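(* Let $f_1,\dots,f_c$ be a regular sequence in a regular local ring $S$ with maximal ideal $\mathfrak m$ and residue field $k$. Let $I=(f_1,\dots,f_c)$, let $R=S/I$, and let $M$ be a finitely generated $R$-module. Let $\mathcal R=k[\chi_1,\dots,\chi_c]$ be the ring of CI operators, where $\chi_i$ acts on $\operatorname{Ext}_R(M,k)=\operatorname{Hom}_k(\operatorname{Tor}^R(M,k),k)$ via the action of the $i$-th CI operator $t_{2,i}$ on $\operatorname{Tor}^R(M,k)$. Suppose that $\operatorname{reg}\operatorname{Ext}_R^{\mathrm{even}}(M,k)=0$ and $\operatorname{reg}\operatorname{Ext}_R^{\mathrm{odd}}(M,k)=1$ as $\mathcal R$-modules. Let $\mathbf T(M)$ be the complex of free $E$-modules whose term in homological degree $i\ge0$ is $$\big(\operatorname{Tor}^R_{2i}(M,k)\otimes_k E\big)\oplus\big(\operatorname{Tor}^R_{2i+1}(M,k)\otimes_k E\big),$$ and whose differential has components $$t_2:\operatorname{Tor}^R_{2i}(M,k)\otimes E\to\operatorname{Tor}^R_{2i-2}(M,k)\otimes E,\qquad t_2:\operatorname{Tor}^R_{2i+1}(M,k)\otimes E\to\operatorname{Tor}^R_{2i-1}(M,k)\otimes E,$$ $$t_3:\operatorname{Tor}^R_{2i+1}(M,k)\otimes E\to\operatorname{Tor}^R_{2i-2}(M,k)\otimes E$$ induced by the CI operators $t_2$ and the higher CI operators $t_3$. Then $\mathbf T(M)$ is a minimal free resolution of $\operatorname{Tor}^S(M,k)$ as a module over $E=\operatorname{Tor}^S(R,k)$. Moreover,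 the upper row (the subcomplex with terms $\operatorname{Tor}^R_{2i}(M,k)\otimes E$ and differential $t_2$) is a minimal free resolution of the submodule $T':=E\cdot\operatorname{Tor}^S_0(M,k)\subset\operatorname{Tor}^S(M,k)$, and the lower row (the quotient complex with terms $\operatorname{Tor}^R_{2i+1}(M,k)\otimes E$ and differential $t_2$) is a minimal free resolution of $T''=\operatorname{Tor}^S(M,k)/T'$.
   Context: Exterior algebra. $E=\bigwedge_k(I/\mathfrak mI)=k\langle e_1,\dots,e_c\rangle=\operatorname{Tor}^S(R,k)$ with $e_i$ the class of $f_i$, of degree 1. If $(\mathbf F,\partial)$ is an $S$-free resolution of $M$ and $\sigma_i$ is a homotopy for $f_i$ on $\mathbf F$ ($\partial\sigma_i+\sigma_i\partial=f_i$), then $e_i$ acts on $\operatorname{Tor}^S(M,k)=H(\mathbf F\otimes k)$ by the map induced by $\sigma_i\otimes1$; this is a well-defined graded $E$-module structure. Left and right graded $E$-modules are identified in the usual way, since $E$ is graded-commutative. CI operators and higher CI operators. Let $\mathbf K=\mathbf K(f_1,\dots,f_c)=\bigwedge S^c$ be the Koszul complex with differential $t_0'$. Let $\mathbf G:\cdots\xrightarrow{t_1'}G_p\xrightarrow{t_1'}G_{p-1}\to\cdots\to G_0$ be a sequence of maps of free $S$-modules such that $R\otimes_S\mathbf G$ is the minimal $R$-free resolution of $M$, so $\operatorname{Tor}_p^R(M,k)=G_p\otimes k$. There are maps $t_i=\sum_{p,q} t_i^{p,q}$ with components $t_i^{p,q}:G_p\otimes K_q\to G_{p-i}\otimes K_{q+i-1}$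 ($i,q\ge0$, $p\ge i$) such that $t_0^{p,q}=1\otimes(-1)^pt_0'$, $t_1=t_1'\otimes1$, each $t_i$ with $i\ge1$ commutes with the (right) action of $\bigwedge S^c$ on $\mathbf K$ (i.e. $t_i(g\otimes x\wedge y)=t_i(g\otimes x)\wedge y$), and $\sum_{i+j=n}t_it_j=0$ for all $n$. Tensoring with $k$, and using $\mathbf K\otimes k=E$, gives the maps $t_2:\operatorname{Tor}^R_p(M,k)\otimes E\to\operatorname{Tor}^R_{p-2}(M,k)\otimes E$ and $t_3:\operatorname{Tor}_p^R(M,k)\otimes E\to\operatorname{Tor}_{p-3}^R(M,k)\otimes E$. The components $t_{2,i}$ of $t_2:G_p\to G_{p-2}\otimes S^c$ with respect to the basis $e_1,\dots,e_c$ of $S^c=K_1$ are (up to sign) the classical CI operators: $R\otimes t_{2,i}$, where $t_1'^2=\sum_if_it_{2,i}$. $\mathcal R$-modules and regularity. $\mathcal R=\operatorname{Sym}_k((I/\mathfrak mI)^\vee)=k[\chi_1,\dots,\chi_c]$ with $\chi_i$ of degree 2. $\operatorname{Ext}^{\mathrm{even}}_R(M,k)=\bigoplus_j\operatorname{Ext}^{2j}_R(M,k)$ and $\operatorname{Ext}_R^{\mathrm{odd}}(M,k)=\bigoplus_j\operatorname{Ext}_R^{2j+1}(M,k)$. Regularity is normalized to account for the degree of the $\chi_i$: for a finitely generated graded $\mathcal R$-module $N$, $\operatorname{reg}N=\sup\{j-2i\mid\operatorname{Tor}_i^{\mathcal R}(N,k)_j\neq0\}$. Thus $\operatorname{reg}\operatorname{Ext}_R^{\mathrm{even}}(M,k)=0$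 means that this (nonzero) module is generated in degree $0$ with linear resolution; $\operatorname{reg}\operatorname{Ext}_R^{\mathrm{odd}}(M,k)=1$ means that this (nonzero) module is generated in degree $1$ with linear resolution. *)

(* Defs.v *)
From HB Require Import structures.
From mathcomp Require Import all_boot all_order all_algebra.
From mathcomp Require Import mpoly.

Set Implicit Arguments.
Unset Strict Implicit.
Unset Printing Implicit Defensive.

Import GRing.Theory.
Local Open Scope ring_scope.

(* Conventions.  Vectors of a free module A^n are rows 'rV[A]_n and matrices
   act on the right.  A quotient ring (R = S/I, k = S/m) is given by a
   surjective ring morphism with the prescribed kernel. *)

(** * Commutative algebra *)

Section Rings.
Variable S : comNzRingType.

Definition is_ideal (J : S -> Prop) : Prop :=
  [/\ J 0, forall x y, J x -> J y -> J (x + y) & forall a x, J x -> J (a * x)].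

Definition ideal_gen n (g : 'I_n -> S) : S -> Prop :=
  fun x => exists a : 'I_n -> S, x = \sum_(i < n) a i * g i.

Definition noetherian : Prop :=
  forall J, is_ideal J ->
    exists n (g : 'I_n -> S), forall x, J x <-> ideal_gen g x.

Definition prime_ideal (J : S -> Prop) : Prop :=
  [/\ is_ideal J, ~ J 1 & forall x y, J (x * y) -> J x \/ J y].

Definition prime_chain (d : nat) : Prop :=
  exists P : nat -> S -> Prop,
    (forall i, (i <= d)%N -> prime_ideal (P i)) /\
    (forall i, (i < d)%N ->
       (forall x, P i x -> P i.+1 x) /\ exists2 x, P i.+1 x & ~ P i x).

Definition krull_dim (d : nat) : Prop :=
  prime_chain d /\ forall e, prime_chain e -> (e <= d)%N.

Definition local_ring (mm : S -> Prop) : Prop :=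
  is_ideal mm /\ forall x, mm x <-> ~ exists y, x * y = 1.

Definition regular_local_ring (mm : S -> Prop) : Prop :=
  [/\ local_ring mm, noetherian &
      exists2 d, krull_dim d &
        exists g : 'I_d -> S, forall x, mm x <-> ideal_gen g x].

Definition regular_sequence c (f : 'I_c -> S) : Prop :=
  (forall (i : 'I_c) x,
     let J y := exists a : 'I_c -> S, y = \sum_(j < c | (j < i)%N) a j * f j in
     J (x * f i) -> J x) /\
  ~ ideal_gen f 1.

Definition quotient_map (A : nzRingType) (phi : {rmorphism S -> A})
    (J : S -> Prop) : Prop :=
  (forall y, exists x, phi x = y) /\ (forall x, phi x = 0 <-> J x).

End Rings.

Definition fin_generated (R : comNzRingType) (M : lmodType R) : Prop :=
  exists n (g : 'I_n -> M), forall x, exists a, x = \sum_(i < n) a i *: g i.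

(** * Complexes of free modules of finite rank *)

Definition exact_complex (A : nzRingType) (n : nat -> nat)
    (d : forall p, 'M[A]_(n p.+1, n p)) : Prop :=
  forall p (v : 'rV[A]_(n p.+1)),
    v *m d p = 0 <-> exists w : 'rV[A]_(n p.+2), v = w *m d p.+1.

(* M is a module over R, regarded as a module over A through phi. *)
Definition free_resolution (A R : comNzRingType) (phi : A -> R)
    (M : lmodType R) (n : nat -> nat) (d : forall p, 'M[A]_(n p.+1, n p))
    (eta : 'rV[A]_(n 0%N) -> M) : Prop :=
  [/\ forall a u v, eta (a *: u + v) = phi a *: eta u + eta v,
      forall x, exists u, eta u = x,
      forall u, eta u = 0 <-> exists w : 'rV[A]_(n 1%N), u = w *m d 0%N &
      exact_complex d].

(* The homology of a complex of vector spaces at place p is cycles / bounds. *)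
Section Homology.
Variables (k : fieldType) (n : nat -> nat).
Variable d : forall p, 'M[k]_(n p.+1, n p).

Definition cycles (p : nat) : 'M[k]_(n p) :=
  match p return 'M[k]_(n p) with
  | 0 => 1%:M
  | q.+1 => kermx (d q)
  end.

Definition bounds (p : nat) : 'M[k]_(n p) := <<d p>>%MS.

End Homology.

Definition homotopies (S : comNzRingType) c (f : 'I_c -> S) (a : nat -> nat)
    (dF : forall n, 'M[S]_(a n.+1, a n))
    (sigma : 'I_c -> forall n, 'M[S]_(a n, a n.+1)) : Prop :=
  forall l, sigma l 0%N *m dF 0%N = (f l)%:M /\
    forall n, sigma l n.+1 *m dF n.+1 + dF n *m sigma l n = (f l)%:M.

(** * Exterior algebra *)

(* ext c V is the tensor product of V with the exterior algebra on e_1,...,e_c: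
   the value of u at A = {a_1 < ... < a_q} is the coefficient of
   e_A = e_{a_1} ^ ... ^ e_{a_q}.  The exterior algebra itself is ext c A. *)
Notation ext c V := {ffun {set 'I_c} -> V}.

Section Exterior.
Variable c : nat.

(* Number of transpositions in e_B ^ e_D = +/- e_(B :|: D), B, D disjoint. *)
Definition inversions (B D : {set 'I_c}) : nat :=
  #|[set x : 'I_c * 'I_c | [&& x.1 \in B, x.2 \in D & (x.2 < x.1)%N]]|.

Variables (A : comNzRingType) (V : lmodType A).

Definition wedge (u : ext c V) (y : ext c A) : ext c V :=
  [ffun C : {set 'I_c} => \sum_(B : {set 'I_c} | B \subset C)
     ((-1) ^+ inversions B (C :\: B) * y (C :\: B)) *: u B].

Definition egen (l : 'I_c) : ext c A := [ffun B => (B == [set l])%:R].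

(* The Koszul differential
   e_{a_1} ^ ... ^ e_{a_q} |-> \sum_i (-1)^(i-1) f_{a_i} e_{... omit a_i ...}. *)
Definition koszul (f : 'I_c -> A) (u : ext c V) : ext c V :=
  [ffun B : {set 'I_c} => \sum_(l | l \notin B)
     ((-1) ^+ #|[set x in B | (x < l)%N]| * f l) *: u (l |: B)].

End Exterior.

Definition ext_basis (A : nzRingType) c m (B : {set 'I_c}) (j : 'I_m) :
    ext c 'rV[A]_m :=
  [ffun B' => if B' == B then delta_mx 0 j else 0].

(* The base change along rho : S -> k of an S-linear map between free modules. *)
Definition ext_base_change (S : comNzRingType) (k : fieldType) (rho : S -> k)
    c m n (h : ext c 'rV[S]_m -> ext c 'rV[S]_n)
    (u : ext c 'rV[k]_m) : ext c 'rV[k]_n :=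
  \sum_(B : {set 'I_c}) \sum_(j < m)
    u B 0 j *: [ffun C => map_mx rho (h (ext_basis S B j) C)].

(** * CI operators *)

(* t p r, for r <= p, is the component G_p (x) K -> G_r (x) K of t_(p-r);
   the values of t for r > p play no role.  With this indexing the sum
   of the t_i t_j for i + j = n is a sum over the intermediate place. *)
Section HigherCI.
Variables (S : comNzRingType) (c : nat) (f : 'I_c -> S) (b : nat -> nat).
Variable d : forall p, 'M[S]_(b p.+1, b p).
Variable t : forall p r : nat,
  {linear ext c 'rV[S]_(b p) -> ext c 'rV[S]_(b r)}.

Definition higher_CI_operators : Prop :=
  [/\ forall p r q (u : ext c 'rV[S]_(b p)), (r <= p)%N ->
        (forall B : {set 'I_c}, u B != 0 -> #|B| = q) ->
        forall B : {set 'I_c}, t p r u B != 0 -> (#|B| + 1 = q + (p - r))%N,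
      forall p u, t p p u = (-1) ^+ p *: koszul f u,
      forall p u, t p.+1 p u = [ffun B => u B *m d p],
      forall p r u y, (r < p)%N -> t p r (wedge u y) = wedge (t p r u) y &
      forall p r u, (r <= p)%N -> \sum_(r <= q < p.+1) t q r (t p q u) = 0].

End HigherCI.

(* The matrix of t_{2,l} (x) k : G_{p+2} (x) k -> G_p (x) k. *)
Definition CI_operator (S : comNzRingType) (k : fieldType) (rho : S -> k)
    c (b : nat -> nat)
    (t : forall p r, ext c 'rV[S]_(b p) -> ext c 'rV[S]_(b r))
    (l : 'I_c) (p : nat) : 'M[k]_(b p.+2, b p) :=
  \matrix_(i, j) rho (t p.+2 p (ext_basis S set0 i) [set l] 0 j).

(** * Graded modules over k[chi_1,...,chi_c], deg chi_l = 2, and regularity *)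

Section Regularity.
Variables (k : fieldType) (c : nat).

(* Degreewise finite graded modules, given by the components 'cV_(rdim j) and
   the operators chi_l.  That these commute is forced by the existence
   of the augmentation in graded_resolution. *)
Record rmod := RMod {
  rdim : nat -> nat;
  rchi : 'I_c -> forall j, 'M[k]_(rdim j.+2, rdim j)
}.

(* Components in even (s = false) or odd (s = true) degrees.  conform_mx is the
   identity here up to the propositional equality of dimensions. *)
Definition parity_part (s : bool) (N : rmod) : rmod :=
  @RMod (fun j => if odd j == s then rdim N j else 0%N)
        (fun l j => conform_mx 0 (rchi N l j)).

Notation RR := {mpoly k[c]}.

(* Elements of degree n in the graded free module on generators of degrees dg. *)
Definition rhomog r (dg : 'I_r -> nat) (n : nat) (v : 'rV[RR]_r) : Prop :=
  forall i, v 0 i != 0 -> exists2 e, n = (dg i + 2 * e)%N & v 0 i \is e.-homog.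

(* aug n is the degree n component of the augmentation. *)
Definition graded_resolution (N : rmod) (r : nat -> nat)
    (dg : forall i, 'I_(r i) -> nat) (D : forall i, 'M[RR]_(r i.+1, r i))
    (aug : forall n, 'rV[RR]_(r 0%N) -> 'cV[k]_(rdim N n)) : Prop :=
  [/\ forall i g, rhomog (@dg i) (@dg i.+1 g) (row g (D i)),
      exact_complex D,
      [/\ forall n u v, aug n (u + v) = aug n u + aug n v,
          forall n a u, aug n (a%:MP_[c] *: u) = a *: aug n u,
          forall l n u, aug n.+2 ('X_l *: u) = rchi N l n *m aug n u &
          forall m n u, rhomog (@dg 0%N) m u -> m <> n -> aug n u = 0],
      forall n x, exists u, aug n u = x &
      forall u, (forall n, aug n u = 0) <-> exists w, u = w *m D 0%N].

(* Tor_i(N, k)_j <> 0, computed from a graded free resolution of N;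
   P (x) k is P modulo the variables. *)
Definition Tor_nonzero (N : rmod) (i j : nat) : Prop :=
  exists r dg D aug, @graded_resolution N r dg D aug /\
    let Dk p := map_mx (mcoeff 0%MM) (D p) in
    exists v : 'rV[k]_(r i),
      [/\ forall g, v 0 g != 0 -> dg i g = j,
          (v <= cycles Dk i)%MS & ~~ (v <= bounds Dk i)%MS].

(* reg N = s; the supremum, being an integer, is attained. *)
Definition has_regularity (N : rmod) (s : int) : Prop :=
  (forall i j, Tor_nonzero N i j -> (j%:Z - 2 * i%:Z <= s)%R) /\
  (exists i j, Tor_nonzero N i j /\ j%:Z - 2 * i%:Z = s).

End Regularity.

(* Ext_R^p(M,k) = Hom_k(G_p (x) k, k): a column phi is the functional
   v |-> v *m phi, so chi_l phi = phi o t_{2,l} is the left product. *)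
Definition Ext_R (S : comNzRingType) (k : fieldType) (rho : S -> k)
    c (b : nat -> nat)
    (t : forall p r, ext c 'rV[S]_(b p) -> ext c 'rV[S]_(b r)) : rmod k c :=
  @RMod k c b (CI_operator rho t).

(** * Graded modules over the exterior algebra E and their free resolutions *)

Section ExteriorModules.
Variables (k : fieldType) (c : nat).

(* Graded right E-modules presented as subquotients: the component of degree n
   is gcyc n / gbnd n (row spaces in k^(gdim n)), and right multiplication by
   e_l is induced by gact l n. *)
Record gmod := GMod {
  gdim : nat -> nat;
  gcyc : forall n, 'M[k]_(gdim n);
  gbnd : forall n, 'M[k]_(gdim n);
  gact : 'I_c -> forall n, 'M[k]_(gdim n, gdim n.+1)
}.

Definition is_Emodule (N : gmod) : Prop :=
  [/\ forall n, (gbnd N n <= gcyc N n)%MS,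
      forall l n, (gcyc N n *m gact N l n <= gcyc N n.+1)%MS,
      forall l n, (gbnd N n *m gact N l n <= gbnd N n.+1)%MS,
      forall l n, (gcyc N n *m (gact N l n *m gact N l n.+1)
                     <= gbnd N n.+2)%MS &
      forall l l' n, (gcyc N n *m (gact N l n *m gact N l' n.+1 +
                                   gact N l' n *m gact N l n.+1)
                     <= gbnd N n.+2)%MS].

(* Elements of degree n in k^r (x) E, the graded free E-module whose generators
   have degrees dg. *)
Definition ehomog r (dg : 'I_r -> nat) (n : nat) (u : ext c 'rV[k]_r) : Prop :=
  forall B i, u B 0 i != 0 -> (dg i + #|B| = n)%N.

(* Minimality: d maps into F E_+, the elements with no coefficient at e_set0. *)
Definition minimal_exact_complex (r : nat -> nat)
    (dg : forall i, 'I_(r i) -> nat)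
    (d : forall i, ext c 'rV[k]_(r i.+1) -> ext c 'rV[k]_(r i)) : Prop :=
  [/\ forall i, linear (d i),
      forall i u y, d i (wedge u y) = wedge (d i u) y,
      forall i n u, ehomog (@dg i.+1) n u -> ehomog (@dg i) n (d i u),
      forall i u, d i u = 0 <-> exists w, u = d i.+1 w &
      forall i u, d i u set0 = 0].

(* eps n u represents the degree n component of the image of u. *)
Definition augmentation r0 r1 (dg : 'I_r0 -> nat)
    (d : ext c 'rV[k]_r1 -> ext c 'rV[k]_r0) (N : gmod)
    (eps : forall n, ext c 'rV[k]_r0 -> 'rV[k]_(gdim N n)) : Prop :=
  [/\ (forall n, linear (eps n)) /\ (forall n u, (eps n u <= gcyc N n)%MS),
      forall m n u, ehomog dg m u -> m <> n -> (eps n u <= gbnd N n)%MS,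
      forall l n u, (eps n.+1 (wedge u (egen k l)) - eps n u *m gact N l n
                       <= gbnd N n.+1)%MS,
      forall n (z : 'rV[k]_(gdim N n)), (z <= gcyc N n)%MS ->
        exists u, (z - eps n u <= gbnd N n)%MS &
      forall u, (forall n, (eps n u <= gbnd N n)%MS) <-> exists w, u = d w].

Definition minimal_free_resolution (r : nat -> nat)
    (dg : forall i, 'I_(r i) -> nat)
    (d : forall i, ext c 'rV[k]_(r i.+1) -> ext c 'rV[k]_(r i)) (N : gmod)
    (eps : forall n, ext c 'rV[k]_(r 0%N) -> 'rV[k]_(gdim N n)) : Prop :=
  [/\ is_Emodule N, minimal_exact_complex dg d &
      augmentation (@dg 0%N) (d 0%N) eps].

(* N_0 . E, degree by degree. *)
Fixpoint gen_by_degree0 (N : gmod) (n : nat) : 'M[k]_(gdim N n) :=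
  match n return 'M[k]_(gdim N n) with
  | 0 => gcyc N 0%N
  | p.+1 => (gbnd N p.+1 +
             \sum_(l < c) <<gen_by_degree0 N p *m gact N l p>>)%MS
  end.

Definition sub_degree0 (N : gmod) : gmod :=
  @GMod (gdim N) (gen_by_degree0 N) (gbnd N) (gact N).

Definition quo_degree0 (N : gmod) : gmod :=
  @GMod (gdim N) (gcyc N) (gen_by_degree0 N) (gact N).

End ExteriorModules.

(* Tor^S(M,k) = H(F (x) k).  The left action of e_l is induced by sigma_l; the
   right action is x e_l = (-1)^(deg x) e_l x. *)
Definition Tor_S (S : comNzRingType) (k : fieldType) (rho : S -> k) c
    (a : nat -> nat) (dF : forall n, 'M[S]_(a n.+1, a n))
    (sigma : 'I_c -> forall n, 'M[S]_(a n, a n.+1)) : gmod k c :=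
  let dk n := map_mx rho (dF n) in
  @GMod k c a (cycles dk) (bounds dk)
        (fun l n => (-1) ^+ n *: map_mx rho (sigma l n)).

(** * The complex T(M) *)

(* Tor^R_p(M,k) (x) E is ext c 'rV[k]_(b p), since Tor^R_p(M,k) = G_p (x) k. *)
Section TComplex.
Variables (S : comNzRingType) (k : fieldType) (rho : S -> k).
Variables (c : nat) (b : nat -> nat).
Variable t : forall p r, ext c 'rV[S]_(b p) -> ext c 'rV[S]_(b r).

Definition tk p r : ext c 'rV[k]_(b p) -> ext c 'rV[k]_(b r) :=
  ext_base_change rho (@t p r).

Definition ext_pair m n (u : ext c 'rV[k]_m) (v : ext c 'rV[k]_n) :
    ext c 'rV[k]_(m + n) :=
  [ffun B => row_mx (u B) (v B)].
Definition ext_fst m n (u : ext c 'rV[k]_(m + n)) : ext c 'rV[k]_m :=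
  [ffun B => lsubmx (u B)].
Definition ext_snd m n (u : ext c 'rV[k]_(m + n)) : ext c 'rV[k]_n :=
  [ffun B => rsubmx (u B)].

Definition up_rank i : nat := b i.*2.
Definition low_rank i : nat := b i.*2.+1.
Definition T_rank i : nat := (up_rank i + low_rank i)%N.

(* A generator of Tor_p sitting in homological degree i of T(M) has internal
   degree p - i, which makes t_2, t_3 and the augmentation homogeneous. *)
Definition up_deg i : 'I_(up_rank i) -> nat := fun=> i.
Definition low_deg i : 'I_(low_rank i) -> nat := fun=> i.+1.
Definition T_deg i (g : 'I_(T_rank i)) : nat :=
  match split g with inl g => up_deg g | inr g => low_deg g end.

Definition up_diff i :
    ext c 'rV[k]_(up_rank i.+1) -> ext c 'rV[k]_(up_rank i) :=
  @tk i.+1.*2 i.*2.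
Definition low_diff i :
    ext c 'rV[k]_(low_rank i.+1) -> ext c 'rV[k]_(low_rank i) :=
  @tk i.+1.*2.+1 i.*2.+1.
Definition T_diff i (u : ext c 'rV[k]_(T_rank i.+1)) : ext c 'rV[k]_(T_rank i) :=
  ext_pair (up_diff (ext_fst u) + @tk i.+1.*2.+1 i.*2 (ext_snd u))
           (low_diff (ext_snd u)).

End TComplex.

(* Main.v *)
(* The total complex P of G (x) K, with differential the sum of the t_i, is an
   S-free resolution of M, and u |-> (-1)^n u ^ e_l is a homotopy for f_l on it.
   Comparing P with F identifies Tor^S(M,k), as an E-module, with the homology of
   P (x) k, where t_0 and t_1 vanish.  Linearity of the resolution of
   Ext^even (Ext^odd) says that the Koszul homology of chi_1, ..., chi_c on it
   vanishes in degrees > 0 (> 1); dually, t_2 is exact on Tor^R(M,k) (x) E except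
   at the places 0 and 1.  Subtracting boundaries one can therefore clear all
   components of a cycle of P (x) k at places p >= 2, so that the homology is
   generated by the places 0 and 1, with relations t_2 w_2 + t_3 w_3 and t_2 w_3;
   this is the augmented complex T(M).  The image of place 0 is E Tor_0. *)

Require Import Defs.
From HB Require Import structures.
From mathcomp Require Import all_boot all_order all_algebra.
From mathcomp Require Import mpoly.
From Stdlib Require Import IndefiniteDescription.

Set Implicit Arguments.
Unset Strict Implicit.
Unset Printing Implicit Defensive.

Import GRing.Theory.
Local Open Scope ring_scope.

(** * Comparison of free resolutions *)

(** Regularity is read off a free resolution over k[chi], while t_2 is dual to the Koszul
    differential of the chi_l on Ext. The passage between them is the balancing of Tor, carried out
    on elements: an exterior degree is traded for a step up the resolution. The component N_j in
    exterior degree q has internal degree j + 2q, so the bound s + 2q on Tor_q gives Koszul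
    exactness for all j > s, whatever q; the values s = 0 and s = 1 on the two parities leave
    precisely the places 0 and 1.

    G is only a sequence of maps over S; it becomes a complex after reduction to R. Acyclicity of P
    is therefore proved along the place p: the summand with K_0 uses the resolution over R, all
    others the Koszul complex of f.

    Modulo the maximal ideal the relations on the t_i begin with t_2 t_2 = 0 and t_2 t_3 + t_3 t_2 =
    0. The second one glues the two exact rows into an exact complex. It also shows that t_3 w_3
    with t_2 w_3 = 0 is a t_2-boundary, so that T' has no relations beyond those of the upper
    row. *)

Lemma dependent_choice (X : nat -> Type) (P : forall n, X n -> Prop)
    (Q : forall n, X n -> X n.+1 -> Prop) :
    (exists x, P 0%N x) ->
    (forall n x, P n x -> exists2 y, Q n x y & P n.+1 y) ->
  exists s : forall n, X n, P 0%N (s 0%N) /\ forall n, Q n (s n) (s n.+1).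
Proof.
move=> /constructive_indefinite_description [x0 Px0] step.
have st n (x : {x : X n | P n x}) :
    {y : {y : X n.+1 | P n.+1 y} | Q n (sval x) (sval y)}.
  apply: constructive_indefinite_description.
  by have [y qy py] := step n _ (svalP x); exists (exist _ y py).
pose s := fix s n : {x : X n | P n x} :=
  match n with 0 => exist _ x0 Px0 | m.+1 => sval (st m (s m)) end.
exists (fun n => sval (s n)); split=> [//|n].
exact: svalP (st n (s n)).
Qed.

Section Comparison.
Variable S : comNzRingType.

Lemma row_factor m n p (M : 'M[S]_(m, p)) (N : 'M[S]_(n, p)) :
    (forall v : 'rV_m, exists w, v *m M = w *m N) ->
  exists W, M = W *m N.
Proof.
move=> h; have /fin_all_exists [w hw] i : exists w, row i M = w *m N.
  by have [w e] := h (delta_mx 0 i); exists w; rewrite rowE.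
exists (\matrix_i w i); apply/row_matrixP => i.
by rewrite hw row_mul rowK.
Qed.

Lemma exact_factor n (d : forall p, 'M[S]_(n p.+1, n p)) p m
    (M : 'M[S]_(m, n p.+1)) :
  exact_complex d -> M *m d p = 0 -> exists W, M = W *m d p.+1.
Proof.
move=> ex M0; apply: row_factor => v.
by apply/(ex p (v *m M)); rewrite -mulmxA M0 mulmx0.
Qed.

Lemma exact_dd n (d : forall p, 'M[S]_(n p.+1, n p)) p :
  exact_complex d -> d p.+1 *m d p = 0.
Proof.
move=> ex; apply/row_matrixP => i; rewrite row_mul row0.
by apply/ex; exists (delta_mx 0 i); rewrite rowE.
Qed.

(** Exactness is asked of the target alone, which may be a shifted complex; this is how maps that
    raise the degree are treated later. *)
Lemma null_homotopy x y (dX : forall p, 'M[S]_(x p.+1, x p))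
    (dY : forall p, 'M[S]_(y p.+1, y p)) (g : forall p, 'M[S]_(x p, y p)) :
    (forall p, dX p.+1 *m dX p = 0) -> exact_complex dY ->
    (forall p, dX p *m g p = g p.+1 *m dY p) ->
    (exists h, g 0%N = h *m dY 0%N) ->
  exists h : forall p, 'M[S]_(x p, y p.+1), g 0%N = h 0%N *m dY 0%N /\
    forall p, g p.+1 = h p.+1 *m dY p.+1 + dX p *m h p.
Proof.
move=> ddX exY comm [h0 gh0].
(* [dependent_choice] hands back P only at 0, so the equation in degree 0 is stored there behind the
   guard [p = 0]; the second clause lets exactness supply the next matrix. *)
pose P p (h : 'M[S]_(x p, y p.+1)) :=
  (p = 0%N -> g p = h *m dY p) /\ (g p.+1 - dX p *m h) *m dY p = 0.
pose Q p (h : 'M[S]_(x p, y p.+1)) (h' : 'M[S]_(x p.+1, y p.+2)) :=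
  g p.+1 = h' *m dY p.+1 + dX p *m h.
have [||h [[/(_ erefl) ? _] ?]] := @dependent_choice _ P Q; last by exists h.
  by exists h0; split=> //; rewrite mulmxBl -mulmxA -gh0 comm subrr.
move=> p h [_ /(exact_factor exY)[h' e]]; exists h'.
  by rewrite /Q -e subrK.
split=> //; rewrite mulmxBl -comm -mulmxA -e.
by rewrite mulmxBr mulmxA ddX mul0mx subr0 subrr.
Qed.

End Comparison.

Section NullHomotopicTensor.
Variables (S : comNzRingType) (k : fieldType) (rho : {rmorphism S -> k}).
Variables (x y : nat -> nat) (dX : forall p, 'M[S]_(x p.+1, x p)).
Variables (dY : forall p, 'M[S]_(y p.+1, y p)) (g : forall p, 'M[S]_(x p, y p)).

Lemma null_homotopic_homology :
    (forall p, dX p.+1 *m dX p = 0) -> exact_complex dY ->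
    (forall p, dX p *m g p = g p.+1 *m dY p) ->
    (exists h, g 0%N = h *m dY 0%N) ->
  forall p, (cycles (fun p => map_mx rho (dX p)) p *m map_mx rho (g p)
               <= map_mx rho (dY p))%MS.
Proof.
move=> ddX exY comm h0 [|p] /=.
  by have [h ->] := h0; rewrite mul1mx map_mxM submxMl.
have [h [_ ->]] := null_homotopy ddX exY comm h0.
by rewrite map_mxD !map_mxM mulmxDr mulmxA addmx_sub ?submxMl //
   mulmxA mulmx_ker mul0mx sub0mx.
Qed.

End NullHomotopicTensor.

Section ChainMap.
Variables (S R : comNzRingType) (pi : {rmorphism S -> R}) (M : lmodType R).

Lemma aug_linear n (eta : 'rV[S]_n -> M) :
    (forall a u v, eta (a *: u + v) = pi a *: eta u + eta v) ->
  [/\ eta 0 = 0, forall u v, eta (u + v) = eta u + eta v,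
      forall u v, eta (u - v) = eta u - eta v &
      forall a u, eta (a *: u) = pi a *: eta u].
Proof.
move=> h.
have h0 : eta 0 = 0.
  by have := h (-1) 0 0; rewrite scaler0 addr0 rmorphN1 scaleN1r addNr.
have hZ a u : eta (a *: u) = pi a *: eta u.
  by rewrite -[a *: u]addr0 h h0 addr0.
have hD u v : eta (u + v) = eta u + eta v.
  by rewrite -[u]scale1r h rmorph1 !scale1r.
by split=> // u v; rewrite hD -[- v]scaleN1r hZ rmorphN1 scaleN1r.
Qed.

Lemma chain_map x y (dX : forall p, 'M[S]_(x p.+1, x p)) etaX
    (dY : forall p, 'M[S]_(y p.+1, y p)) etaY :
    @free_resolution S R pi M x dX etaX -> @free_resolution S R pi M y dY etaY ->
  exists F : forall p, 'M[S]_(x p, y p),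
    (forall u, etaY (u *m F 0%N) = etaX u) /\
    forall p, dX p *m F p = F p.+1 *m dY p.
Proof.
move=> [/aug_linear[X0 XD XB XZ] Xs Xk exX] [/aug_linear[Y0 YD YB YZ] Ys Yk exY].
(* Compatibility with the augmentations has content only at p = 0; since P ranges over all p it is
   stated through casts along [0 = p], removed by [castmx_id]. *)
pose P p (F : 'M[S]_(x p, y p)) :=
  (forall e : 0%N = p, forall u : 'rV_(x 0%N),
     etaY (u *m castmx (f_equal x (esym e), f_equal y (esym e)) F) = etaX u) /\
  exists N, dX p *m F = N *m dY p.
pose Q p (F : 'M[S]_(x p, y p)) (F' : 'M[S]_(x p.+1, y p.+1)) :=
  dX p *m F = F' *m dY p.
have [||F [[/(_ erefl) h _] ?]] := @dependent_choice _ P Q; last first.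
- by exists F; split=> // u; rewrite -h castmx_id.
- move=> p F [_ [N e]]; exists N; first exact: e.
  split=> //; apply: (exact_factor exY).
  by rewrite -mulmxA -e mulmxA exact_dd // mul0mx.
have /fin_all_exists [w hw] i := Ys (etaX (delta_mx 0 i)).
have h0 u : etaY (u *m \matrix_i w i) = etaX u.
  rewrite {2}[u]row_sum_delta mulmx_sum_row.
  rewrite !(big_morph _ YD Y0) (big_morph _ XD X0); apply: eq_bigr => i _.
  by rewrite YZ XZ rowK hw.
exists (\matrix_i w i); split=> [e u|].
  by rewrite (eq_irrelevance e erefl) castmx_id h0.
apply: row_factor => v; rewrite mulmxA; apply/Yk; rewrite h0.
by apply/Xk; exists v.
Qed.

End ChainMap.

Section Quasi.
Variables (S R : comNzRingType) (pi : {rmorphism S -> R}) (M : lmodType R).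
Variables (k : fieldType) (rho : {rmorphism S -> k}).
Variables (c : nat) (f : 'I_c -> S).

Local Notation tens d := (fun p => map_mx rho (d p)).

Lemma cycles_mulmx n (d : forall p, 'M[k]_(n p.+1, n p)) p
    (v : 'rV[k]_(n p.+1)) :
  (v <= cycles d p.+1)%MS = (v *m d p == 0).
Proof. exact: sub_kermx. Qed.

(** [1 - F] lifts the zero map of M, hence is null-homotopic and induces zero on homology after
    tensoring with k. *)
Lemma endomorphism_homology x (d : forall p, 'M[S]_(x p.+1, x p)) eta
    (F : forall p, 'M[S]_(x p, x p)) :
    @free_resolution S R pi M x d eta ->
    (forall u, eta (u *m F 0%N) = eta u) ->
    (forall p, d p *m F p = F p.+1 *m d p) ->
  forall p (v : 'rV_(x p)), (v <= cycles (tens d) p)%MS ->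
    (v - v *m map_mx rho (F p) <= map_mx rho (d p))%MS.
Proof.
move=> [/aug_linear[_ _ etaB _] _ etak ex] F0 Fd p v vc.
have dd q := exact_dd q ex.
rewrite -[v in v - _]mulmx1 -mulmxBr -(map_mx1 rho) -map_mxB.
apply: submx_trans (submxMr _ vc) _.
apply: (@null_homotopic_homology _ _ rho _ _ d d (fun p => 1%:M - F p)) => //.
  by move=> q; rewrite mulmxBr mulmxBl Fd mulmx1 mul1mx.
apply: row_factor => u; rewrite mulmxBr mulmx1.
by apply/etak; rewrite etaB F0 subrr.
Qed.

(** The third and fourth clauses are injectivity and surjectivity on homology, obtained from a chain
    map in the other direction. The last one is E-linearity; it holds modulo boundaries only,
    because the homotopies on the two resolutions are chosen independently. *)
Lemma comparison x y (dX : forall p, 'M[S]_(x p.+1, x p)) etaX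
    (dY : forall p, 'M[S]_(y p.+1, y p)) etaY sX sY :
    @free_resolution S R pi M x dX etaX -> homotopies f dX sX ->
    @free_resolution S R pi M y dY etaY -> homotopies f dY sY ->
  exists F : forall p, 'M[k]_(x p, y p),
  [/\ forall p (v : 'rV_(x p)), (v <= cycles (tens dX) p)%MS ->
        (v *m F p <= cycles (tens dY) p)%MS,
      forall p (v : 'rV_(x p)), (v <= bounds (tens dX) p)%MS ->
        (v *m F p <= bounds (tens dY) p)%MS,
      forall p (v : 'rV_(x p)), (v <= cycles (tens dX) p)%MS ->
        (v *m F p <= bounds (tens dY) p)%MS -> (v <= bounds (tens dX) p)%MS,
      forall p (z : 'rV_(y p)), (z <= cycles (tens dY) p)%MS ->
        exists2 v : 'rV_(x p), (v <= cycles (tens dX) p)%MS &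
          (z - v *m F p <= bounds (tens dY) p)%MS &
      forall l p (v : 'rV_(x p)), (v <= cycles (tens dX) p)%MS ->
        (v *m map_mx rho (sX l p) *m F p.+1 - v *m F p *m map_mx rho (sY l p)
          <= bounds (tens dY) p.+1)%MS].
Proof.
move=> resX sXf resY sYf.
have [F [F0 Fd]] := chain_map resX resY.
have [G [G0 Gd]] := chain_map resY resX.
have [_ _ _ exX] := resX; have [_ _ _ exY] := resY.
have ddX q := exact_dd q exX.
have cyc m n (dM : forall p, 'M[S]_(m p.+1, m p))
    (dN : forall p, 'M[S]_(n p.+1, n p)) (H : forall p, 'M[S]_(m p, n p)) :
    (forall p, dM p *m H p = H p.+1 *m dN p) -> forall p (v : 'rV_(m p)),
    (v <= cycles (tens dM) p)%MS -> (v *m map_mx rho (H p) <= cycles (tens dN) p)%MS.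
  move=> Hd [|p] v; first by move=> _; exact: submx1.
  rewrite !cycles_mulmx -mulmxA -map_mxM -Hd map_mxM mulmxA => /eqP->.
  by rewrite mul0mx.
have bnd m n (dM : forall p, 'M[S]_(m p.+1, m p))
    (dN : forall p, 'M[S]_(n p.+1, n p)) (H : forall p, 'M[S]_(m p, n p)) :
    (forall p, dM p *m H p = H p.+1 *m dN p) -> forall p (v : 'rV_(m p)),
    (v <= bounds (tens dM) p)%MS -> (v *m map_mx rho (H p) <= bounds (tens dN) p)%MS.
  move=> Hd p v; rewrite !genmxE => /submxP[w ->].
  by rewrite -mulmxA -map_mxM Hd map_mxM mulmxA submxMl.
exists (fun p => map_mx rho (F p)); split=> [||p v vc vFb|p z zc|l p v vc].
- exact: cyc.
- exact: bnd.
- have := @endomorphism_homology _ _ _ (fun p => F p *m G p) resX _ _ p v vc.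
  rewrite map_mxM mulmxA genmxE => h.
  rewrite -[v](subrK (v *m map_mx rho (F p) *m map_mx rho (G p))) addmx_sub //.
    apply: h => [u|q]; first by rewrite mulmxA G0 F0.
    by rewrite mulmxA Fd -mulmxA Gd mulmxA.
  by have := bnd _ _ _ _ _ Gd _ _ vFb; rewrite genmxE.
- exists (z *m map_mx rho (G p)); first exact: cyc.
  have := @endomorphism_homology _ _ _ (fun p => G p *m F p) resY _ _ p z zc.
  rewrite map_mxM mulmxA genmxE => h; apply: h => [u|q].
    by rewrite mulmxA F0 G0.
  by rewrite mulmxA Gd -mulmxA Fd mulmxA.
rewrite -!mulmxA -mulmxBr -!map_mxM -map_mxB genmxE.
apply: submx_trans (submxMr _ vc) _.
have [sX0 sXS] := sXf l; have [sY0 sYS] := sYf l.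
(* [sX] and [sY] are homotopies for the same [f l], so [sX F - F sY] anticommutes with the
   differentials; the sign on the shifted [dY] turns it into a chain map, null-homotopic by
   exactness of Y. *)
have := @null_homotopic_homology _ _ rho _ _ dX (fun p => - dY p.+1)
  (fun p => sX l p *m F p.+1 - F p *m sY l p) ddX.
move=> h; apply: submx_trans (h _ _ _ p) _; last first.
- by rewrite map_mxN -scaleN1r scalemx_sub.
- suff [h0 ->] : exists h0, sX l 0%N *m F 1%N - F 0%N *m sY l 0%N = h0 *m dY 1%N.
    by exists (- h0); rewrite mulmxN mulNmx opprK.
  apply: (exact_factor exY).
  rewrite mulmxBl -!mulmxA -Fd [sX l 0%N *m _]mulmxA sX0 sY0.
  by rewrite scalar_mxC subrr.
- move=> q; rewrite mulmxN mulmxBl -!mulmxA -Fd [sX l q.+1 *m _]mulmxA.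
  have /(canRL (addrK _)) -> := sYS q.
  have /(canRL (addrK _)) -> := sXS q.
  rewrite mulmxBl !mulmxBr scalar_mxC !mulmxA Fd.
  by rewrite opprB [X in _ = _ + X]opprB [RHS]addrC addrA subrK.
- move=> q v0; split=> [e|[w ->]].
    have /(exY q.+1 v0) [w ->] : v0 *m dY q.+1 = 0.
      by rewrite -[LHS]opprK -mulmxN e oppr0.
    by exists (- w); rewrite mulmxN mulNmx opprK.
  by rewrite !mulmxN mulNmx opprK -mulmxA exact_dd // mulmx0.
Qed.

End Quasi.

(** * The exterior algebra action on Tor over S *)

Section TorModule.
Variables (S : comNzRingType) (k : fieldType) (rho : {rmorphism S -> k}).
Variables (c : nat) (f : 'I_c -> S) (a : nat -> nat).
Variables (d : forall n, 'M[S]_(a n.+1, a n)).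
Variable sigma : 'I_c -> forall n, 'M[S]_(a n, a n.+1).
Hypotheses (exd : exact_complex d) (hsigma : homotopies f d sigma).
Hypothesis rhof : forall l, rho (f l) = 0.

Local Notation dk := (fun p => map_mx rho (d p)).
Local Notation sk l n := (map_mx rho (sigma l n)).

(** The defect of a product of two homotopies from being a chain map of degree 2 is antisymmetric in
    l and l', so it disappears from anticommutators and from squares. *)
Lemma homotopy_product0 l l' : sigma l 0%N *m sigma l' 1%N *m d 1%N =
  f l' *: sigma l 0%N - f l *: sigma l' 0%N.
Proof.
have [s0 _] := hsigma l; have [_ s1] := hsigma l'.
rewrite -mulmxA; have /(canRL (addrK _)) -> := s1 0%N.
by rewrite mulmxBr mulmxA s0 mul_mx_scalar mul_scalar_mx.
Qed.

Lemma homotopy_productS l l' p : sigma l p.+1 *m sigma l' p.+2 *m d p.+2 =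
  f l' *: sigma l p.+1 - f l *: sigma l' p.+1 +
  d p *m (sigma l p *m sigma l' p.+1).
Proof.
have [_ s] := hsigma l; have [_ s1] := hsigma l'.
rewrite -mulmxA; have /(canRL (addrK _)) -> := s1 p.+1.
rewrite mulmxBr [_ *m (d _ *m _)]mulmxA.
have /(canRL (addrK _)) -> := s p.
rewrite mulmxBl mul_mx_scalar mul_scalar_mx opprB mulmxA.
by rewrite [RHS]addrAC addrA.
Qed.

Lemma Tor_anticomm l l' n :
  (cycles dk n *m (sk l n *m sk l' n.+1 + sk l' n *m sk l n.+1) <= dk n.+2)%MS.
Proof.
rewrite -!map_mxM -map_mxD.
apply: (@null_homotopic_homology _ _ rho a (fun n => a n.+2) d
  (fun n => d n.+2) (fun n => sigma l n *m sigma l' n.+1 +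
     sigma l' n *m sigma l n.+1)) => [q|q v|q|].
- exact: exact_dd.
- exact: exd.
- rewrite mulmxDl !homotopy_productS addrACA -mulmxDr.
  by rewrite addrA subrK subrr add0r.
apply: (exact_factor exd).
by rewrite mulmxDl !homotopy_product0 addrA subrK subrr.
Qed.

(** Squares are treated apart from anticommutators, which say nothing about them in characteristic
    2. *)
Lemma Tor_square0 l n : (cycles dk n *m (sk l n *m sk l n.+1) <= dk n.+2)%MS.
Proof.
rewrite -!map_mxM.
apply: (@null_homotopic_homology _ _ rho a (fun n => a n.+2) d
  (fun n => d n.+2) (fun n => sigma l n *m sigma l n.+1)) => [q|q v|q|].
- exact: exact_dd.
- exact: exd.
- by rewrite homotopy_productS subrr add0r.
by apply: (exact_factor exd); rewrite homotopy_product0 subrr.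
Qed.

Lemma tensor_homotopy0 l : sk l 0%N *m dk 0%N = 0.
Proof.
have [s0 _] := hsigma l; rewrite -map_mxM s0 map_scalar_mx rhof.
by apply/matrixP => i j; rewrite !mxE mul0rn.
Qed.

Lemma tensor_homotopyS l n : sk l n.+1 *m dk n.+1 = - (dk n *m sk l n).
Proof.
have [_ s] := hsigma l; apply/eqP; rewrite -addr_eq0 -!map_mxM -map_mxD s.
by rewrite map_scalar_mx rhof; apply/eqP/matrixP => i j; rewrite !mxE mul0rn.
Qed.

Lemma Tor_S_Emodule : is_Emodule (Tor_S rho d sigma).
Proof.
split=> [n|l n|l n|l n|l l' n] /=.
- rewrite genmxE; case: n => [|n]; first exact: submx1.
  by apply/sub_kermxP; rewrite -map_mxM exact_dd // map_mx0.
- rewrite -scalemxAr scalemx_sub //; apply/sub_kermxP.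
  case: n => [|n]; first by rewrite mul1mx tensor_homotopy0.
  by rewrite -mulmxA tensor_homotopyS mulmxN mulmxA mulmx_ker mul0mx oppr0.
- rewrite -scalemxAr scalemx_sub // genmxE.
  rewrite (eqmxMr _ (genmxE _)).
  by rewrite -[_ *m _]opprK -tensor_homotopyS -mulNmx submxMl.
- rewrite -scalemxAl -!scalemxAr !scalemx_sub // genmxE.
  exact: Tor_square0.
rewrite -!scalemxAl -!scalemxAr -!scalerDr -!scalemxAr !scalemx_sub // genmxE.
exact: Tor_anticomm.
Qed.

End TorModule.

(** * The Koszul complex of a regular sequence *)

Section Koszul.
Variables (A : comNzRingType) (c : nat) (V : lmodType A).
Implicit Types (f : 'I_c -> A) (u v : {ffun {set 'I_c} -> V}) (B C : {set 'I_c}).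

Lemma ext_addE u v B : (u + v) B = u B + v B. Proof. by rewrite ffunE. Qed.
Lemma ext_subE u v B : (u - v) B = u B - v B. Proof. by rewrite !ffunE. Qed.
Lemma ext_scaleE a u B : (a *: u) B = a *: u B. Proof. by rewrite ffunE. Qed.
Lemma ext_0E B : (0 : {ffun {set 'I_c} -> V}) B = 0. Proof. by rewrite ffunE. Qed.

Lemma card_below_setU1 B (m l : 'I_c) : m \notin B ->
  #|[set x in m |: B | (x < l)%N]| = ((m < l) + #|[set x in B | (x < l)%N]|)%N.
Proof.
move=> mB; case: (ltnP m l) => ml.
  have -> : [set x in m |: B | (x < l)%N] = m |: [set x in B | (x < l)%N].
    by apply/setP => x; rewrite !inE; case: (x =P m) => // ->.
  by rewrite cardsU1 inE (negbTE mB).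
rewrite add0n; apply: eq_card => x; rewrite !inE; case: (x =P m) => // ->.
by rewrite ltnNge ml (negbTE mB).
Qed.

Lemma koszul_is_linear f : linear (@koszul c A V f).
Proof.
move=> a u v; apply/ffunP => B; rewrite !ffunE scaler_sumr -big_split /=.
apply: eq_bigr => l _; rewrite !ffunE scalerDr !scalerA; congr (_ *: _ + _).
by rewrite mulrC.
Qed.

HB.instance Definition _ f := GRing.isLinear.Build A
  {ffun {set 'I_c} -> V} {ffun {set 'I_c} -> V} _ (@koszul c A V f)
  (koszul_is_linear f).

Lemma koszul_koszul f u : koszul f (koszul f u) = 0.
Proof.
apply/ffunP => B; rewrite [LHS]ffunE [RHS]ffunE.
under eq_bigr => l _ do rewrite ffunE scaler_sumr.
(* Each pair of indices is removed in two orders; swapping the pair matches one order with the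
   other, and the signs are opposite. *)
rewrite pair_big_dep /= (bigID (fun x : 'I_c * 'I_c => (x.1 < x.2)%N)) /=.
rewrite [X in _ + X](reindex_inj (h := fun x => (x.2, x.1))) /=; last first.
  by move=> [x1 x2] [y1 y2] [-> ->].
rewrite [X in _ + X](eq_bigl (fun x : 'I_c * 'I_c =>
    (x.1 \notin B) && (x.2 \notin x.1 |: B) && (x.1 < x.2)%N)); last first.
  move=> [x y] /=; rewrite !inE !negb_or -leqNgt leq_eqVlt val_eqE (eq_sym y x).
  by case: eqP => [->|] /=; rewrite ?ltnn ?andbF //=; do 2! case: (_ \in B).
rewrite -big_split big1 //= => -[l m] /= /andP[/andP[lB]].
rewrite !inE negb_or => /andP[ml mB] lm.
rewrite setUCA !scalerA -scalerDl !card_below_setU1 // lm (ltnNge m l) (ltnW lm) /=.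
rewrite add0n add1n exprS mulN1r [X in _ + X]mulrACA [X in X + _]mulrACA.
by rewrite mulrN mulNr [f m * _]mulrC [X in _ + X * _]mulrC addNr scale0r.
Qed.

Definition supported (J : {set 'I_c}) u := forall B, ~~ (B \subset J) -> u B = 0.

Lemma koszul_supported f J u : supported J u -> supported J (koszul f u).
Proof.
move=> uJ B BJ; rewrite ffunE big1 // => l lB; rewrite uJ ?scaler0 //.
by apply: contra BJ; apply: subset_trans; rewrite subsetUr.
Qed.

Definition regular_on f := forall (i : 'I_c) (x : V),
  (exists w, f i *: x = \sum_(j < c | (j < i)%N) f j *: w j) ->
  exists w, x = \sum_(j < c | (j < i)%N) f j *: w j.

(* [adjoin l v w] stands for w + e_l ^ v, where w and v do not involve e_l. *)
Definition adjoin (l : 'I_c) (v w : {ffun {set 'I_c} -> V}) :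
    {ffun {set 'I_c} -> V} :=
  [ffun B : {set 'I_c} => if l \in B then v (B :\ l) else w B].

Section Adjoin.
Variables (f : 'I_c -> A) (l : 'I_c) (v w : {ffun {set 'I_c} -> V}).
Let J := [set x : 'I_c | (x < l)%N].
Hypotheses (vJ : supported J v) (wJ : supported J w).

Lemma notin_below B : B \subset J -> l \notin B.
Proof. by move=> /subsetP BJ; apply/negP => /BJ; rewrite inE ltnn. Qed.

(** Every index of J lies below l, so removing l from [l |: B] carries the sign (-1)^#|B|, while
    removing an element of J carries the same sign with or without l. *)
Lemma koszul_adjoin0 B : B \subset J ->
  koszul f (adjoin l v w) B = koszul f w B + ((-1) ^+ #|B| * f l) *: v B.
Proof.
move=> BJ; have lB := notin_below BJ.
rewrite !ffunE (bigD1 l) //= [in RHS](bigD1 l) //= addrC.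
rewrite wJ; last by apply: contraL lB => /notin_below; rewrite setU11.
rewrite scaler0 add0r ffunE setU11 setU1K //; congr (_ + _); last first.
  congr ((_ ^+ _ * _) *: _); apply: eq_card => x; rewrite !inE andb_idr //.
  by move/(subsetP BJ); rewrite inE.
apply: eq_bigr => m /andP[mB ml]; rewrite ffunE !inE eq_sym (negbTE ml) /=.
by rewrite (negbTE lB).
Qed.

Lemma koszul_adjoin1 B : B \subset J ->
  koszul f (adjoin l v w) (l |: B) = koszul f v B.
Proof.
move=> BJ; have lB := notin_below BJ.
rewrite !ffunE [in RHS](bigD1 l) //= vJ ?scaler0 ?add0r; last first.
  by apply: contraL lB => /notin_below; rewrite setU11.
apply: eq_big => m; first by rewrite !inE negb_or andbC.
rewrite !inE negb_or => /andP[ml mB].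
rewrite ffunE setUCA setU11 setU1K; last by rewrite !inE negb_or eq_sym ml.
rewrite card_below_setU1 //; case: (ltnP l m) => // lm.
rewrite vJ ?scaler0 //; apply/negP => /subsetP/(_ m).
by rewrite setU11 inE ltnNge (ltnW lm) => /(_ isT).
Qed.

End Adjoin.

(** The sign in [koszul_adjoin0] depends on #|B|; on inhomogeneous elements it becomes this
    involution, which anticommutes with the differential. *)
Definition alternate v : {ffun {set 'I_c} -> V} :=
  [ffun B : {set 'I_c} => (-1) ^+ #|B| *: v B].

Lemma koszul_alternate f v : koszul f (alternate v) = - alternate (koszul f v).
Proof.
apply/ffunP => B; rewrite !ffunE scaler_sumr -sumrN; apply: eq_bigr => l lB.
rewrite ffunE cardsU1 lB exprS mulN1r scaleNr scalerN !scalerA.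
by congr (- (_ *: _)); rewrite mulrC mulrA.
Qed.

Lemma koszul_drop0 f u :
  koszul f [ffun B : {set 'I_c} => if B == set0 then 0 else u B] = koszul f u.
Proof.
apply/ffunP => B; rewrite !ffunE; apply: eq_bigr => m _; rewrite ffunE.
case: eqP => // /setP/(_ m); by rewrite !inE eqxx.
Qed.

(* Induction on i: write u = b + e_i ^ a.  Then a is a cycle whose component at
   the empty set becomes a boundary by regularity, and after correcting a the
   remaining part of u is a cycle in the first i variables. *)
Lemma koszul_acyclic_below f : regular_on f -> forall i u, (i <= c)%N ->
    supported [set x : 'I_c | (x < i)%N] u -> u set0 = 0 -> koszul f u = 0 ->
  exists2 w, supported [set x : 'I_c | (x < i)%N] w & u = koszul f w.
Proof.
move=> reg; elim=> [|i IH] u ic uJ u0 ku.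
  exists 0 => [B _|]; first by rewrite ffunE.
  rewrite linear0; apply/ffunP => B; rewrite ffunE.
  have [->//|/set0Pn[x xB]] := eqVneq B set0.
  by apply: uJ; apply/subsetPn; exists x; rewrite ?inE.
pose l := Ordinal ic; set J' := [set x : 'I_c | (x < i.+1)%N].
pose J := [set x : 'I_c | (x < i)%N].
have J'E B : l \notin B -> (B \subset J') = (B \subset J).
  move=> lB; apply/subsetP/subsetP => h x xB; have := h x xB;
    rewrite !inE; last exact: leqW.
  rewrite ltnS leq_eqVlt => /predU1P[e|//].
  by case/negP: lB; rewrite (_ : l = x) //; apply: val_inj.
have J'U B : B \subset J -> l |: B \subset J'.
  move=> /subsetP h; apply/subsetP => x; rewrite !inE => /predU1P[->//|/h].
  by rewrite inE; exact: leqW.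
have J'D B : B \subset J' -> B :\ l \subset J.
  move=> h; rewrite -J'E ?setD11 //; exact: subset_trans (subsetDl _ _) h.
pose a : {ffun {set 'I_c} -> V} :=
  [ffun B : {set 'I_c} => if B \subset J then u (l |: B) else 0].
pose b : {ffun {set 'I_c} -> V} :=
  [ffun B : {set 'I_c} => if B \subset J then u B else 0].
have aJ : supported J a by move=> B; rewrite ffunE => /negbTE->.
have bJ : supported J b by move=> B; rewrite ffunE => /negbTE->.
have uE : u = adjoin l a b.
  apply/ffunP => B; rewrite !ffunE; have [lB|lB] := boolP (l \in B).
    case: (boolP (B :\ l \subset J)) => h; first by rewrite setD1K.
    by rewrite uJ //; apply: contra h => /J'D.
  by case: ifP => // h; rewrite uJ // J'E // h.
have ka : koszul f a = 0.
  apply/ffunP => B; rewrite [RHS]ffunE; have [BJ|] := boolP (B \subset J).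
    by rewrite -(@koszul_adjoin1 f l a b) // -uE ku ffunE.
  exact: koszul_supported.
have kb : koszul f b = - (f l *: alternate a).
  apply/ffunP => B; have [BJ|nBJ] := boolP (B \subset J).
    have := @koszul_adjoin0 f l a b bJ B BJ; rewrite -uE ku ffunE => /eqP.
    by rewrite eq_sym addr_eq0 => /eqP->; rewrite !ffunE scalerA mulrC.
  rewrite (koszul_supported f bJ) // !ffunE.
  by rewrite (negbTE nBJ) !scaler0 oppr0.
have [y ay yJ] : exists2 y, a set0 = koszul f y set0 & supported J y.
  have [|w aE] := reg l (a set0).
    exists (fun j => - b [set j]).
    have h : koszul f b set0 = - (f l *: a set0).
      by rewrite kb !ffunE cards0 scale1r.
    apply: (@oppr_inj V); rewrite -h ffunE -sumrN.
    rewrite (bigID (fun j : 'I_c => (j < i)%N)) /= [X in _ + X]big1 ?addr0.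
      apply: eq_big => [j|j _]; first by rewrite inE.
      rewrite setU0 scalerN opprK (_ : [set x in _ | _] = set0) ?cards0 ?mul1r //.
      by apply/setP => x; rewrite !inE.
    move=> j /andP[_ ji]; rewrite ffunE setU0 sub1set inE (negbTE ji).
    by rewrite scaler0.
  exists [ffun B : {set 'I_c} => \sum_(j < c | (j < i)%N && (B == [set j])) w j].
    rewrite aE ffunE [RHS](bigID (fun j : 'I_c => (j < i)%N)) /=.
    rewrite [X in _ + X]big1 ?addr0 => [|j /andP[_ ji]].
      apply: eq_big => [j|j ji]; first by rewrite inE.
      rewrite ffunE (big_pred1 j) => [|m]; last first.
        rewrite setU0 (inj_eq set1_inj) [LHS]andbC /= eq_sym.
        by case: eqP => // ->.
      rewrite (_ : [set x in _ | _] = set0) ?cards0 ?mul1r //.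
      by apply/setP => x; rewrite !inE.
    rewrite ffunE big_pred0 ?scaler0 // => m; rewrite setU0 (inj_eq set1_inj).
    by case: eqP => [<-|]; rewrite ?andbF // (negbTE ji).
  move=> B nB; rewrite ffunE big_pred0 // => m; apply/negP => /andP[mi /eqP BE].
  by case/negP: nB; rewrite BE sub1set inE.
have [|||z zJ az] := IH (a - koszul f y) (ltnW ic).
- by move=> B nB; rewrite ext_subE aJ // sub0r (koszul_supported f yJ nB) oppr0.
- by rewrite ext_subE ay subrr.
- by rewrite linearB /= ka koszul_koszul subrr.
(* The component at [set0] does not enter [koszul]. Deleting it keeps [koszul f a' = a] and makes
   [b - f l *: alternate a'] vanish at [set0], as the induction hypothesis requires. *)
pose a' : {ffun {set 'I_c} -> V} :=
  [ffun B : {set 'I_c} => if B == set0 then 0 else (z + y) B].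
have a'J : supported J a'.
  move=> B nB; rewrite ffunE; case: ifP => // _.
  by rewrite ffunE zJ // yJ // addr0.
have ka' : koszul f a' = a.
  by rewrite -[a](subrK (koszul f y)) az -linearD /= koszul_drop0.
have [|||w wJ bw] := IH (b - f l *: alternate a') (ltnW ic).
- move=> B nB; rewrite ext_subE ext_scaleE bJ // [alternate _ _]ffunE a'J //.
  by rewrite !scaler0 subrr.
- by rewrite !ffunE eqxx sub0set u0 !scaler0 subrr.
- rewrite linearB linearZ /= koszul_alternate ka' kb scalerN opprK.
  exact: addNr.
exists (adjoin l a' w) => [B nB|].
  rewrite ffunE; case: ifP => lB; [apply: a'J|apply: wJ]; apply: contra nB => h.
    by rewrite -(setD1K lB) J'U.
  by rewrite J'E ?lB.
apply/ffunP => B; have [BJ|nB] := boolP (B \subset J'); last first.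
  rewrite uJ // (@koszul_supported f J') // => C nC.
  rewrite ffunE; case: ifP => lC; [apply: a'J|apply: wJ]; apply: contra nC => h.
    by rewrite -(setD1K lC) J'U.
  by rewrite J'E ?lC.
have [lB|lB] := boolP (l \in B).
  rewrite -(setD1K lB) koszul_adjoin1 ?J'D // ka' ffunE J'D //.
rewrite koszul_adjoin0 -?J'E // -bw !ffunE -J'E // BJ scalerA.
by rewrite [f l * _]mulrC subrK.
Qed.

Lemma koszul_acyclic f u :
  regular_on f -> u set0 = 0 -> koszul f u = 0 -> exists w, u = koszul f w.
Proof.
move=> reg u0 ku; have [|w _ ->] := koszul_acyclic_below reg (leqnn c) _ u0 ku.
- by move=> B /subsetPn[x _]; rewrite inE ltn_ord.
- by exists w.
Qed.

End Koszul.

(** * Exterior multiplication and the Leibniz rule *)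

Section Wedge.
Variables (A : comNzRingType) (c : nat) (V : lmodType A).
Implicit Types (u v w : {ffun {set 'I_c} -> V}) (y z : {ffun {set 'I_c} -> A}).
Implicit Types (B C D : {set 'I_c}) (l : 'I_c).

Lemma wedge_linearl y : linear (fun u => wedge u y).
Proof.
move=> a u v; apply/ffunP => C; rewrite !ffunE scaler_sumr -big_split /=.
by apply: eq_bigr => B _; rewrite !ffunE scalerDr !scalerA mulrC.
Qed.

Lemma wedge0l y : wedge (0 : {ffun {set 'I_c} -> V}) y = 0.
Proof.
by apply/ffunP => C; rewrite !ffunE big1 // => B _; rewrite ffunE scaler0.
Qed.

Lemma wedgeDl u v y : wedge (u + v) y = wedge u y + wedge v y.
Proof. by rewrite -[u]scale1r wedge_linearl !scale1r. Qed.

Lemma wedgeZl a u y : wedge (a *: u) y = a *: wedge u y.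
Proof. by rewrite -[_ *: u]addr0 wedge_linearl wedge0l addr0. Qed.

Lemma inversions_set1r B l : inversions B [set l] = #|[set x in B | (l < x)%N]|.
Proof.
have inj : injective (fun x : 'I_c => (x, l)) by move=> x y [].
rewrite -(card_imset _ inj); apply: eq_card => -[x y]; rewrite !inE /=.
apply/and3P/imsetP => [[xB /eqP-> lx]|[z zB [-> ->]]].
  by exists x; rewrite ?inE ?xB.
by move: zB; rewrite inE => /andP[].
Qed.

Lemma inversions_set1l D l : inversions [set l] D = #|[set x in D | (x < l)%N]|.
Proof.
have inj : injective (fun x : 'I_c => (l, x)) by move=> x y [].
rewrite -(card_imset _ inj); apply: eq_card => -[x y]; rewrite !inE /=.
apply/and3P/imsetP => [[/eqP-> xB lx]|[z zB [-> ->]]].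
  by exists y; rewrite ?inE ?xB.
by move: zB; rewrite inE => /andP[].
Qed.

Lemma inversions_set0l D : inversions set0 D = 0%N.
Proof. by apply: eq_card0 => x; rewrite !inE. Qed.

Lemma wedge_egen u l C : wedge u (egen A l) C =
  if l \in C then (-1) ^+ #|[set x in C | (l < x)%N]| *: u (C :\ l) else 0.
Proof.
have D1 B : B \subset C -> (C :\: B == [set l]) = (l \in C) && (B == C :\ l).
  move=> BC; apply/eqP/andP => [e|[lC /eqP->]].
    have lCB : l \in C :\: B by rewrite e set11.
    split; first by move: lCB; rewrite inE => /andP[].
    by rewrite -e setDDr setDv set0U (setIidPr BC).
  by rewrite setDDr setDv set0U; apply/setIidPr; rewrite sub1set.
rewrite ffunE; case: ifP => lC; last first.
  by rewrite big1 // => B /D1; rewrite !ffunE lC /= => ->; rewrite mulr0 scale0r.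
rewrite (bigD1 (C :\ l)) ?subsetDl //= ffunE D1 ?subsetDl // lC eqxx mulr1.
rewrite big1 ?addr0 => [|B /andP[BC ne]]; last first.
  by rewrite ffunE D1 // (negbTE ne) andbF mulr0 scale0r.
have/eqP-> : C :\: (C :\ l) == [set l] by rewrite D1 ?subsetDl // lC /=.
rewrite inversions_set1r; congr (_ ^+ _ *: _); apply: eq_card => x.
by rewrite !inE; case: eqP => [->|]; rewrite ?ltnn ?andbF.
Qed.

Lemma wedge_scalar (x : V) y C :
  wedge [ffun B : {set 'I_c} => if B == set0 then x else 0] y C = y C *: x.
Proof.
rewrite ffunE (bigD1 set0) ?sub0set //= ffunE eqxx inversions_set0l setD0 mul1r.
by rewrite big1 ?addr0 // => B /andP[_ /negbTE n]; rewrite ffunE n scaler0.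
Qed.

Lemma wedge_vector w y C : (forall B, #|B| != 1%N -> w B = 0) ->
  wedge w y C = \sum_(l in C) ((-1) ^+ #|[set x in C :\ l | (x < l)%N]| *
                               y (C :\ l)) *: w [set l].
Proof.
move=> w1; rewrite ffunE (bigID (fun B : {set 'I_c} => #|B| == 1%N)) /=.
rewrite [X in _ + X]big1 ?addr0 => [|B /andP[_ /w1->]]; last by rewrite scaler0.
transitivity (\sum_(B in [set [set l] | l in C]) 
   ((-1) ^+ inversions B (C :\: B) * y (C :\: B)) *: w B).
  apply: eq_bigl => B; apply/andP/imsetP => [[BC /cards1P[l e]]|[l lC ->]].
    by exists l => //; rewrite -sub1set -e.
  by rewrite sub1set lC cards1.
rewrite big_imset /=; last by move=> l m _ _; exact: set1_inj.
by apply: eq_bigr => l _; rewrite inversions_set1l.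
Qed.

Definition extdeg q u := forall B, u B != 0 -> #|B| = q.

Lemma extdegE q u B : extdeg q u -> #|B| != q -> u B = 0.
Proof. by move=> h; apply: contraNeq => /h->. Qed.

Lemma koszul_extdeg (f : 'I_c -> A) q u : extdeg q.+1 u -> extdeg q (koszul f u).
Proof.
move=> h B; apply: contraNeq => Bq; rewrite ffunE big1 // => l lB.
by rewrite (extdegE h) ?scaler0 // cardsU1 lB.
Qed.

Lemma koszul_extdeg0 (f : 'I_c -> A) u : extdeg 0 u -> koszul f u = 0.
Proof.
move=> h; apply/ffunP => B; rewrite !ffunE big1 // => l lB.
by rewrite (extdegE h) ?scaler0 // cardsU1 lB.
Qed.

(* Leibniz rule: the Koszul differential maps e_l to f_l. *)
Lemma koszul_wedge_egen (f : 'I_c -> A) q u l : extdeg q u ->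
  koszul f (wedge u (egen A l)) =
  wedge (koszul f u) (egen A l) + ((-1) ^+ q * f l) *: u.
Proof.
move=> h; apply/ffunP => B; rewrite ext_addE wedge_egen ext_scaleE.
rewrite [LHS]ffunE; case: ifP => lB; last first.
  rewrite (bigD1 l) ?lB //= big1 ?addr0 => [|m /andP[mB ml]]; last first.
    by rewrite wedge_egen !inE eq_sym (negbTE ml) lB scaler0.
  rewrite wedge_egen setU11 setU1K ?lB // add0r.
  have [->|/h e] := eqVneq (u B) 0; first by rewrite !scaler0.
  rewrite scalerA mulrAC -exprD; congr ((_ ^+ _ * _) *: _); rewrite -e.
  rewrite -(cardsID [set x : 'I_c | (x < l)%N] B); congr (_ + _)%N; apply: eq_card => x.
    by rewrite !inE.
  rewrite !inE -leqNgt [in RHS]leq_eqVlt val_eqE (eq_sym l).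
  by case: eqP => [->|] /=; rewrite ?ltnn ?lB ?andbF // andbC.
(* For l in B, the term of [koszul f u (B :\ l)] at the index l gives back [u B] and cancels the
   extra summand of the Leibniz rule; the other terms match index by index. *)
rewrite ffunE scaler_sumr [in RHS](bigD1 l) ?setD11 //= setD1K //.
rewrite addrAC -[LHS]add0r; congr (_ + _).
  have [->|/h e] := eqVneq (u B) 0; first by rewrite !scaler0 addr0.
  rewrite scalerA -scalerDl mulrA -exprD -mulrDl.
  rewrite [X in X + _](_ : _ = - (-1) ^+ q); first by rewrite addNr mul0r scale0r.
  rewrite -e (cardsD1 l B) lB add1n exprS mulN1r opprK; congr (_ ^+ _).
  rewrite -[in RHS](cardsID [set x : 'I_c | (l < x)%N] (B :\ l)); congr (_ + _)%N.
    by apply: eq_card => x; rewrite !inE; case: eqP => [->|]; rewrite ?ltnn ?andbF.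
  apply: eq_card => x; rewrite !inE -leqNgt [in RHS]leq_eqVlt val_eqE.
  by case: eqP => [->|] /=; rewrite ?ltnn ?andbF // andbC.
apply: eq_big => m; first by rewrite !inE negb_and negbK;
  case: (m =P l) => [->|]; rewrite ?lB ?andbF ?andbT.
move=> mB; rewrite wedge_egen !inE lB orbT !scalerA.
have ml : m != l by apply: contraNneq mB => ->.
rewrite [m |: B :\ l](_ : _ = (m |: B) :\ l); last first.
  by apply/setP => x; rewrite !inE; case: (x =P m) => // ->; rewrite ml.
congr (_ *: _); rewrite mulrAC -!exprD mulrA -exprD; congr (_ * _).
rewrite (_ : [set x in m |: B | _] =
  (if (l < m)%N then [set m] else set0) :|: [set x in B | (l < x)%N]); last first.
  apply/setP => x; case: (ltnP l m) => lm; rewrite !inE;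
  by case: (x =P m) => //= ->; rewrite ?lm ?(leq_gtF lm) ?andbF.
have -> : #|[set x in B | (x < m)%N]| = ((l < m) + #|[set x in B :\ l | (x < m)%N]|)%N.
  by rewrite -card_below_setU1 ?setD11 ?setD1K.
case: ltnP => _; last by rewrite set0U add0n addnC.
rewrite cardsU1 !inE (negbTE mB) addnACA exprD sqrrN expr1n mul1r.
by rewrite addnC.
Qed.

End Wedge.

(** * Regularity and Koszul homology *)

Section MpolyRegular.
Variables (k : fieldType) (c : nat).
Local Notation RR := {mpoly k[c]}.

Lemma mcoeffXM (j : 'I_c) (p : RR) m :
  ('X_j * p)@_m = if (0 < m j)%N then p@_(m - U_(j))%MM else 0.
Proof.
rewrite mulrC; case: ltnP => mj.
  rewrite -[m in LHS](@submK _ U_(j) m) 1?addmC ?mcoeffMX //.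
  by apply/mnm_lepP => i; rewrite mnm1E; case: eqP => // <-.
apply/eqP; rewrite mcoeff_eq0; apply/negP => /msuppM_le.
rewrite msuppX => /allpairsP[[m1 m2] /= [_]]; rewrite inE => /eqP-> e.
by move: mj; rewrite e mnmDE mnm1E eqxx addn1.
Qed.

(** An ideal generated by variables is monomial, so membership can be tested on each monomial;
    regularity of the variables then becomes a statement about exponents. *)
Lemma mpoly_sum_variables (P : pred 'I_c) (p : RR) :
  (exists w, p = \sum_(j | P j) 'X_j * w j) <->
  forall m, p@_m != 0 -> exists2 j, P j & (0 < m j)%N.
Proof.
split=> [[w ->] m|h].
  rewrite raddf_sum /= => nz.
  case: (boolP [exists j, P j && (0 < m j)%N]) => [/existsP[j /andP[]]|].
    by exists j.
  rewrite negb_exists => /forallP n; case/eqP: nz; rewrite big1 // => j Pj.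
  by have := n j; rewrite mcoeffXM Pj /= => /negbTE->.
(* Each monomial is charged to one variable dividing it, the one returned by [pick], so that none is
   counted twice. *)
pose w j := \sum_(m <- msupp p | [pick i | P i && (0 < m i)%N] == Some j)
              p@_m *: 'X_[m - U_(j)] : RR.
exists w; rewrite {1}[p]mpolyE.
under [RHS]eq_bigr => j _ do rewrite mulr_sumr.
rewrite [RHS](exchange_big_dep predT) //= big_seq [RHS]big_seq; apply: eq_bigr => m.
rewrite mcoeff_msupp => /h [i Pi mi]; case: pickP => [j /andP[Pj mj]|/(_ i)].
  rewrite (big_pred1 j) => [|l]; last first.
    by apply/andP/eqP => [[_ /eqP[->]]|->].
  rewrite -scalerAr mulrC -mpolyXD submK //.
  by apply/mnm_lepP => l; rewrite mnm1E; case: eqP => // <-.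
by rewrite Pi mi.
Qed.

Lemma row_sum_variables (P : pred 'I_c) r (x : 'rV[RR]_r) :
  (exists w : 'I_c -> 'rV[RR]_r, x = \sum_(j | P j) 'X_j *: w j) <->
  forall g m, (x 0 g)@_m != 0 -> exists2 j, P j & (0 < m j)%N.
Proof.
split=> [[w xE] g|h].
  apply/mpoly_sum_variables; exists (fun j => w j 0 g).
  by rewrite xE summxE; apply: eq_bigr => j _; rewrite mxE.
have /fin_all_exists [w hw] g : exists w, x 0 g = \sum_(j | P j) 'X_j * w j.
  by apply/mpoly_sum_variables => m; apply: h.
exists (fun j => \row_g w g j); apply/rowP => g; rewrite hw summxE.
by apply: eq_bigr => j _; rewrite !mxE.
Qed.

Lemma variables_regular r : regular_on 'rV[RR]_r (fun l : 'I_c => 'X_l).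
Proof.
move=> i x /row_sum_variables h; apply/row_sum_variables => g m nz.
have := h g (m + U_(i))%MM; rewrite mxE mulrC addmC mcoeffMX => /(_ nz) [j ji].
by rewrite mnmDE mnm1E; case: eqP ji => [->|]; rewrite ?ltnn ?addn0 // => _; exists j.
Qed.

Lemma koszul_variables_surj r (x : 'rV[RR]_r) : map_mx (mcoeff 0%MM) x = 0 ->
  exists v, koszul (fun l : 'I_c => 'X_l) v =
    [ffun B : {set 'I_c} => if B == set0 then x else 0].
Proof.
move=> /rowP x0.
have [|w xE] := (row_sum_variables predT x).2.
  move=> g m nz; have [m0|] := eqVneq m 0%MM.
    by have := x0 g; rewrite !mxE -m0 => e; rewrite e eqxx in nz.
  rewrite -mdeg_eq0 mdegE sum_nat_eq0 => /forall_inPn [j _ mj].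
  by exists j; rewrite // lt0n.
exists [ffun B : {set 'I_c} => \sum_(j | B == [set j]) w j].
apply/ffunP => B; rewrite !ffunE; case: eqP => [->|/eqP/set0Pn[i iB]].
  rewrite xE; apply: eq_big => [l|l _]; first by rewrite inE.
  rewrite ffunE setU0 (big_pred1 l) => [|j]; last by rewrite (inj_eq set1_inj) eq_sym.
  rewrite (_ : [set y in _ | _] = set0) ?cards0 ?mul1r //.
  by apply/setP => y; rewrite !inE.
rewrite big1 // => l lB; rewrite ffunE big_pred0 ?scaler0 // => j.
apply/eqP => /setP e; have := e l; have := e i; rewrite !inE eqxx iB orbT.
by move=> /esym/eqP eij /esym/eqP elj; rewrite elj -eij iB in lB.
Qed.

End MpolyRegular.

(** * Homogeneous components in graded free modules over the polynomial ring *)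

Section HomogeneousParts.
Variables (k : fieldType) (c : nat).
Local Notation RR := {mpoly k[c]}.

Lemma rhomogP r (dg : 'I_r -> nat) n (v : 'rV[RR]_r) :
  rhomog dg n v <-> forall g m, (v 0 g)@_m != 0 -> (dg g + 2 * mdeg m = n)%N.
Proof.
split=> [h g m nz|h g nz].
  have [|e -> /dhomogP he] := h g.
    by apply: contraNneq nz => ->; rewrite mcoeff0.
  by rewrite he // mcoeff_msupp.
exists (mdeg (mlead (v 0 g))).
  by rewrite (h g) // -mcoeff_msupp mlead_supp.
apply/dhomogP => m; rewrite mcoeff_msupp => /h e.
have := h g (mlead (v 0 g)); rewrite -mcoeff_msupp mlead_supp // => /(_ isT).
by rewrite -e => /addnI/eqP; rewrite eqn_mul2l /= => /eqP ->.
Qed.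

Definition hpart r (dg : 'I_r -> nat) n (v : 'rV[RR]_r) : 'rV[RR]_r :=
  \row_g \sum_(m <- msupp (v 0 g) | (dg g + 2 * mdeg m == n)%N)
    (v 0 g)@_m *: 'X_[m].

Lemma mcoeff_hpart r (dg : 'I_r -> nat) n v g m :
  (hpart dg n v 0 g)@_m = if (dg g + 2 * mdeg m == n)%N then (v 0 g)@_m else 0.
Proof.
rewrite mxE raddf_sum /=.
under eq_bigr => m' _ do rewrite mcoeffZ mcoeffX.
have [ms|] := boolP (m \in msupp (v 0 g)).
  case: ifP => e.
    rewrite (big_rem m) //= e eqxx mulr1 big_seq_cond big1 ?addr0 // => m'.
    rewrite mem_rem_uniq ?msupp_uniq // inE => /andP[/andP[/negbTE-> _] _].
    by rewrite mulr0.
  rewrite big1 // => m' /eqP e'; case: eqP => [mm|_]; last by rewrite mulr0.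
  by rewrite -mm e' eqxx in e.
move=> ms; rewrite (memN_msupp_eq0 ms) if_same big_seq_cond big1 // => m' /andP[m's _].
by case: eqP => [e|_]; [rewrite -e m's in ms|rewrite mulr0].
Qed.

Lemma hpart_rhomog r (dg : 'I_r -> nat) n v : rhomog dg n (hpart dg n v).
Proof.
apply/rhomogP => g m; rewrite mcoeff_hpart; case: ifP => [/eqP//|_].
by rewrite eqxx.
Qed.

Lemma hpart_id r (dg : 'I_r -> nat) n v : rhomog dg n v -> hpart dg n v = v.
Proof.
move/rhomogP=> h; apply/rowP => g; apply/mpolyP => m; rewrite mcoeff_hpart.
by case: eqP => // ne; have [->//|/h] := eqVneq ((v 0 g)@_m) 0.
Qed.

(** The number of summands may be any large N', so that the sum can be made long enough to include a
    prescribed degree. *)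
Lemma hpart_sum r (dg : 'I_r -> nat) (v : 'rV[RR]_r) :
  exists N, forall N', (N <= N')%N -> v = \sum_(n < N') hpart dg n v.
Proof.
exists (\max_g (dg g + 2 * msize (v ord0 g)))%N => N' NN.
apply/rowP => g; apply/mpolyP => m; rewrite summxE raddf_sum /=.
under eq_bigr => n _ do rewrite mcoeff_hpart.
have [->|nz] := eqVneq ((v 0 g)@_m) 0.
  by rewrite big1 // => n _; rewrite if_same.
have lt : (dg g + 2 * mdeg m < N')%N.
  apply: leq_trans NN; apply: leq_trans (leq_bigmax g).
  by rewrite ltn_add2l ltn_mul2l msize_mdeg_lt // mcoeff_msupp.
rewrite (bigD1 (Ordinal lt)) //= eqxx big1 ?addr0 // => n /eqP ne.
by case: eqP => // e; case: ne; apply: val_inj.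
Qed.

Lemma hpart_mulmx r r' (dg : 'I_r -> nat) (dg' : 'I_r' -> nat)
    (D : 'M[RR]_(r', r)) n w :
    (forall g, rhomog dg (dg' g) (row g D)) ->
  hpart dg n (w *m D) = hpart dg' n w *m D.
Proof.
move=> hD; apply/rowP => g; apply/mpolyP => m; rewrite mcoeff_hpart !mxE.
rewrite !raddf_sum /=.
transitivity (\sum_j (if (dg g + 2 * mdeg m == n)%N then (w 0 j * D j g)@_m else 0)).
  by case: ifP => // _; rewrite big1.
apply: eq_bigr => j _; rewrite !mcoeffM.
transitivity (\sum_(kk : 'X_{1..c < (mdeg m).+1, (mdeg m).+1} | m == (kk.1 + kk.2)%MM)
   (if (dg g + 2 * mdeg m == n)%N then (w 0 j)@_kk.1 * (D j g)@_kk.2 else 0)).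
  by case: ifP => // _; rewrite big1.
apply: eq_bigr => kk /eqP mE; rewrite mcoeff_hpart.
have [->|nz] := eqVneq ((D j g)@_kk.2) 0; first by rewrite !mulr0 if_same.
have /rhomogP/(_ g kk.2) := hD j; rewrite mxE => /(_ nz) <-.
rewrite -addnA -mulnDr [(mdeg kk.2 + _)%N]addnC -mdegD -mE.
by case: ifP; rewrite ?mul0r.
Qed.

Lemma rhomogX r (dg : 'I_r -> nat) n (v : 'rV[RR]_r) l :
  rhomog dg n v -> rhomog dg n.+2 ('X_l *: v).
Proof.
move=> /rhomogP h; apply/rhomogP => g m; rewrite mxE mcoeffXM.
case: ltnP => [ml|]; rewrite ?eqxx // => /h <-.
rewrite -[m in LHS](@submK _ U_(l) m) ?mdegD ?mdeg1 ?mulnDr ?addnA ?addn2 //.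
by apply/mnm_lepP => i; rewrite mnm1E; case: eqP => // <-.
Qed.

Lemma rhomog0 r (dg : 'I_r -> nat) n : rhomog dg n (0 : 'rV[RR]_r).
Proof. by move=> g; rewrite mxE eqxx. Qed.

Lemma rhomogD r (dg : 'I_r -> nat) n (u v : 'rV[RR]_r) :
  rhomog dg n u -> rhomog dg n v -> rhomog dg n (u + v).
Proof.
move=> /rhomogP hu /rhomogP hv; apply/rhomogP => g m; rewrite mxE mcoeffD.
by have [->|/hu //] := eqVneq ((u 0 g)@_m) 0; rewrite add0r => /hv.
Qed.

Lemma rhomogZ r (dg : 'I_r -> nat) n a (v : 'rV[RR]_r) :
  rhomog dg n v -> rhomog dg n ((-1) ^+ a *: v).
Proof.
move=> /rhomogP hv; apply/rhomogP => g m; rewrite mxE -signr_odd.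
by case: odd; rewrite ?expr1 ?mulN1r ?mul1r ?mcoeffN ?oppr_eq0 => /hv.
Qed.

End HomogeneousParts.

Section ColKoszul.
Variables (k : fieldType) (c : nat).

(** Unlike in [koszul], the operators are not scalars on one module: chi_l maps the component of
    degree j to that of degree j + 2, hence the two dimensions. *)
Definition col_koszul n0 n2 (X : 'I_c -> 'M[k]_(n2, n0)) (u : ext c 'cV[k]_n0) :
    ext c 'cV[k]_n2 :=
  [ffun B : {set 'I_c} => \sum_(l | l \notin B)
     (-1) ^+ #|[set x in B | (x < l)%N]| *: (X l *m u (l |: B))].

End ColKoszul.

Section KoszulHomology.
Variables (k : fieldType) (c : nat) (N : rmod k c).
Local Notation RR := {mpoly k[c]}.
Local Notation X := (fun l : 'I_c => 'X_l : RR).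

Local Notation chi_koszul := (col_koszul (fun l => rchi N l _)).

Variables (r : nat -> nat) (dg : forall i, 'I_(r i) -> nat).
Variables (D : forall i, 'M[RR]_(r i.+1, r i)).
Variable aug : forall n, 'rV[RR]_(r 0%N) -> 'cV[k]_(rdim N n).
Hypothesis res : graded_resolution dg D aug.
Variable s : nat.
Local Notation Dk := (fun p => map_mx (mcoeff 0%MM) (D p)).
Hypothesis tor : forall i j (v : 'rV[k]_(r i)), (s + 2 * i < j)%N ->
  (forall g, v 0 g != 0 -> dg g = j) ->
  (v <= cycles Dk i)%MS -> (v <= bounds Dk i)%MS.

Definition ext_mulmx p (u : ext c 'rV[RR]_(r p.+1)) : ext c 'rV[RR]_(r p) :=
  [ffun B : {set 'I_c} => u B *m D p].

Lemma koszul_ext_mulmx p (u : ext c 'rV[RR]_(r p.+1)) :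
  koszul X (ext_mulmx u) = ext_mulmx (koszul X u).
Proof.
apply/ffunP => B; rewrite !ffunE mulmx_suml; apply: eq_bigr => l _.
by rewrite ffunE -scalemxAl.
Qed.

Lemma rhomog_koszul p n (u : ext c 'rV[RR]_(r p)) :
    (forall B, rhomog (@dg p) n (u B)) ->
  forall B, rhomog (@dg p) n.+2 (koszul X u B).
Proof.
move=> h B; rewrite ffunE; elim/big_rec: _ => [|l x _ hx]; first exact: rhomog0.
by apply: rhomogD hx; rewrite -scalerA; apply/rhomogZ/rhomogX.
Qed.

(** The invariant of the induction in [koszul_cokernel]: a Koszul boundary has no constant terms, so
    if [z D] is one, the constant terms of z form a cycle of D (x) k. At p = 0 there is no preceding
    term and everything is a cycle. *)
Definition dies_below p : ext c 'rV[RR]_(r p) -> Prop :=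
  match p with
  | 0 => fun _ => True
  | p'.+1 => fun z => exists y, ext_mulmx z = koszul X y
  end.

(* Exactness of the Koszul complex of coker D_p, for those classes which become
   trivial in the Koszul complex of the preceding free module. *)
Lemma koszul_cokernel q p m (z : ext c 'rV[RR]_(r p)) : (s + 2 * p < m)%N ->
    extdeg q z -> (forall B, rhomog (@dg p) m (z B)) ->
    (exists z', koszul X z = ext_mulmx z') -> dies_below z ->
  exists v w, z = koszul X v + @ext_mulmx p w.
Proof.
have [hD ex _ _ _] := res.
(* In the inductive step q drops by 1 while p grows by 1 and m by 2, so [s + 2 * p < m] is
   preserved. For q = 0 the bound on Tor makes the constant terms of z a boundary of D (x) k, and
   the remainder lies in the ideal of the variables. *)
elim: q p m z => [|q IH] p m z mp zq zm [z' zE] zd.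
  have [w0 w0E] : exists w0, map_mx (mcoeff 0%MM) (z set0) = w0 *m Dk p.
    apply/submxP; suff : (map_mx (mcoeff 0%MM) (z set0) <= bounds Dk p)%MS.
      by rewrite genmxE.
    apply: (tor mp) => [g|].
      by rewrite mxE => /((rhomogP _ _ _).1 (zm set0)); rewrite mdeg0 addn0.
    case: p {mp zm z' zE} z zq zd => [|p] z zq zd; first exact: submx1.
    rewrite sub_kermx -map_mxM; have [y /ffunP/(_ set0)] := zd.
    rewrite !ffunE => ->; apply/eqP/rowP => g; rewrite !mxE summxE raddf_sum big1 //=.
    move=> l _; rewrite mxE -mulrA rmorphM /= mulrC rmorphM /=.
    by rewrite mcoeffX mnm1_eq0 mul0r mul0r.
  pose w1 := map_mx (mpolyC c (R := k)) w0.
  have [|v vE] := @koszul_variables_surj k c _ (z set0 - w1 *m D p).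
    rewrite map_mxB map_mxM /= w0E (_ : map_mx _ w1 = w0) ?subrr //.
    by apply/rowP => g; rewrite !mxE mcoeffC eqxx mulr1.
  exists v, [ffun B : {set 'I_c} => if B == set0 then w1 else 0].
  apply/ffunP => B; rewrite ext_addE vE !ffunE; case: eqP => [->|/eqP nB].
    by rewrite subrK.
  by rewrite mul0mx addr0 (extdegE zq) // cards_eq0.
have /fin_all_exists [y0 y0E] (B : {set 'I_c}) : exists y0 : 'rV_(r p.+1), 
    (if #|B| == q then koszul X z B else 0) = y0 *m D p.
  by case: eqP => _; [exists (z' B); rewrite zE ffunE|exists 0; rewrite mul0mx].
(* A lift y of [koszul X z] through D lives one step up the resolution. Its part of exterior degree
   q and degree m + 2 is still a lift, because D and z are homogeneous. *)
have [y [yq ym yE]] : exists y, [/\ extdeg q y,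
    forall B, rhomog (@dg p.+1) m.+2 (y B) & koszul X z = ext_mulmx y].
  exists [ffun B : {set 'I_c} => if #|B| == q then hpart (@dg p.+1) m.+2 (y0 B) else 0].
  split=> [B|B|].
  - by rewrite ffunE; case: ifP => [/eqP//|_]; rewrite eqxx.
  - by rewrite ffunE; case: eqP => _; [apply: hpart_rhomog|apply: rhomog0].
  apply/ffunP => B; rewrite [RHS]ffunE [in RHS]ffunE; have := y0E B.
  case: eqP => [_ e|/eqP Bq _]; last first.
    by rewrite mul0mx; apply: extdegE Bq; apply: koszul_extdeg.
  rewrite -(hpart_mulmx _ _ (hD p)) -e hpart_id //.
  exact: rhomog_koszul.
have [|//|//|||v' [w' y'E]] := IH p.+1 m.+2 y.
- by rewrite mulnS addnCA add2n !ltnS.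
- have /fin_all_exists [x xE] B : exists x, koszul X y B = x *m D p.+1.
    apply/(ex p); have /ffunP/(_ B) : ext_mulmx (koszul X y) = 0.
      by rewrite -koszul_ext_mulmx -yE koszul_koszul.
    by rewrite !ffunE.
  by exists [ffun B : {set 'I_c} => x B]; apply/ffunP => B; rewrite xE !ffunE.
- by exists z.
(* Removing the component at [set0] leaves [koszul] unchanged and makes the cycle [z - ext_mulmx v1]
   vanish there, so that Koszul acyclicity applies. *)
pose v1 : {ffun {set 'I_c} -> 'rV[RR]_(r p.+1)} :=
  [ffun B : {set 'I_c} => if B == set0 then 0 else v' B].
have [||v vE] := @koszul_acyclic _ c _ X (z - ext_mulmx v1) (@variables_regular k c _).
- rewrite ext_subE (extdegE zq) ?cards0 // sub0r !ffunE eqxx mul0mx.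
  exact: oppr0.
- rewrite linearB /= koszul_ext_mulmx koszul_drop0 yE y'E.
  apply/ffunP => B; rewrite ext_subE ext_0E !ffunE mulmxDl.
  by rewrite -[w' B *m _ *m _]mulmxA exact_dd // mulmx0 addr0 subrr.
by exists v, v1; rewrite -vE subrK.
Qed.

Lemma aug0 n : aug n 0 = 0.
Proof.
have [_ _ [_ augZ _ _] _ _] := res.
by have := augZ n 0 0; rewrite scaler0 scale0r.
Qed.

Lemma aug_sum n (I : Type) (e : seq I) (P : pred I) F :
  aug n (\sum_(i <- e | P i) F i) = \sum_(i <- e | P i) aug n (F i).
Proof.
have [_ _ [augD _ _ _] _ _] := res.
by apply: (big_morph (aug n)); [apply: augD|apply: aug0].
Qed.

Lemma aug_hpart n u : aug n (hpart (@dg 0%N) n u) = aug n u.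
Proof.
have [_ _ [_ _ _ augh] _ _] := res.
have [K KE] := hpart_sum (@dg 0%N) u.
rewrite {2}(KE (maxn K n.+1)) ?leq_maxl // aug_sum.
have lt : (n < maxn K n.+1)%N by rewrite leq_maxr.
rewrite (bigD1 (Ordinal lt)) //= big1 ?addr0 // => m /eqP ne.
by apply: (augh m); [apply: hpart_rhomog|move=> e; apply: ne; apply: val_inj].
Qed.

Lemma chi_koszul_aug j (u : ext c 'rV[RR]_(r 0%N)) :
  chi_koszul [ffun B : {set 'I_c} => aug j (u B)] =
  [ffun B : {set 'I_c} => aug j.+2 (koszul X u B)].
Proof.
have [_ _ [_ augZ augX _] _ _] := res.
apply/ffunP => B; rewrite !ffunE aug_sum; apply: eq_bigr => l lB.
rewrite ffunE -augX -augZ scalerA; congr (aug _ (_ *: _)).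
by rewrite rmorphXn /= rmorphN1.
Qed.

(** Homogeneous lifts turn u into an element of the Koszul complex of the free module at place 0.
    Its Koszul differential lies in the image of D since u is a cycle, so [koszul_cokernel] applies
    with p = 0, and [aug] kills the part coming from D. *)
Lemma koszul_homology_vanishes_deg q j (u : ext c 'cV[k]_(rdim N j.+2)) :
    (s < j.+2)%N -> extdeg q u -> chi_koszul u = 0 ->
  exists w, u = chi_koszul w.
Proof.
have [hD ex [_ _ _ augh] surj ker] := res.
move=> sj uq uk.
have /fin_all_exists [z0 z0E] B := surj j.+2 (u B).
pose z : {ffun {set 'I_c} -> 'rV[RR]_(r 0%N)} :=
  [ffun B : {set 'I_c} => if #|B| == q then hpart (@dg 0%N) j.+2 (z0 B) else 0].
have zE B : aug j.+2 (z B) = u B.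
  rewrite ffunE; case: eqP => [_|/eqP Bq]; first by rewrite aug_hpart.
  by rewrite aug0 (extdegE uq).
have zm B : rhomog (@dg 0%N) j.+2 (z B).
  by rewrite ffunE; case: eqP => _; [apply: hpart_rhomog|apply: rhomog0].
have [|||||v [w zvw]] := @koszul_cokernel q 0 j.+2 z.
- by rewrite muln0 addn0.
- by move=> B; rewrite ffunE; case: ifP => [/eqP//|_]; rewrite eqxx.
- exact: zm.
- have /fin_all_exists [x xE] B : exists x, koszul X z B = x *m D 0%N.
    apply/ker => n; have [<-|/eqP ne] := eqVneq j.+4 n; last first.
      by apply: (augh j.+4) => //; apply: rhomog_koszul.
    have := chi_koszul_aug j.+2 z.
    rewrite (_ : [ffun B : {set 'I_c} => aug j.+2 (z B)] = u); last first.
      by apply/ffunP => C; rewrite ffunE zE.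
    by rewrite uk => /ffunP/(_ B); rewrite !ffunE => <-.
  by exists [ffun B : {set 'I_c} => x B]; apply/ffunP => B; rewrite xE !ffunE.
- by [].
exists [ffun B : {set 'I_c} => aug j (v B)]; rewrite chi_koszul_aug.
apply/ffunP => B; rewrite ffunE -zE zvw ext_addE.
have [_ _ [augD _ _ _] _ _] := res.
rewrite augD [ext_mulmx w B]ffunE; have [_ -> ] := ker (w B *m D 0%N); rewrite ?addr0 //.
by exists (w B).
Qed.

Lemma koszul_homology_vanishes j (u : ext c 'cV[k]_(rdim N j.+2)) :
  (s < j.+2)%N -> chi_koszul u = 0 -> exists w, u = chi_koszul w.
Proof.
move=> sj uk.
have /fin_all_exists [w wE] (q : 'I_c.+1) : exists w,
    [ffun B : {set 'I_c} => if #|B| == q then u B else 0] = chi_koszul w.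
  apply: (@koszul_homology_vanishes_deg q) => // [B|].
    by rewrite ffunE; case: ifP => [/eqP//|_]; rewrite eqxx.
  apply/ffunP => B; rewrite !ffunE.
  case: (altP (#|B|.+1 =P q)) => Bq; last first.
    rewrite big1 // => l lB; rewrite ffunE cardsU1 lB (negbTE Bq) mulmx0.
    exact: scaler0.
  have /ffunP/(_ B) := uk; rewrite !ffunE => {2}<-; apply: eq_bigr => l lB.
  by rewrite ffunE cardsU1 lB add1n Bq eqxx.
exists [ffun B : {set 'I_c} => \sum_q w q B]; apply/ffunP => B; rewrite ffunE.
have lt : (#|B| < c.+1)%N by rewrite ltnS -[X in (_ <= X)%N]card_ord max_card.
transitivity (\sum_q chi_koszul (w q) B).
  rewrite (bigD1 (Ordinal lt)) //= -wE ffunE eqxx big1 ?addr0 // => q ne.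
  rewrite -wE ffunE; case: eqP => // e; case/eqP: ne; exact: val_inj.
under eq_bigr => q _ do rewrite ffunE.
rewrite exchange_big; apply: eq_bigr => l _ /=.
by rewrite ffunE mulmx_sumr scaler_sumr.
Qed.

End KoszulHomology.

Lemma sum_ext_basis (k : comNzRingType) c m (u : ext c 'rV[k]_m) :
  u = \sum_(B : {set 'I_c}) \sum_(j < m) u B 0 j *: ext_basis k B j.
Proof.
apply/ffunP => C; rewrite sum_ffunE (bigD1 C) //= sum_ffunE.
rewrite [X in _ + X]big1 ?addr0 => [|B ne].
  by rewrite {1}[u C]row_sum_delta; apply: eq_bigr => j _; rewrite !ffunE eqxx.
by rewrite sum_ffunE big1 // => j _; rewrite !ffunE eq_sym (negbTE ne) scaler0.
Qed.

(** * Duality between Ext and Tor *)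

Section Duality.
Variables (k : fieldType) (c : nat).

Definition row_koszul n0 n2 (X : 'I_c -> 'M[k]_(n2, n0)) (u : ext c 'rV[k]_n2) :
    ext c 'rV[k]_n0 :=
  [ffun C : {set 'I_c} => \sum_(l in C)
     (-1) ^+ #|[set x in C :\ l | (x < l)%N]| *: (u (C :\ l) *m X l)].

Lemma row_koszul_linear n0 n2 (X : 'I_c -> 'M[k]_(n2, n0)) : linear (row_koszul X).
Proof.
move=> a u v; apply/ffunP => C; rewrite !ffunE scaler_sumr -big_split /=.
apply: eq_bigr => l _; rewrite !ffunE mulmxDl scalerDr -scalemxAl !scalerA.
by rewrite mulrC.
Qed.

HB.instance Definition _ n0 n2 X := GRing.isLinear.Build k _ _ _
  (@row_koszul n0 n2 X) (row_koszul_linear X).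

Definition pairing m (u : ext c 'rV[k]_m) (phi : ext c 'cV[k]_m) : k :=
  \sum_(B : {set 'I_c}) (u B *m phi B) 0 0.

(* Dual to the Koszul complex of chi on columns is t_2 (x) k on rows. *)
Lemma koszul_adjoint n0 n2 (X : 'I_c -> 'M[k]_(n2, n0)) u phi :
  pairing (row_koszul X u) phi = pairing u (col_koszul X phi).
Proof.
rewrite /pairing.
under eq_bigr => C _ do rewrite ffunE mulmx_suml summxE.
under [RHS]eq_bigr => C _ do rewrite ffunE mulmx_sumr summxE.
rewrite !pair_big_dep /=.
rewrite (reindex_onto (fun x : {set 'I_c} * 'I_c => (x.2 |: x.1, x.2))
  (fun x => (x.1 :\ x.2, x.2))) => [|[C l] /= lC]; last by rewrite setD1K.
apply: eq_big => [[B l] /=|[B l] /=].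
  rewrite setU11 /=; apply/eqP/idP => [[<-]|lB]; first by rewrite setD11.
  by rewrite setU1K.
move=> /andP[_ /eqP[e]]; rewrite e -scalemxAl -scalemxAr -mulmxA mxE.
by rewrite mxE.
Qed.

(** With U the image of g, the coordinates of [v - projv U v] are functionals that vanish on U and
    jointly detect membership in it; evaluating them on the basis writes them as pairings. *)
Lemma separating_functional m n (g : {linear ext c 'rV[k]_m -> ext c 'rV[k]_n}) u :
    (forall phi, (forall w, pairing (g w) phi = 0) -> pairing u phi = 0) ->
  exists w, u = g w.
Proof.
move=> h; pose U := limg (linfun g).
have [|nu] := boolP (u \in U).
  by case/memv_imgP => w _ ->; exists w; rewrite lfunE.
pose la v B i := (v - projv U v) B 0 i.
have gE v B i :
    pairing v [ffun C : {set 'I_c} => \col_j la (ext_basis k C j) B i] = la v B i.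
  rewrite /pairing {2}[v]sum_ext_basis /la linear_sum -sumrB sum_ffunE summxE.
  apply: eq_bigr => C _; rewrite linear_sum -sumrB sum_ffunE summxE mxE.
  apply: eq_bigr => j _; rewrite linearZ -scalerBr.
  by rewrite ext_scaleE [RHS]mxE; congr (_ * _); rewrite ffunE mxE.
case/negP: nu; suff /subr0_eq -> : u - projv U u = 0 by exact: memv_proj.
apply/ffunP => B; apply/rowP => i; rewrite ext_0E [RHS]mxE -[LHS]/(la u B i) -gE.
apply: h => w; rewrite gE /la projv_id ?subrr ?ext_0E ?mxE //.
by apply/memv_imgP; exists w; rewrite ?memvf // lfunE.
Qed.

Lemma row_koszul_exact n0 n2 n4 (X : 'I_c -> 'M[k]_(n2, n0))
    (Y : 'I_c -> 'M[k]_(n4, n2)) :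
    (forall phi, col_koszul Y phi = 0 -> exists psi, phi = col_koszul X psi) ->
  forall u, row_koszul X u = 0 -> exists w, u = row_koszul Y w.
Proof.
move=> ex u uX; apply: separating_functional => phi h.
(* Vanishing on the image of [row_koszul Y] means, by adjointness, [col_koszul Y phi = 0]; exactness
   writes phi through X, and adjointness moves X onto u. *)
have [|psi ->] := ex phi.
  apply/ffunP => B; apply/colP => i; rewrite !ffunE mxE.
  have := h (ext_basis k B i); rewrite /= koszul_adjoint /pairing.
  rewrite (bigD1 B) //= big1 ?addr0 => [|C ne].
    by rewrite !ffunE eqxx -rowE mxE.
  by rewrite ffunE (negbTE ne) mul0mx mxE.
by rewrite -koszul_adjoint uX /pairing big1 // => B _; rewrite ffunE mul0mx mxE.
Qed.

(** The components of [parity_part] have the dimensions of those of N only up to a propositional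
    equality; with the dimensions as variables the equalities can be substituted and [conform_mx]
    disappears. *)
Lemma col_koszul_conform n0 n2 n4 m0 m2 m4 (X : 'I_c -> 'M[k]_(n2, n0))
    (Y : 'I_c -> 'M[k]_(n4, n2)) : m0 = n0 -> m2 = n2 -> m4 = n4 ->
    (forall phi, col_koszul (fun l => conform_mx (0 : 'M_(m4, m2)) (Y l)) phi = 0 ->
       exists psi, phi = col_koszul (fun l => conform_mx (0 : 'M_(m2, m0)) (X l)) psi) ->
  forall phi, col_koszul Y phi = 0 -> exists psi, phi = col_koszul X psi.
Proof.
move=> e0 e2 e4; subst; move=> h phi phiY.
have XE : (fun l => conform_mx 0 (X l)) =1 X by move=> l; rewrite conform_mx_id.
have YE : (fun l => conform_mx 0 (Y l)) =1 Y by move=> l; rewrite conform_mx_id.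
have [|psi ->] := h phi.
  rewrite -phiY; apply/ffunP => B; rewrite !ffunE; apply: eq_bigr => l _.
  by rewrite YE.
by exists psi; apply/ffunP => B; rewrite !ffunE; apply: eq_bigr => l _; rewrite XE.
Qed.

Lemma regularity_row_exact (N : rmod k c) (odd_part : bool) (s j : nat) :
    has_regularity (parity_part odd_part N) s%:Z -> odd j = odd_part ->
    (s < j.+2)%N ->
  forall u, row_koszul (fun l => rchi N l j) u = 0 ->
  exists w, u = row_koszul (fun l => rchi N l j.+2) w.
Proof.
(* The attained supremum supplies a graded resolution. The upper bound then applies to this very
   resolution, since any one resolution can witness [Tor_nonzero]. *)
move=> [reg [i0 [j0 [[r [dg [D [aug [res _]]]]] _]]]] oj sj; apply: row_koszul_exact.
apply: (@col_koszul_conform _ _ _ (rdim (parity_part odd_part N) j)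
  (rdim (parity_part odd_part N) j.+2) (rdim (parity_part odd_part N) j.+4)) => /=.
- by rewrite oj eqxx.
- by rewrite !negbK oj eqxx.
- by rewrite !negbK oj eqxx.
apply: (fun H phi =>
  @koszul_homology_vanishes _ _ _ _ _ _ _ res s H j phi sj) => i j' v ij vj vc.
apply: contraT => nvb; have := reg i j'; rewrite Num.Theory.lerBlDr -PoszM -PoszD.
rewrite lez_nat leqNgt ij; apply; exists r, dg, D, aug; split=> //.
by exists v.
Qed.

End Duality.

(** * The total complex of G (x) K *)

Section Linear.
Variables (S : pzRingType) (U V : lmodType S) (g : U -> V).
Hypothesis gl : linear g.

Definition linear_bundle : {linear U -> V} :=
  HB.pack g (GRing.isLinear.Build _ _ _ _ g gl).

Lemma lin0 : g 0 = 0. Proof. exact: (linear0 linear_bundle). Qed.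
Lemma linD u v : g (u + v) = g u + g v.
Proof. exact: (linearD linear_bundle). Qed.
Lemma linB u v : g (u - v) = g u - g v.
Proof. exact: (linearB linear_bundle). Qed.
Lemma linZ a u : g (a *: u) = a *: g u.
Proof. exact: (linearZ_LR linear_bundle). Qed.
Lemma lin_sum (I : Type) (r : seq I) (P : pred I) F :
  g (\sum_(i <- r | P i) F i) = \sum_(i <- r | P i) g (F i).
Proof. exact: (linear_sum linear_bundle). Qed.

End Linear.

Section LinearMatrix.
Variables (S : comNzRingType).

Lemma mul_lin1_mx m n (f : 'rV[S]_m -> 'rV[S]_n) v :
  linear f -> v *m lin1_mx f = f v.
Proof. by move=> fl; apply: (mul_rV_lin1 (linear_bundle fl)). Qed.

Lemma eq_mulmx_row m n (M N : 'M[S]_(m, n)) :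
  (forall v : 'rV_m, v *m M = v *m N) -> M = N.
Proof. by move=> e; apply/row_matrixP => i; rewrite !rowE e. Qed.

Lemma map_lin1_mx (k : nzRingType) (rho : {rmorphism S -> k}) m n
    (f : 'rV[S]_m -> 'rV[S]_n) (g : 'rV[k]_m -> 'rV[k]_n) :
    (forall v, g (map_mx rho v) = map_mx rho (f v)) ->
  map_mx rho (lin1_mx f) = lin1_mx g.
Proof. by move=> fg; apply/matrixP => i j; rewrite !mxE -(map_delta_mx rho) fg mxE. Qed.

End LinearMatrix.

(** * Coordinates on the total complex of G (x) K *)

Section Families.
Variables (A : comNzRingType) (c : nat) (b : nat -> nat).

Local Notation family := (forall p, ext c 'rV[A]_(b p)).
Implicit Types U V W : family.

(* Basis of the term of degree n of the total complex: the triples (p, B, j)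
   for g_j (x) e_B with g_j in G_p and p + #|B| = n. *)
Definition tot_index n : finType :=
  {x : {p : 'I_n.+1 & ({set 'I_c} * 'I_(b p))%type} |
     #|(tagged x).1| == (n - tag x)%N}.

Definition tot_rank n := #|tot_index n|.

(** Forgets the dependency of j on p, so that basis elements can be compared without transport. *)
Definition key n (x : tot_index n) : nat * {set 'I_c} * nat :=
  (val (tag (val x)), (tagged (val x)).1, val (tagged (val x)).2).

Lemma key_inj n : injective (@key n).
Proof.
move=> [[p [B j]] Hx] [[q [C i]] Hy] [] /= pq BC ji; apply: val_inj => /=.
have e : p = q by apply: val_inj.
by subst q; subst C; rewrite (val_inj ji).
Qed.

(* [vec n U] forgets the components U p B with p + #|B| <> n. *)
Definition vec n U : 'rV[A]_(tot_rank n) :=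
  \row_(x < #|tot_index n|) U (tag (val (enum_val x))) (tagged (val (enum_val x))).1 0
           (tagged (val (enum_val x))).2.

Definition fam n (v : 'rV[A]_(tot_rank n)) : family := fun p =>
  [ffun B : {set 'I_c} => \row_j
     \sum_(x | key (enum_val x) == (p, B, val j)) v 0 x].


Lemma key_surj n p (B : {set 'I_c}) (j : 'I_(b p)) : (p + #|B| = n)%N ->
  exists x : tot_index n, key x = (p, B, val j).
Proof.
move=> pn; have lt : (p < n.+1)%N by rewrite ltnS -pn leq_addr.
pose y : {p : 'I_n.+1 & ({set 'I_c} * 'I_(b p))%type} :=
  @Tagged _ (Ordinal lt) (fun p : 'I_n.+1 => ({set 'I_c} * 'I_(b p))%type) (B, j).
have Hy : #|(tagged y).1| == (n - tag y)%N by rewrite /= -pn addKn.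
by exists (exist _ y Hy).
Qed.

Lemma key_degree n (x : tot_index n) : ((key x).1.1 + #|(key x).1.2| = n)%N.
Proof.
case: x => [[p [B j]] Hx] /=; rewrite (eqP Hx) /= subnKC //.
by rewrite -ltnS ltn_ord.
Qed.

Lemma key_val n U (x : tot_index n) p B (j : 'I_(b p)) :
  key x = (p, B, val j) ->
  U (tag (val x)) (tagged (val x)).1 0 (tagged (val x)).2 = U p B 0 j.
Proof.
case: x => [[q [C i]] Hx] [] /= qp; move: j; rewrite -qp => j -> /= ij.
by congr (U _ _ _ _); apply: val_inj.
Qed.

Lemma vec_fam n (v : 'rV[A]_(tot_rank n)) : vec n (fam v) = v.
Proof.
apply/rowP => x; rewrite !mxE ffunE mxE (big_pred1 x) // => y.
by rewrite (inj_eq (@key_inj n)) (inj_eq enum_val_inj).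
Qed.

Lemma fam_vec n U p (B : {set 'I_c}) :
  fam (vec n U) p B = if (p + #|B| == n)%N then U p B else 0.
Proof.
rewrite ffunE; apply/rowP => j; rewrite mxE; case: eqP => [e|ne].
  have [x kx] := key_surj j e.
  rewrite (big_pred1 (enum_rank x)) => [|y].
    by rewrite mxE enum_rankK (key_val _ kx).
  by rewrite -kx (inj_eq (@key_inj n)) -(inj_eq (@enum_rank_inj _)) enum_valK.
rewrite mxE big_pred0 // => x; apply/eqP => kx.
by have := key_degree (enum_val x); rewrite kx /= => /ne.
Qed.

Lemma eq_vec n U V : (forall p (B : {set 'I_c}), (p + #|B| = n)%N -> U p B = V p B) ->
  vec n U = vec n V.
Proof.
move=> UV; apply/rowP => x; rewrite !mxE UV //.
exact: (key_degree (enum_val x)).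
Qed.

Lemma fam_degree n (v : 'rV_(tot_rank n)) p (B : {set 'I_c}) :
  (p + #|B| != n)%N -> fam v p B = 0.
Proof. by rewrite -[v]vec_fam fam_vec => /negbTE->. Qed.

Lemma fam_extdeg n (v : 'rV_(tot_rank n)) p : extdeg (n - p) (fam v p).
Proof.
move=> B; apply: contraNeq => ne; rewrite fam_degree //.
by apply: contraNneq ne => <-; rewrite addKn.
Qed.

Lemma fam_inj n (v w : 'rV_(tot_rank n)) :
  (forall p, fam v p = fam w p) -> v = w.
Proof.
by move=> e; rewrite -[v]vec_fam -[w]vec_fam; apply: eq_vec => p B _; rewrite e.
Qed.

Lemma fam_linear n p : linear (fun v : 'rV_(tot_rank n) => fam v p).
Proof.
move=> a u v; apply/ffunP => B; rewrite !ffunE; apply/rowP => j.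
rewrite !mxE mulr_sumr -big_split /=; apply: eq_bigr => x _.
by rewrite !mxE.
Qed.

Lemma vec_linear n a U V : vec n (fun p => a *: U p + V p) = a *: vec n U + vec n V.
Proof. by apply/rowP => x; rewrite !mxE !ffunE !mxE. Qed.

Definition single q (x : ext c 'rV[A]_(b q)) : family := fun p =>
  match q =P p with
  | ReflectT e => eq_rect q (fun p => ext c 'rV[A]_(b p)) x p e
  | ReflectF _ => 0
  end.

Lemma single_id q (x : ext c 'rV[A]_(b q)) : single x q = x.
Proof.
by rewrite /single; case: (q =P q) => // e; rewrite (eq_irrelevance e erefl).
Qed.

Lemma single_neq q (x : ext c 'rV[A]_(b q)) p : q != p -> single x p = 0.
Proof. by rewrite /single; case: (q =P p). Qed.

End Families.

Section TotalDifferential.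
Variables (A : comNzRingType) (c : nat) (b : nat -> nat).
Variable t : forall p r, ext c 'rV[A]_(b p) -> ext c 'rV[A]_(b r).
Hypothesis t_linear : forall p r, linear (@t p r).
Hypothesis t_degree : forall p r q (u : ext c 'rV[A]_(b p)), (r <= p)%N ->
  extdeg q u -> forall B : {set 'I_c}, t r u B != 0 -> (#|B| + 1 = q + (p - r))%N.

Local Notation family := (forall p, ext c 'rV[A]_(b p)).
Implicit Types U V W : family.

(** A family may be nonzero at infinitely many places, so the sum of all the t_i is cut off at N;
    beyond the support of U the cut-off does not change the value. *)
Definition tot N U : family := fun r => \sum_(p < N.+1 | (r <= p)%N) t r (U p).

Lemma eq_tot N U V r : (forall p, (p <= N)%N -> U p = V p) -> tot N U r = tot N V r.
Proof. by move=> e; apply: eq_bigr => p _; rewrite e // -ltnS. Qed.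

Lemma tot_linear N a U V r :
  tot N (fun p => a *: U p + V p) r = a *: tot N U r + tot N V r.
Proof.
rewrite scaler_sumr -big_split; apply: eq_bigr => p _ /=.
by rewrite (linD (@t_linear _ _)) (linZ (@t_linear _ _)).
Qed.

Lemma tot_widen N N' U r : (N <= N')%N -> (forall p, (N < p)%N -> U p = 0) ->
  tot N' U r = tot N U r.
Proof.
move=> NN U0; rewrite /tot.
rewrite [RHS](big_ord_widen_cond N'.+1 (leq r) (fun p => t r (U p))) ?ltnS //.
rewrite (bigID (fun p : 'I_N'.+1 => (p < N.+1)%N)) /=.
rewrite [X in _ + X]big1 ?addr0 // => p /andP[_]; rewrite -leqNgt => Np.
by rewrite U0 // (lin0 (@t_linear _ _)).
Qed.

Lemma tot_single N q (x : ext c 'rV[A]_(b q)) r : (q <= N)%N ->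
  tot N (single x) r = if (r <= q)%N then t r x else 0.
Proof.
rewrite -ltnS => qN; rewrite /tot big_mkcond (bigD1 (Ordinal qN)) //= single_id.
rewrite big1 ?addr0 // => p; rewrite -val_eqE /= => pq.
by rewrite single_neq 1?eq_sym // (lin0 (@t_linear _ _)) if_same.
Qed.

Definition extpart m q (u : ext c 'rV[A]_m) : ext c 'rV[A]_m :=
  [ffun B : {set 'I_c} => if #|B| == q then u B else 0].

Lemma extpart_extdeg m q (u : ext c 'rV[A]_m) : extdeg q (extpart q u).
Proof. by move=> B; rewrite ffunE; case: ifP => [/eqP|_]; rewrite ?eqxx. Qed.

Lemma extpart_sum m (u : ext c 'rV[A]_m) : u = \sum_(q < c.+1) extpart q u.
Proof.
apply/ffunP => B; rewrite sum_ffunE.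
have lt : (#|B| < c.+1)%N by rewrite ltnS -[X in (_ <= X)%N]card_ord max_card.
rewrite (bigD1 (Ordinal lt)) //= ffunE eqxx big1 ?addr0 // => q ne.
by rewrite ffunE; case: eqP => // e; case/eqP: ne; apply: val_inj.
Qed.

Lemma t_extpart p r q (u : ext c 'rV[A]_(b p)) (B : {set 'I_c}) : (r <= p)%N ->
  (#|B| + 1 = q + (p - r))%N -> t r u B = t r (extpart q u) B.
Proof.
move=> rp Bq; rewrite {1}[u]extpart_sum (lin_sum (@t_linear _ _)) sum_ffunE.
have off q' : q' != q -> t r (extpart q' u) B = 0.
  move=> ne; apply: contraNeq ne => /(t_degree rp (@extpart_extdeg _ q' u)).
  by rewrite Bq => /addIn ->.
have [qc|cq] := ltnP q c.+1.
  rewrite (bigD1 (Ordinal qc)) //= big1 ?addr0 // => q' ne.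
  by apply: off; rewrite -val_eqE in ne.
rewrite big1 => [|q' _]; last by rewrite off // neq_ltn (leq_trans _ cq).
suff -> : extpart q u = 0 by rewrite (lin0 (@t_linear _ _)) ffunE.
apply/ffunP => C; rewrite !ffunE; case: eqP => // Cq.
by move: cq; rewrite ltnNge -Cq -[X in (_ <= X)%N]card_ord max_card.
Qed.

Lemma t_too_large p r (u : ext c 'rV[A]_(b p)) (B : {set 'I_c}) : (r <= p)%N ->
  (#|B| + 1 < p - r)%N -> t r u B = 0.
Proof.
move=> rp lt; rewrite [u]extpart_sum (lin_sum (@t_linear _ _)) sum_ffunE big1 // => q _.
apply/eqP; apply: contraTT lt => /(t_degree rp (@extpart_extdeg _ q u)) ->.
by rewrite -leqNgt leq_addl.
Qed.

(** The total differential lowers the degree by 1, so its part of degree n sees only the part of W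
    of degree n + 1. This allows inhomogeneous families in place of coordinate vectors. *)
Lemma vec_tot n N W : (n < N)%N ->
  vec n (tot N W) = vec n (tot n.+1 (fam (vec n.+1 W))).
Proof.
move=> nN; transitivity (vec n (tot N (fam (vec n.+1 W)))); last first.
  apply: eq_vec => p B _; rewrite (@tot_widen n.+1 N) // => q nq; apply/ffunP => C.
  rewrite fam_degree ?ffunE //; apply: contraTneq nq => <-.
  by rewrite -leqNgt leq_addr.
apply: eq_vec => r B rB; rewrite !sum_ffunE; apply: eq_bigr => p rp.
case: (leqP p n.+1) => pn.
  have e : (#|B| + 1 = (n.+1 - p) + (p - r))%N.
    by rewrite addnBA // subnK // -[n.+1]addn1 -rB -addnA addKn.
  rewrite [LHS](t_extpart _ rp e) [RHS](t_extpart _ rp e).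
  congr (fun_of_fin (t _ _) _); apply/ffunP => C; rewrite [LHS]ffunE [RHS]ffunE.
  by case: eqP => // Cp; rewrite fam_vec Cp subnKC ?eqxx.
have lt : (#|B| + 1 < p - r)%N by rewrite ltn_subRL addnA rB addn1.
by rewrite !t_too_large.
Qed.

Lemma tot_degree n U r (B : {set 'I_c}) :
    (forall p (C : {set 'I_c}), U p C != 0 -> (p + #|C| = n.+1)%N) ->
  (r + #|B| != n)%N -> tot n.+1 U r B = 0.
Proof.
move=> hU ne; rewrite sum_ffunE big1 // => p rp; apply: contraNeq ne.
have Ud : extdeg (n.+1 - p) (U p).
  by move=> C /hU e; apply/eqP; rewrite -(eqn_add2l p) e subnKC ?leq_ord.
move=> /(t_degree rp Ud); rewrite addnBA // subnK ?leq_ord // addn1 => e.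
by rewrite -eqSS -addnS e subnKC // (leq_trans rp) // leq_ord.
Qed.

Lemma fam_supp n (v : 'rV[A]_(tot_rank c b n)) p (C : {set 'I_c}) :
  fam v p C != 0 -> (p + #|C| = n)%N.
Proof. by apply: contraNeq => /(fam_degree v) ->. Qed.

Definition dTot n : 'M[A]_(tot_rank c b n.+1, tot_rank c b n) :=
  lin1_mx (fun v => vec n (tot n.+1 (fam v))).

Lemma mulmx_dTot n v : v *m dTot n = vec n (tot n.+1 (fam v)).
Proof.
apply: mul_lin1_mx => a u w; rewrite -vec_linear; apply: eq_vec => p B _.
rewrite -tot_linear; congr (fun_of_fin _ B); apply: eq_tot => q _.
exact: (fam_linear).
Qed.

Lemma fam_dTot n v p : fam (v *m dTot n) p = tot n.+1 (fam v) p.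
Proof.
apply/ffunP => B; rewrite mulmx_dTot fam_vec; case: eqP => // /eqP ne.
by rewrite tot_degree //; apply: fam_supp.
Qed.

Lemma vec_dTot n N W : (n < N)%N -> vec n.+1 W *m dTot n = vec n (tot N W).
Proof. by move=> nN; rewrite mulmx_dTot -(vec_tot W nN). Qed.

Hypothesis t_deg0 : forall p (u : ext c 'rV[A]_(b p)), extdeg 0 u -> t p u = 0.
Hypothesis tt0 : forall p r (u : ext c 'rV[A]_(b p)), (r <= p)%N ->
  \sum_(r <= q < p.+1) t r (t q u) = 0.

Lemma tot_tot N U r : tot N (tot N U) r = 0.
Proof.
rewrite /tot.
under eq_bigr => q _ do rewrite (lin_sum (@t_linear _ _)).
rewrite (exchange_big_dep (fun p : 'I_N.+1 => (r <= p)%N)) /=; last first.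
  by move=> q p rq qp; apply: leq_trans qp.
rewrite big1 // => p rp; rewrite -[RHS](tt0 (U p) rp) big_geq_mkord /=.
rewrite (big_ord_widen_cond N.+1 (fun q => r <= q)%N
  (fun q => t r (t q (U p)))) ?ltnS ?leq_ord //.
Qed.

Lemma dTot_dTot n : dTot n.+1 *m dTot n = 0.
Proof.
apply/row_matrixP => i; rewrite row_mul row0.
move: (row i _) (rowE i (dTot n.+1)) => v ->.
apply: fam_inj => r; rewrite fam_dTot.
transitivity (tot n.+2 (tot n.+2 (fam (delta_mx 0 i))) r); last first.
  by rewrite tot_tot (lin0 (@fam_linear _ _ _ _ _)).
(* The inner sum reaches place n + 2 only through the diagonal map on G_(n+2) (x) K_0, which is
   zero; hence the outer sum may stop at n + 1. *)
rewrite (@tot_widen n.+1 n.+2) //; last first.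
  move=> p np; rewrite /tot big1 // => q pq.
  have e : q = n.+2 :> nat by apply/eqP; rewrite eqn_leq leq_ord (leq_trans np).
  have {np}pE : p = n.+2 by apply/eqP; rewrite eqn_leq np -[X in (_ <= X)%N]e pq.
  move: q e pq => [q ltq] /= e _; subst; apply: t_deg0.
  by have := @fam_extdeg _ _ _ _ (delta_mx 0 i) n.+2; rewrite subnn.
by apply: eq_tot => p _; rewrite fam_dTot.
Qed.

End TotalDifferential.

(** * Acyclicity of the total complex *)

Section TotalResolution.
Variables (S R : comNzRingType) (pi : {rmorphism S -> R}) (M : lmodType R).
Variables (c : nat) (f : 'I_c -> S).
Hypotheses (hf : regular_sequence f) (hR : quotient_map pi (ideal_gen f)).
Variables (b : nat -> nat) (dG : forall p, 'M[S]_(b p.+1, b p)).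
Variable etaG : 'rV[R]_(b 0%N) -> M.
Hypothesis hG : free_resolution id (fun p => map_mx pi (dG p)) etaG.
Variable t : forall p r : nat,
  {linear ext c 'rV[S]_(b p) -> ext c 'rV[S]_(b r)}.
Hypothesis ht : higher_CI_operators f dG t.

Local Notation tf := (fun p r => t p r : ext c 'rV[S]_(b p) -> ext c 'rV[S]_(b r)).
Local Notation dP := (dTot tf).

Lemma CI_linear p r : linear (tf p r).
Proof. exact: linearP. Qed.

Lemma CI_degree p r q (u : ext c 'rV[S]_(b p)) : (r <= p)%N ->
  extdeg q u -> forall B : {set 'I_c}, tf p r u B != 0 -> (#|B| + 1 = q + (p - r))%N.
Proof. by have [h _ _ _ _] := ht; apply: h. Qed.

Lemma CI_deg0 p (u : ext c 'rV[S]_(b p)) : extdeg 0 u -> tf p p u = 0.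
Proof. by have [_ h _ _ _] := ht => /koszul_extdeg0 k0; rewrite h k0 scaler0. Qed.

Lemma CI_square p r (u : ext c 'rV[S]_(b p)) : (r <= p)%N ->
  \sum_(r <= q < p.+1) tf q r (tf p q u) = 0.
Proof. by have [_ _ _ _ h] := ht; apply: h. Qed.

Let dPdP := dTot_dTot CI_linear CI_degree CI_deg0 CI_square.
Let fam_dP := fam_dTot CI_linear CI_degree.
Let vec_dP := vec_dTot CI_linear CI_degree.

Lemma regular_sequence_rows m : regular_on 'rV[S]_m f.
Proof.
move=> i x [w xE]; have [reg _] := hf.
have /fin_all_exists [a aE] g : exists a : 'I_c -> S,
    x 0 g = \sum_(j < c | (j < i)%N) a j * f j.
  apply: (reg i); exists (fun j => w j 0 g).
  have /rowP/(_ g) := xE; rewrite mxE mulrC => ->; rewrite summxE.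
  by apply: eq_bigr => j _; rewrite mxE mulrC.
exists (fun j => \row_g a g j); apply/rowP => g; rewrite aE summxE.
by apply: eq_bigr => j _; rewrite !mxE mulrC.
Qed.

Lemma lift_row m (u : 'rV[R]_m) : exists v : 'rV[S]_m, map_mx pi v = u.
Proof.
have [surj _] := hR; have /fin_all_exists [v vE] j := surj (u 0 j).
by exists (\row_j v j); apply/rowP => j; rewrite !mxE vE.
Qed.

Lemma kernel_row m (u : 'rV[S]_m) : map_mx pi u = 0 ->
  exists y : 'I_c -> 'rV[S]_m, u = \sum_l f l *: y l.
Proof.
move=> /rowP u0; have [_ ker] := hR.
have /fin_all_exists [a aE] j : exists a : 'I_c -> S, u 0 j = \sum_(l < c) a l * f l.
  by apply/ker; have := u0 j; rewrite !mxE.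
exists (fun l => \row_j a j l); apply/rowP => j; rewrite aE summxE.
by apply: eq_bigr => l _; rewrite !mxE mulrC.
Qed.

Lemma pi_f l : pi (f l) = 0.
Proof.
have [_ ker] := hR; apply/ker; exists (fun j => (j == l)%:R).
by rewrite (bigD1 l) //= eqxx mul1r big1 ?addr0 // => j /negbTE->; rewrite mul0r.
Qed.

Lemma koszul_set0 m (u : ext c 'rV[S]_m) :
  koszul f u set0 = \sum_l f l *: u [set l].
Proof.
rewrite ffunE; apply: eq_big => [l|l _]; first by rewrite inE.
rewrite setU0 (_ : [set x in _ | _] = set0) ?cards0 ?mul1r //.
by apply/setP => x; rewrite !inE.
Qed.

Lemma pi_koszul_set0 m (u : ext c 'rV[S]_m) : map_mx pi (koszul f u set0) = 0.
Proof.
rewrite koszul_set0 raddf_sum big1 // => l _ /=.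
by rewrite map_mxZ pi_f scale0r.
Qed.

(* The summand G_n (x) K_0 of the term of degree n. *)
Definition base_part n (v : 'rV[S]_(tot_rank c b n)) : 'rV[S]_(b n) :=
  fam v n set0.

Lemma base_part_linear n : linear (@base_part n).
Proof. by move=> a u v; rewrite /base_part fam_linear ext_addE ext_scaleE. Qed.

Lemma pi_base_part_dP n v :
  map_mx pi (base_part (v *m dP n)) = map_mx pi (base_part v) *m map_mx pi (dG n).
Proof.
have [_ h0 h1 _ _] := ht.
rewrite /base_part fam_dP /tot (bigD1 (Ordinal (ltnSn n.+1))) //=.
rewrite (bigD1 (Ordinal (leqW (ltnSn n)))) /=; last first.
  by rewrite leqnn -val_eqE /= neq_ltn ltnSn.
rewrite big1 ?addr0 => [|p /andP[/andP[np pn1] pn]]; last first.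
  move: np pn1 pn; rewrite -!val_eqE /= => np pn1 pn.
  have := ltn_ord p; rewrite ltnS leq_eqVlt (negbTE pn1) /= ltnS => pn'.
  by case/eqP: pn; apply/eqP; rewrite eqn_leq pn' np.
rewrite h0 h1 ext_addE ext_scaleE ffunE map_mxD map_mxM map_mxZ.
by rewrite pi_koszul_set0 scaler0 addr0.
Qed.

Lemma fam_sub n (u v : 'rV[S]_(tot_rank c b n)) p : fam (u - v) p = fam u p - fam v p.
Proof. exact: (linB (@fam_linear _ _ _ _ p)). Qed.

Lemma fam_single_dP n q (x : ext c 'rV[S]_(b q)) p (B : {set 'I_c}) :
    (q <= n.+1)%N -> (p + #|B| = n)%N ->
  fam (vec n.+1 (single x) *m dP n) p B = if (p <= q)%N then t q p x B else 0.
Proof.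
move=> qn pB; rewrite (vec_dP _ (ltnSn n)) fam_vec pB eqxx.
rewrite (tot_single CI_linear) //; case: ifP => // _; exact: ffunE.
Qed.

(** Lifting a preimage of the component in G_n (x) K_0 from R to S leaves an error in (f) G_n, which
    is the Koszul image of G_n (x) K_1. Above place n there is nothing for degree reasons. *)
Lemma clear_top n (v : 'rV[S]_(tot_rank c b n)) :
    (exists x, map_mx pi (base_part v) = x *m map_mx pi (dG n)) ->
  exists w, forall p, (n <= p)%N -> fam (v - w *m dP n) p = 0.
Proof.
have [_ h0 h1 _ _] := ht.
move=> [xR]; have [x <-] := lift_row xR => /eqP; rewrite -subr_eq0 -map_mxM -map_mxB.
move=> /eqP /kernel_row [y yE].
pose X : ext c 'rV[S]_(b n.+1) := [ffun B : {set 'I_c} => if B == set0 then x else 0].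
pose Y : ext c 'rV[S]_(b n) :=
  [ffun B : {set 'I_c} => \sum_(l | B == [set l]) (-1) ^+ n *: y l].
exists (vec n.+1 (single X) + vec n.+1 (single Y)) => p np; apply/ffunP => B.
rewrite ext_0E; have [e|ne] := eqVneq (p + #|B|)%N n; last exact: fam_degree.
have pE : p = n by apply/eqP; rewrite eqn_leq np -e leq_addr.
move: e; rewrite pE -[X in _ = X]addn0 => /addnI/eqP; rewrite cards_eq0 => /eqP->.
rewrite mulmxDl fam_sub ext_subE.
rewrite (linD (@fam_linear _ _ _ _ n)) ext_addE.
rewrite !fam_single_dP ?leqnSn ?leqnn ?cards0 ?addn0 //.
have -> : t n.+1 n X set0 = x *m dG n by rewrite h1 !ffunE eqxx.
rewrite h0 ext_scaleE koszul_set0 opprD addrA.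
rewrite -/(base_part v) yE scaler_sumr -sumrB big1 // => l _.
rewrite ffunE (big_pred1 l) => [|j]; last by rewrite (inj_eq set1_inj) eq_sym.
by rewrite !scalerA mulrAC -expr2 sqrr_sign mul1r subrr.
Qed.

(** The component at the highest place, at most n, is a Koszul cycle of positive exterior degree,
    hence a Koszul boundary. The t_i never raise the place, so removing it disturbs only lower
    places. *)
Lemma clear_below n j (v : 'rV[S]_(tot_rank c b n.+1)) : (j <= n.+1)%N ->
    v *m dP n = 0 -> (forall p, (j <= p)%N -> fam v p = 0) ->
  exists w, v = w *m dP n.+1.
Proof.
have [_ h0 h1 _ _] := ht.
elim: j v => [|j IH] v jn vd vj.
  exists 0; rewrite mul0mx; apply: fam_inj => p; rewrite vj //.
  by rewrite (lin0 (@fam_linear _ _ _ _ p)).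
have [|||x xE] := @koszul_acyclic S c _ f (fam v j).
- exact: regular_sequence_rows.
- by apply: fam_degree; rewrite cards0 addn0 neq_ltn jn.
- have : fam (v *m dP n) j = 0 by rewrite vd (lin0 (@fam_linear _ _ _ _ j)).
  have jn2 : (j < n.+2)%N by apply: leqW.
  rewrite fam_dP /tot (bigD1 (Ordinal jn2)) //= big1 ?addr0 => [|p /andP[jp pj]].
    rewrite h0 => /(congr1 (fun u => (-1) ^+ j *: u)).
    by rewrite scalerA -expr2 sqrr_sign scale1r scaler0.
  rewrite vj ?linear0 // ltn_neqAle jp andbT eq_sym.
  by move: pj; rewrite -val_eqE.
pose X : ext c 'rV[S]_(b j) := (-1) ^+ j *: x.
have tX : t j j X = fam v j.
  by rewrite h0 linearZ /= scalerA -expr2 sqrr_sign scale1r.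
have [|||w wE] := IH (v - vec n.+2 (single X) *m dP n.+1); first exact: ltnW.
- by rewrite mulmxBl vd -mulmxA dPdP mulmx0 subr0.
- move=> p jp; apply/ffunP => B; rewrite ext_0E.
  have [e|ne] := eqVneq (p + #|B|)%N n.+1; last exact: fam_degree.
  rewrite fam_sub ext_subE fam_single_dP //; last by rewrite leqW // ltnW.
  move: jp; rewrite leq_eqVlt => /predU1P[<-|jp]; first by rewrite leqnn tX subrr.
  by rewrite leqNgt jp /= vj // ext_0E subr0.
by exists (w + vec n.+2 (single X)); rewrite mulmxDl -wE subrK.
Qed.

Lemma total_free_resolution :
  free_resolution pi dP (fun v => etaG (map_mx pi (base_part v))).
Proof.
have [etaL etaS etaK exG] := hG.
split=> [a u v|x|u|n v].
- by rewrite base_part_linear map_mxD map_mxZ etaL.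
- have [u <-] := etaS x; have [v <-] := lift_row u.
  pose V : ext c 'rV[S]_(b 0) := [ffun B : {set 'I_c} => if B == set0 then v else 0].
  exists (vec 0 (single V)).
  congr (etaG (map_mx pi _)).
  by rewrite /base_part fam_vec cards0 addn0 eqxx single_id ffunE eqxx.
- split=> [/etaK/clear_top [w wE]|[w ->]].
    exists w; apply/eqP; rewrite -subr_eq0; apply/eqP; apply: fam_inj => p.
    by rewrite wE // (lin0 (@fam_linear _ _ _ _ p)).
  by rewrite pi_base_part_dP; apply/etaK; exists (map_mx pi (base_part w)).
split=> [vd|[w ->]]; last by rewrite -mulmxA dPdP mulmx0.
have [|w wE] := @clear_top _ v.
  apply/exG; rewrite -pi_base_part_dP vd.
  by rewrite (lin0 (@base_part_linear n)) map_mx0.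
have [|y yE] := @clear_below n n.+1 (v - w *m dP n.+1) (leqnn _) _ wE.
  by rewrite mulmxBl vd -mulmxA dPdP mulmx0 subr0.
by exists (y + w); rewrite mulmxDl -yE subrK.
Qed.

End TotalResolution.

(** * Homotopies on the total complex *)

Section RightMultiplication.
Variables (A : comNzRingType) (c : nat) (b : nat -> nat).

Definition rmul_mx (l : 'I_c) n : 'M[A]_(tot_rank c b n, tot_rank c b n.+1) :=
  lin1_mx (fun v => (-1) ^+ n *: vec n.+1 (fun p => wedge (fam v p) (egen A l))).

Lemma mulmx_rmul l n (v : 'rV[A]_(tot_rank c b n)) :
  v *m rmul_mx l n =
  (-1) ^+ n *: vec n.+1 (fun p => wedge (fam v p) (egen A l)).
Proof.
apply: mul_lin1_mx => a u w; rewrite scalerA mulrC -scalerA -scalerDr.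
congr (_ *: _); rewrite -vec_linear; apply: eq_vec => p B _.
by rewrite fam_linear wedge_linearl.
Qed.

End RightMultiplication.

Section TotalHomotopy.
Variables (S : comNzRingType) (c : nat) (f : 'I_c -> S).
Variables (b : nat -> nat) (dG : forall p, 'M[S]_(b p.+1, b p)).
Variable t : forall p r : nat,
  {linear ext c 'rV[S]_(b p) -> ext c 'rV[S]_(b r)}.
Hypothesis ht : higher_CI_operators f dG t.

Local Notation tf := (fun p r => t p r : ext c 'rV[S]_(b p) -> ext c 'rV[S]_(b r)).

(** The t_i with i >= 1 commute with right multiplication, so the Leibniz term comes from t_0 alone;
    its sign (-1)^r at place r and the Leibniz sign (-1)^(n-r) combine to (-1)^n at every place. *)
Lemma tot_wedge n N l (v : 'rV[S]_(tot_rank c b n)) r : (r <= n)%N -> (n <= N)%N ->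
  tot tf N (fun p => wedge (fam v p) (egen S l)) r =
  wedge (tot tf N (fam v) r) (egen S l) + ((-1) ^+ n * f l) *: fam v r.
Proof.
have [_ h0 _ hw _] := ht => rn nN.
have rN : (r < N.+1)%N by rewrite ltnS (leq_trans rn).
rewrite /tot (bigD1 (Ordinal rN)) //= [in RHS](bigD1 (Ordinal rN)) //=.
rewrite wedgeDl addrAC; congr (_ + _).
  rewrite !h0 (koszul_wedge_egen _ _ (@fam_extdeg _ _ _ _ v r)).
  rewrite scalerDr wedgeZl; congr (_ + _); rewrite scalerA mulrA -exprD.
  by rewrite subnKC.
rewrite (big_morph (fun u => wedge u (egen S l)) (id1 := 0) (op1 := +%R)); last first.
- exact: wedge0l.
- by move=> u w; rewrite wedgeDl.
apply: eq_bigr => p /andP[rp pr]; rewrite hw // ltn_neqAle rp andbT eq_sym.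
by move: pr; rewrite -val_eqE.
Qed.

Lemma total_homotopies : homotopies f (dTot tf) (@rmul_mx S c b).
Proof.
have dE := mulmx_dTot (CI_linear t); have fE := fam_dTot (CI_linear t) (CI_degree ht).
have vE := vec_dTot (CI_linear t) (CI_degree ht).
have sE n l (v : 'rV[S]_(tot_rank c b n)) : v *m rmul_mx S b l n *m dTot tf n =
    (-1) ^+ n *: vec n (fun r => wedge (tot tf n.+1 (fam v) r) (egen S l) +
       ((-1) ^+ n * f l) *: fam v r).
  rewrite mulmx_rmul -scalemxAl (vE _ _ _ (ltnSn n)); congr (_ *: _).
  apply: eq_vec => p B pB; rewrite tot_wedge //.
  by rewrite -pB leq_addr.
have fin n l (v : 'rV[S]_(tot_rank c b n)) : 
    (-1) ^+ n *: vec n (fun r => ((-1) ^+ n * f l) *: fam v r) = v *m (f l)%:M.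
  rewrite mul_mx_scalar -{2}[v]vec_fam; apply/rowP => x; rewrite !mxE.
  by rewrite !ext_scaleE !mxE !mulrA -expr2 sqrr_sign mul1r.
move=> l; split=> [|n]; apply: eq_mulmx_row => v.
  (* In degree 0 only coefficients at [set0] occur, and a multiple of e_l has none there. *)
  rewrite mulmxA sE -fin; congr (_ *: _); apply: eq_vec => r B rB.
  have /eqP := rB; rewrite addn_eq0 cards_eq0 => /andP[_ /eqP->].
  by rewrite ext_addE wedge_egen inE add0r.
rewrite mulmxDr !mulmxA sE mulmx_rmul -fin.
rewrite exprS mulN1r !scaleNr addrC -scalerBr -[RHS]scalerN; congr (_ *: _).
apply/rowP => x; rewrite !mxE fE (@tot_widen _ _ _ _ (CI_linear t) n.+1 n.+2) //.
  by rewrite ext_addE !mxE opprD addrA subrr add0r.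
move=> p np; apply/ffunP => C; rewrite ext_0E; apply: fam_degree.
by rewrite neq_ltn (leq_trans np) ?leq_addr // orbT.
Qed.

End TotalHomotopy.

(** * Reduction modulo the maximal ideal *)

Section BaseChange.
Variables (S : comNzRingType) (k : fieldType) (rho : {rmorphism S -> k}) (c : nat).
Hypothesis rho_surj : forall y, exists x, rho x = y.

Definition map_ext m (u : ext c 'rV[S]_m) : ext c 'rV[k]_m :=
  [ffun B : {set 'I_c} => map_mx rho (u B)].

Lemma map_extD m (u v : ext c 'rV[S]_m) : map_ext (u + v) = map_ext u + map_ext v.
Proof. by apply/ffunP => B; rewrite !ffunE map_mxD. Qed.

Lemma map_extZ m a (u : ext c 'rV[S]_m) : map_ext (a *: u) = rho a *: map_ext u.
Proof. by apply/ffunP => B; rewrite !ffunE map_mxZ. Qed.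

Lemma map_ext0 m : map_ext (0 : ext c 'rV[S]_m) = 0.
Proof. by apply/ffunP => B; rewrite !ffunE map_mx0. Qed.

Lemma map_ext_sum m (I : Type) (e : seq I) (P : pred I) (F : I -> ext c 'rV[S]_m) :
  map_ext (\sum_(i <- e | P i) F i) = \sum_(i <- e | P i) map_ext (F i).
Proof. by apply: big_morph; [apply: map_extD|apply: map_ext0]. Qed.

Lemma map_ext_wedge m (u : ext c 'rV[S]_m) (y : ext c S) :
  wedge (map_ext u) [ffun B => rho (y B)] = map_ext (wedge u y).
Proof.
apply/ffunP => C; rewrite !ffunE raddf_sum; apply: eq_bigr => B _ /=.
by rewrite !ffunE map_mxZ rmorphM rmorphXn /= rmorphN1.
Qed.

Lemma map_ext_wedge_egen m (u : ext c 'rV[S]_m) l :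
  wedge (map_ext u) (egen k l) = map_ext (wedge u (egen S l)).
Proof.
by rewrite -map_ext_wedge; congr wedge; apply/ffunP => B; rewrite !ffunE rmorph_nat.
Qed.

(** Zero coefficients are lifted to zero, so the lift keeps the exterior degree; the degree property
    of t then passes to k. *)
Lemma lift_ext m (u : ext c 'rV[k]_m) : exists v : ext c 'rV[S]_m,
  map_ext v = u /\ forall B, u B = 0 -> v B = 0.
Proof.
have lift y : exists x, rho x = y /\ (y = 0 -> x = 0).
  have [->|ne] := eqVneq y 0; first by exists 0; rewrite rmorph0.
  by have [x xy] := rho_surj y; exists x; split=> // e; rewrite e eqxx in ne.
have /fin_all_exists [v vE] (x : {set 'I_c} * 'I_m) := lift (u x.1 0 x.2).
exists [ffun B : {set 'I_c} => \row_j v (B, j)]; split=> [|B uB].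
  by apply/ffunP => B; apply/rowP => j; rewrite !ffunE !mxE (vE (B, j)).1.
by apply/rowP => j; rewrite ffunE !mxE (vE (B, j)).2 //= uB mxE.
Qed.

Lemma ext_base_change_linear m n (h : ext c 'rV[S]_m -> ext c 'rV[S]_n) :
  linear (ext_base_change rho h).
Proof.
move=> a u v; rewrite /ext_base_change scaler_sumr -big_split /=.
apply: eq_bigr => B _; rewrite scaler_sumr -big_split /=.
by apply: eq_bigr => j _; rewrite ext_addE ext_scaleE !mxE scalerDl scalerA.
Qed.

Lemma ext_base_change_map m n (h : ext c 'rV[S]_m -> ext c 'rV[S]_n) u :
  linear h -> ext_base_change rho h (map_ext u) = map_ext (h u).
Proof.
move=> hl; rewrite {2}[u]sum_ext_basis (lin_sum hl) map_ext_sum.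
apply: eq_bigr => B _; rewrite (lin_sum hl) map_ext_sum; apply: eq_bigr => j _.
by rewrite (linZ hl) map_extZ ffunE mxE.
Qed.

Variable b : nat -> nat.

Lemma map_vec n (U : forall p, ext c 'rV[S]_(b p)) :
  map_mx rho (vec n U) = vec n (fun p => map_ext (U p)).
Proof. by apply/rowP => x; rewrite !mxE ffunE mxE. Qed.

Lemma map_fam n (v : 'rV[S]_(tot_rank c b n)) p :
  fam (map_mx rho v) p = map_ext (fam v p).
Proof.
apply/ffunP => B; apply/rowP => j; rewrite !ffunE !mxE raddf_sum.
by apply: eq_bigr => x _; rewrite mxE.
Qed.

Lemma map_rmul_mx (l : 'I_c) n : map_mx rho (rmul_mx S b l n) = rmul_mx k b l n.
Proof.
apply: map_lin1_mx => v; rewrite map_mxZ rmorphXn rmorphN1 map_vec.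
by congr (_ *: _); apply: eq_vec => p B _; rewrite map_fam map_ext_wedge_egen.
Qed.

Variables (f : 'I_c -> S) (dG : forall p, 'M[S]_(b p.+1, b p)).
Variable t : forall p r : nat,
  {linear ext c 'rV[S]_(b p) -> ext c 'rV[S]_(b r)}.
Hypothesis ht : higher_CI_operators f dG t.
Hypothesis rho_f : forall l, rho (f l) = 0.
Hypothesis rho_dG : forall p, map_mx rho (dG p) = 0.

Local Notation tf := (fun p r => t p r : ext c 'rV[S]_(b p) -> ext c 'rV[S]_(b r)).
Local Notation tau p r := (@tk S k rho c b tf p r).
Local Notation taus := (@tk S k rho c b tf).

Lemma tk_linear p r : linear (tau p r).
Proof. exact: ext_base_change_linear. Qed.

Lemma tk_map p r (u : ext c 'rV[S]_(b p)) : tau p r (map_ext u) = map_ext (t p r u).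
Proof. by apply: ext_base_change_map; apply: CI_linear. Qed.

Lemma tk_degree p r q (u : ext c 'rV[k]_(b p)) : (r <= p)%N ->
  extdeg q u -> forall B : {set 'I_c}, tau p r u B != 0 -> (#|B| + 1 = q + (p - r))%N.
Proof.
have [v [<- v0]] := lift_ext u; move=> rp vq B; rewrite tk_map ffunE => nz.
apply: (CI_degree ht rp (u := v)) => [C|]; last first.
  by apply: contraNneq nz => ->; rewrite map_mx0.
by move=> nzC; apply: vq; apply: contraNneq nzC => /v0 ->.
Qed.

Lemma tk_diag p (u : ext c 'rV[k]_(b p)) : tau p p u = 0.
Proof.
have [_ h _ _ _] := ht; have [v [<- _]] := lift_ext u.
rewrite tk_map h map_extZ [X in _ *: X](_ : _ = 0) ?scaler0 //.
apply/ffunP => B; rewrite !ffunE raddf_sum big1 //= => l _.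
by rewrite map_mxZ rmorphM /= rho_f mulr0 scale0r.
Qed.

Lemma tk_sub1 p (u : ext c 'rV[k]_(b p.+1)) : tau p.+1 p u = 0.
Proof.
have [_ _ h _ _] := ht; have [v [<- _]] := lift_ext u.
by rewrite tk_map h; apply/ffunP => B; rewrite !ffunE map_mxM rho_dG mulmx0.
Qed.

Lemma tk_wedge p r (u : ext c 'rV[k]_(b p)) (y : ext c k) : (r < p)%N ->
  tau p r (wedge u y) = wedge (tau p r u) y.
Proof.
move=> rp; have [_ _ _ h _] := ht; have [v [<- _]] := lift_ext u.
have /fin_all_exists [y' y'E] B := rho_surj (y B).
rewrite (_ : y = [ffun B => rho ([ffun B => y' B] B)]); last first.
  by apply/ffunP => B; rewrite !ffunE.
by rewrite map_ext_wedge !tk_map h // map_ext_wedge.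
Qed.

Lemma tk_square p r (u : ext c 'rV[k]_(b p)) : (r <= p)%N ->
  \sum_(r <= q < p.+1) tau q r (tau p q u) = 0.
Proof.
move=> rp; have [v [<- _]] := lift_ext u.
transitivity (map_ext (\sum_(r <= q < p.+1) tf q r (tf p q v))).
  by rewrite map_ext_sum; apply: eq_bigr => q _; rewrite !tk_map.
by rewrite (CI_square ht) // map_ext0.
Qed.

Lemma map_dTot n : map_mx rho (dTot tf n) = dTot taus n.
Proof.
apply: map_lin1_mx => v; rewrite map_vec; apply: eq_vec => p B _.
rewrite /tot map_ext_sum; congr (fun_of_fin _ B); apply: eq_bigr => q _.
by rewrite map_fam tk_map.
Qed.

(** By E-linearity t_2 is determined on G (x) K_0. For degree reasons its values there lie in G (x)
    K_1, with the CI operators as coefficients; the signs come from sorting e_l ^ e_(C - l). *)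
Lemma tk2_row_koszul p (u : ext c 'rV[k]_(b p.+2)) :
  tau p.+2 p u = row_koszul (fun l => CI_operator rho tf l p) u.
Proof.
have p2 : (p <= p.+2)%N by rewrite leqW.
pose e0 (x : 'rV[k]_(b p.+2)) : ext c 'rV[k]_(b p.+2) :=
  [ffun B : {set 'I_c} => if B == set0 then x else 0].
have e0E x B : tau p.+2 p (e0 x) B = if #|B| == 1%N then
    \sum_l (B == [set l])%:R *: (x *m CI_operator rho tf l p) else 0.
  case: eqP => [/eqP/cards1P[l ->]|/eqP ne]; last first.
    have deg : extdeg 0 (e0 x).
      by move=> C; rewrite ffunE; case: ifP => [/eqP->|_]; rewrite ?cards0 ?eqxx.
    apply: contraNeq ne => /(tk_degree p2 deg).
    by rewrite -addn2 addKn add0n addn1 => -[->].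
  rewrite (bigD1 l) //= eqxx scale1r big1 ?addr0 => [|m ml]; last first.
    by rewrite (inj_eq set1_inj) eq_sym (negbTE ml) scale0r.
  have -> : e0 x = \sum_j x 0 j *: ext_basis k set0 j.
    apply/ffunP => C; rewrite sum_ffunE ffunE; case: eqP => [->|/eqP nC].
      by rewrite {1}[x]row_sum_delta; apply: eq_bigr => j _; rewrite !ffunE eqxx.
    by rewrite big1 // => j _; rewrite !ffunE (negbTE nC) scaler0.
  rewrite (lin_sum (@tk_linear _ _)) sum_ffunE; apply/rowP => i.
  rewrite summxE mxE; apply: eq_bigr => j _.
  rewrite (linZ (@tk_linear _ _)) ext_scaleE !mxE; congr (_ * _).
  have -> : ext_basis k set0 j = map_ext (ext_basis S set0 j) :> ext c 'rV[k]_(b p.+2).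
    by apply/ffunP => C; rewrite !ffunE; case: ifP; rewrite ?map_delta_mx ?map_mx0.
  by rewrite tk_map ffunE mxE.
have uE : u = \sum_B wedge (e0 (u B)) [ffun C => (C == B)%:R].
  apply/ffunP => C; rewrite sum_ffunE (bigD1 C) //= big1 ?addr0 => [|B ne].
    by rewrite wedge_scalar ffunE eqxx scale1r.
  by rewrite wedge_scalar ffunE eq_sym (negbTE ne) scale0r.
rewrite {1}uE (lin_sum (@tk_linear _ _)); apply/ffunP => C.
rewrite sum_ffunE ffunE.
transitivity (\sum_(B : {set 'I_c}) \sum_(l in C)
   ((-1) ^+ #|[set x in C :\ l | (x < l)%N]| * (C :\ l == B)%:R) *:
     (u B *m CI_operator rho tf l p)).
  apply: eq_bigr => B _; rewrite (tk_wedge _ _ (leqW (ltnSn p))) wedge_vector => [|D].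
    apply: eq_bigr => l lC; rewrite ffunE e0E cards1 eqxx; congr (_ *: _).
    rewrite (bigD1 l) //= eqxx scale1r big1 ?addr0 // => m ml.
    by rewrite (inj_eq set1_inj) eq_sym (negbTE ml) scale0r.
  by move=> D1; rewrite e0E (negbTE D1).
rewrite exchange_big; apply: eq_bigr => l lC /=.
rewrite (bigD1 (C :\ l)) //= eqxx mulr1 big1 ?addr0 // => B ne.
by rewrite eq_sym (negbTE ne) mulr0 scale0r.
Qed.

End BaseChange.

(** * The linear strands and their extension *)

Section ExtPair.
Variables (k : fieldType) (c : nat).

Lemma ext_pairK1 m n (u : ext c 'rV[k]_m) (v : ext c 'rV[k]_n) :
  ext_fst (ext_pair u v) = u.
Proof. by apply/ffunP => B; rewrite !ffunE row_mxKl. Qed.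

Lemma ext_pairK2 m n (u : ext c 'rV[k]_m) (v : ext c 'rV[k]_n) :
  ext_snd (ext_pair u v) = v.
Proof. by apply/ffunP => B; rewrite !ffunE row_mxKr. Qed.

Lemma ext_pair_eta m n (u : ext c 'rV[k]_(m + n)) :
  ext_pair (ext_fst u) (ext_snd u) = u.
Proof. by apply/ffunP => B; rewrite !ffunE hsubmxK. Qed.

Lemma ext_fst_linear m n : linear (@ext_fst k c m n).
Proof. by move=> a u v; apply/ffunP => B; rewrite !ffunE linearP. Qed.

Lemma ext_snd_linear m n : linear (@ext_snd k c m n).
Proof. by move=> a u v; apply/ffunP => B; rewrite !ffunE linearP. Qed.

Lemma ext_pairP m n a (u u' : ext c 'rV[k]_m) (v v' : ext c 'rV[k]_n) :
  ext_pair (a *: u + u') (a *: v + v') = a *: ext_pair u v + ext_pair u' v'.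
Proof. by apply/ffunP => B; rewrite !ffunE scale_row_mx add_row_mx. Qed.

Lemma ext_pair_inj m n (u u' : ext c 'rV[k]_m) (v v' : ext c 'rV[k]_n) :
  ext_pair u v = ext_pair u' v' -> u = u' /\ v = v'.
Proof.
move=> e; split.
  by rewrite -(ext_pairK1 u v) e ext_pairK1.
by rewrite -(ext_pairK2 u v) e ext_pairK2.
Qed.

Lemma ext_pair0 m n : ext_pair 0 0 = 0 :> ext c 'rV[k]_(m + n).
Proof. by apply/ffunP => B; rewrite !ffunE row_mx0. Qed.

Lemma ext_fst_wedge m n (u : ext c 'rV[k]_(m + n)) (y : ext c k) :
  ext_fst (wedge u y) = wedge (ext_fst u) y.
Proof.
apply/ffunP => B; rewrite !ffunE linear_sum; apply: eq_bigr => D _.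
by rewrite linearZ ffunE.
Qed.

Lemma ext_snd_wedge m n (u : ext c 'rV[k]_(m + n)) (y : ext c k) :
  ext_snd (wedge u y) = wedge (ext_snd u) y.
Proof.
apply/ffunP => B; rewrite !ffunE linear_sum; apply: eq_bigr => D _.
by rewrite linearZ ffunE.
Qed.

End ExtPair.

Section LinearStrands.
Variables (k : fieldType) (c : nat) (b : nat -> nat).
Variable tau : forall p r, ext c 'rV[k]_(b p) -> ext c 'rV[k]_(b r).
Hypothesis tau_linear : forall p r, linear (@tau p r).
Hypothesis tau_degree : forall p r q (u : ext c 'rV[k]_(b p)), (r <= p)%N ->
  extdeg q u -> forall B : {set 'I_c}, tau r u B != 0 -> (#|B| + 1 = q + (p - r))%N.
Hypothesis tau_diag : forall p (u : ext c 'rV[k]_(b p)), tau p u = 0.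
Hypothesis tau_sub1 : forall p (u : ext c 'rV[k]_(b p.+1)), tau p u = 0.
Hypothesis tau_wedge : forall p r (u : ext c 'rV[k]_(b p)) (y : ext c k),
  (r < p)%N -> tau r (wedge u y) = wedge (tau r u) y.
Hypothesis tau_square : forall p r (u : ext c 'rV[k]_(b p)), (r <= p)%N ->
  \sum_(r <= q < p.+1) tau r (tau q u) = 0.
Hypothesis tau2_exact : forall p (u : ext c 'rV[k]_(b p.+2)),
  tau p u = 0 -> exists w : ext c 'rV[k]_(b p.+4), u = tau p.+2 w.

Let tau0 p r : @tau p r 0 = 0. Proof. exact: (lin0 (@tau_linear p r)). Qed.

Lemma tau2_tau2 p (u : ext c 'rV[k]_(b p.+4)) : tau p (tau p.+2 u) = 0.
Proof.
have := tau_square u (leq_addl 4 p).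
rewrite big_ltn ?(leq_addl 4 p.+1) //
  big_ltn ?(leq_addl 3 p.+2) //
  big_ltn ?(leq_addl 2 p.+3) //
  big_ltn ?(leq_addl 1 p.+4) //
  big_ltn ?(leq_addl 0 p.+4.+1) // big_geq //.
by rewrite tau_diag tau_sub1 !add0r !tau_sub1 !tau_diag !tau0 !addr0.
Qed.

Lemma tau2_tau3 p (u : ext c 'rV[k]_(b p.+4.+1)) :
  tau p (tau p.+2 u) + tau p (tau p.+3 u) = 0.
Proof.
have := tau_square u (leq_addl 5 p).
rewrite big_ltn ?(leq_addl 5 p.+1) //
  big_ltn ?(leq_addl 4 p.+2) //
  big_ltn ?(leq_addl 3 p.+3) //
  big_ltn ?(leq_addl 2 p.+4) //
  big_ltn ?(leq_addl 1 p.+4.+1) //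
  big_ltn ?(leq_addl 0 p.+4.+2) // big_geq //.
by rewrite tau_diag tau_sub1 !add0r !tau_sub1 !tau_diag !tau0 !addr0.
Qed.

(** The equation on d and e says that the rise p - r - 1 in exterior degree makes up for the drop e
    - d in the degree of the generators. *)
Lemma tau_ehomog p r d e n (u : ext c 'rV[k]_(b p)) : (r <= p)%N ->
    (d + (p - r) = e.+1)%N ->
  ehomog (fun=> e) n u -> ehomog (fun=> d) n (tau r u).
Proof.
move=> rp de hu B i nz.
have ud C : u C != 0 -> (e + #|C| = n)%N.
  by case/rV0Pn => j; apply: hu.
have /(tau_degree rp) h : extdeg (n - e) u by move=> C /ud <-; rewrite addKn.
have [en|ne] := leqP e n; last first.
  case/eqP: nz; rewrite (_ : u = 0) ?tau0 ?ffunE ?mxE //; apply/ffunP => C.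
  rewrite ffunE; apply/eqP; apply: contraT => /ud e'.
  by move: ne; rewrite -e' ltnNge leq_addr.
have /h : tau r u B != 0 by apply: contraNneq nz => ->; rewrite mxE.
by rewrite addn1 => hB; apply/eqP; rewrite -eqSS -addnS hB addnCA de addnS subnK.
Qed.

(** t_i raises the exterior degree by i - 1, which is positive for i >= 2; this gives the minimality
    of the three complexes. *)
Lemma tau_set0 p r (u : ext c 'rV[k]_(b p)) : (r.+1 < p)%N -> tau r u set0 = 0.
Proof.
move=> rp; rewrite [u]extpart_sum (lin_sum (@tau_linear _ _)) sum_ffunE big1 // => q _.
apply/eqP; apply: contraT => nz.
have := tau_degree (ltnW (ltnW rp)) (@extpart_extdeg _ _ _ q u) nz.
rewrite cards0 => e; have := leq_addl q (p - r).
by rewrite -e leqNgt ltn_subRL add0n addn1 rp.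
Qed.

(** [T_diff] for an abstract family instead of [tk], so that only the formal properties of the t_i
    are used. *)
Definition T_d i (u : ext c 'rV[k]_(T_rank b i.+1)) : ext c 'rV[k]_(T_rank b i) :=
  ext_pair (@tau i.+1.*2 i.*2 (ext_fst u) + @tau i.+1.*2.+1 i.*2 (ext_snd u))
           (@tau i.+1.*2.+1 i.*2.+1 (ext_snd u)).

Lemma up_minimal_exact : minimal_exact_complex (@up_deg b)
  (fun i => @tau i.+1.*2 i.*2 :
     ext c 'rV[k]_(up_rank b i.+1) -> ext c 'rV[k]_(up_rank b i)).
Proof.
split=> [i|i u y|i n u|i u|i u].
- exact: tau_linear.
- by rewrite tau_wedge // doubleS leqW.
- by apply: tau_ehomog; rewrite doubleS ?leqW // -addn2 addKn addn2.
- by split=> [/tau2_exact|[w ->]]; [|apply: tau2_tau2].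
by rewrite tau_set0 // doubleS.
Qed.

Lemma low_minimal_exact : minimal_exact_complex (@low_deg b)
  (fun i => @tau i.+1.*2.+1 i.*2.+1 :
     ext c 'rV[k]_(low_rank b i.+1) -> ext c 'rV[k]_(low_rank b i)).
Proof.
split=> [i|i u y|i n u|i u|i u].
- exact: tau_linear.
- by rewrite tau_wedge // doubleS leqW.
- apply: tau_ehomog; first by rewrite doubleS ltnS !leqW.
  by rewrite doubleS subSS -[i.*2.+2]addn2 addKn addn2.
- by split=> [/tau2_exact|[w ->]]; [|apply: tau2_tau2].
by rewrite tau_set0 // doubleS.
Qed.

Lemma ehomog_T i n (u : ext c 'rV[k]_(T_rank b i)) :
  ehomog (@T_deg b i) n u <->
  ehomog (@up_deg b i) n (ext_fst u) /\ ehomog (@low_deg b i) n (ext_snd u).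
Proof.
split=> [h|[h1 h2] B g nz].
  split=> B g; rewrite ffunE mxE => /h; rewrite /T_deg.
    by rewrite (unsplitK (inl g)).
  by rewrite (unsplitK (inr g)).
rewrite /T_deg; case: split_ordP => j gE; [apply: h1|apply: h2].
  by rewrite ffunE mxE -gE.
by rewrite ffunE mxE -gE.
Qed.

Lemma T_d_exact i (u : ext c 'rV[k]_(T_rank b i.+1)) :
  T_d u = 0 <-> exists w, u = @T_d i.+1 w.
Proof.
rewrite -{2}[u]ext_pair_eta /T_d.
move: (ext_fst u) (ext_snd u) => x y; split=> [|[w /ext_pair_inj[-> ->]]].
  rewrite -ext_pair0 => /ext_pair_inj[xy /(@tau2_exact i.*2.+1)[y' yE]].
  (* With y = t_2 y', the relation t_2 t_3 + t_3 t_2 = 0 turns t_2 x + t_3 y = 0 into t_2 (x - t_3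
     y') = 0. *)
  have [x' xE] : exists x', x - @tau i.*2.+1.+4 i.*2.+2 y' = @tau i.*2.+4 i.*2.+2 x'.
    apply: (@tau2_exact i.*2); rewrite (linB (@tau_linear _ _)).
    move/eqP: xy; rewrite addr_eq0 yE => /eqP xy.
    have /eqP := tau2_tau3 y'; rewrite addr_eq0 => /eqP h.
    by apply/eqP; rewrite subr_eq0; apply/eqP; apply: (etrans xy (esym h)).
  exists (ext_pair x' y'); rewrite ext_pairK1 ext_pairK2; congr ext_pair => //.
  by rewrite -[LHS](subrK (@tau i.*2.+1.+4 i.*2.+2 y')) xE.
rewrite -ext_pair0; congr ext_pair; last exact: (@tau2_tau2 i.*2.+1).
rewrite (linD (@tau_linear _ _)) (@tau2_tau2 i.*2) add0r.
exact: (@tau2_tau3 i.*2).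
Qed.

Lemma T_minimal_exact : minimal_exact_complex (@T_deg b) T_d.
Proof.
split=> [i a u v|i u y|i n u|i u|i u].
- rewrite /T_d !(ext_fst_linear, ext_snd_linear) !tau_linear -ext_pairP.
  by rewrite scalerDr addrACA.
- have [s2 s3] : (i.*2 < i.+1.*2)%N /\ (i.*2 < i.+1.*2.+1)%N.
    by rewrite doubleS !ltnS leqnSn leqW.
  rewrite /T_d !(ext_fst_wedge, ext_snd_wedge) !tau_wedge // -wedgeDl.
  by rewrite -[RHS]ext_pair_eta ext_fst_wedge ext_snd_wedge ext_pairK1 ext_pairK2.
- rewrite !ehomog_T ext_pairK1 ext_pairK2 => -[h1 h2].
  have [_ _ u1 _ _] := up_minimal_exact; have [_ _ u2 _ _] := low_minimal_exact.
  split; last exact: u2.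
  have h3 : ehomog (@up_deg b i) n (@tau i.+1.*2.+1 i.*2 (ext_snd u)).
    apply: (tau_ehomog _ _ h2); first by rewrite doubleS !leqW.
    by rewrite doubleS -addn3 addKn addn3.
  move=> B j; rewrite ext_addE mxE.
  have [->|/(u1 _ _ _ h1)//] := eqVneq (@tau i.+1.*2 i.*2 (ext_fst u) B 0 j) 0.
  by rewrite add0r; apply: h3.
- exact: T_d_exact.
rewrite /T_d ffunE ext_addE !tau_set0 ?doubleS // addr0.
exact: row_mx0.
Qed.

(** * Homology of the total complex modulo the maximal ideal *)

Local Notation totau := (tot tau).
Local Notation family := (forall p, ext c 'rV[k]_(b p)).

Let tt0 := tot_tot tau_linear tau_square.

Lemma tot_sub N (U V : family) r :
  totau N (fun p => U p - V p) r = totau N U r - totau N V r.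
Proof.
rewrite -[- totau N V r]scaleN1r addrC -tot_linear //; apply: eq_tot => p _.
by rewrite scaleN1r addrC.
Qed.

Lemma tot_top N (W : family) : totau N.+2 W N = tau N (W N.+2).
Proof.
rewrite /tot big_mkcond !big_ord_recr /= leqnn !leqW //= big1 ?add0r.
  by rewrite tau_diag tau_sub1 !add0r.
by move=> p _; rewrite leqNgt ltn_ord.
Qed.

(** All degrees are treated at once; N bounds the support of V, which makes the cut-off in [tot]
    harmless. *)
Definition total_boundary (U : family) := exists N (V : family),
  (forall p, (N < p)%N -> V p = 0) /\ forall p, U p = totau N V p.

Lemma total_boundaryD U V : total_boundary U -> total_boundary V ->
  total_boundary (fun p => U p + V p).
Proof.
move=> [N [U' [U0 UE]]] [N' [V' [V0 VE]]].
exists (maxn N N'), (fun p => U' p + V' p); split=> [p|p].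
  by rewrite gtn_max => /andP[? ?]; rewrite U0 // V0 // addr0.
rewrite UE VE -(tot_widen tau_linear p (leq_maxl N N') U0).
rewrite -(tot_widen tau_linear p (leq_maxr N N') V0).
rewrite -[X in X + _ = _]scale1r -tot_linear //; apply: eq_tot => q _.
by rewrite scale1r.
Qed.

Lemma total_boundary_single q (w : ext c 'rV[k]_(b q)) :
  total_boundary (totau q (single w)).
Proof.
exists q, (single w); split=> // p; rewrite ltn_neqAle => /andP[+ _].
exact: single_neq.
Qed.

Lemma eq_total_boundary U V :
  (forall p, U p = V p) -> total_boundary U -> total_boundary V.
Proof. by move=> UV [N [W [W0 WE]]]; exists N, W; split=> // p; rewrite -UV. Qed.

(* Exactness of t_2 at places p >= 2 lets one remove the top component. *)
Lemma clear_top_component N (W : family) : (forall p, (N.+2 < p)%N -> W p = 0) ->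
    totau N.+2 W N = 0 ->
  exists w : ext c 'rV[k]_(b N.+4),
    forall p, (N.+1 < p)%N -> W p - totau N.+4 (single w) p = 0.
Proof.
move=> W0; rewrite tot_top => /tau2_exact[w wE]; exists w => p Np.
rewrite tot_single //; have [pN|Np2] := leqP p N.+2.
  have -> : p = N.+2 by apply/eqP; rewrite eqn_leq pN.
  by rewrite (leqW (leqnSn N.+2)) -wE subrr.
rewrite W0 // sub0r; case: ifP => pN4; last by rewrite oppr0.
have : (p == N.+3) || (p == N.+4).
  by rewrite [p == N.+3]eqn_leq Np2 andbT orbC -ltnS -leq_eqVlt.
by case/orP => /eqP ->; rewrite ?tau_sub1 ?tau_diag oppr0.
Qed.

Lemma total_cycle N (W : family) : (forall p, (N < p)%N -> W p = 0) ->
    (forall p, totau N W p = 0) ->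
  exists U, total_boundary U /\ forall p, (1 < p)%N -> W p = U p.
Proof.
elim: N W => [|[|N] IH] W W0 Wc.
- exists (totau 0 (single (0 : ext c 'rV[k]_(b 0)))); split.
    exact: total_boundary_single.
  move=> p p1; rewrite W0 ?(ltnW p1) // tot_single // leqNgt (ltnW p1) //.
- exists (totau 0 (single (0 : ext c 'rV[k]_(b 0)))); split.
    exact: total_boundary_single.
  by move=> p p1; rewrite W0 // tot_single // leqNgt (ltnW p1).
have [w wE] := clear_top_component W0 (Wc N).
have [|p|U [Ub UE]] := IH (fun p => W p - totau N.+4 (single w) p).
- by move=> p; apply: wE.
- rewrite -(tot_widen tau_linear p (leqW (leqW (leqnSn N.+1))) wE) tot_sub tt0 subr0.
  by rewrite (tot_widen tau_linear p (leqW (leqnSn N.+2)) W0).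
exists (fun p => U p + totau N.+4 (single w) p); split.
  exact/total_boundaryD/total_boundary_single.
by move=> p p1; rewrite -UE // subrK.
Qed.

(** If the top place of W is at least 4, its top component is a t_2-cycle, because U vanishes two
    places lower, and can be cleared without changing the boundary. So W may be taken at places up
    to 3, where only t_2 and t_3 out of places 2 and 3 remain. *)
Lemma total_boundary_low U : total_boundary U -> (forall p, (1 < p)%N -> U p = 0) ->
  exists (w2 : ext c 'rV[k]_(b 2)) (w3 : ext c 'rV[k]_(b 3)),
    U 0%N = tau 0 w2 + tau 0 w3 /\ U 1%N = tau 1 w3.
Proof.
move=> [N [W [W0 UE]]] U0.
have [{N W0 UE} W UE] : exists W : family, forall p, U p = totau 3 W p.
  elim: N W W0 UE => [|N IH] W W0 UE.
    by exists W => p; rewrite UE (tot_widen tau_linear p (leq0n 3) W0).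
  have [N3|] := leqP N.+1 3.
    by exists W => p; rewrite UE (tot_widen tau_linear p N3 W0).
  case: N IH W0 UE => [//|[//|[//|N]]] IH W0 UE _.
  have [|w wE] := @clear_top_component N.+2 W W0 _; first by rewrite -UE U0.
  apply: (IH (fun p => W p - totau N.+4.+2 (single w) p) wE) => p.
  rewrite -(tot_widen tau_linear p (leqW (leqW (leqnSn N.+3))) wE) tot_sub tt0 subr0.
  by rewrite (tot_widen tau_linear p (leqW (leqnSn N.+4)) W0).
exists (W 2), (W 3); rewrite !UE; split.
  rewrite /tot big_mkcond !big_ord_recr big_ord0 /=.
  by rewrite tau_diag tau_sub1 !add0r.
rewrite /tot big_mkcond !big_ord_recr big_ord0 /=.
by rewrite tau_diag tau_sub1 !add0r.
Qed.


Lemma total_boundary_sum m (G : nat -> family) : (forall n, total_boundary (G n)) ->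
  total_boundary (fun p => \sum_(n < m) G n p).
Proof.
move=> Gb; elim: m => [|m IH].
  exists 0, (fun _ => 0); split=> // p; rewrite big_ord0 /tot big1 // => q _.
  exact: tau0.
apply: eq_total_boundary (total_boundaryD IH (Gb m)) => p.
by rewrite big_ord_recr.
Qed.

Section Augmentation.
Variable N : gmod k c.
Hypothesis NE : is_Emodule N.
Variable F : forall n, 'M[k]_(tot_rank c b n, gdim N n).

Definition closed n (v : 'rV[k]_(tot_rank c b n)) :=
  forall p, totau n (fam v) p = 0.

Hypothesis F_cycle : forall n (v : 'rV[k]_(tot_rank c b n)), closed v ->
  (v *m F n <= gcyc N n)%MS.
Hypothesis F_bound : forall n (w : 'rV[k]_(tot_rank c b n.+1)),
  (w *m dTot tau n *m F n <= gbnd N n)%MS.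
Hypothesis F_inj : forall n (v : 'rV[k]_(tot_rank c b n)), closed v ->
  (v *m F n <= gbnd N n)%MS ->
  exists w, v = w *m dTot tau n.
Hypothesis F_surj : forall n (z : 'rV[k]_(gdim N n)), (z <= gcyc N n)%MS ->
  exists2 v, closed v & (z - v *m F n <= gbnd N n)%MS.
Hypothesis F_act : forall l n (v : 'rV[k]_(tot_rank c b n)), closed v ->
  (vec n.+1 (fun p => wedge (fam v p) (egen k l)) *m F n.+1
     - v *m F n *m gact N l n <= gbnd N n.+1)%MS.

Definition low_family (u0 : ext c 'rV[k]_(b 0)) (u1 : ext c 'rV[k]_(b 1)) : family :=
  fun p => match p with 0 => u0 | 1 => u1 | _ => 0 end.

Definition tor_class n u0 u1 := vec n (low_family u0 u1) *m F n.

Lemma low_family_closed n u0 u1 : closed (vec n (low_family u0 u1)).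
Proof.
move=> p; rewrite /tot big1 // => q; move: (nat_of_ord q) => {}q.
case: q p => [|[|q]] p pq.
- by move: pq; rewrite leqn0 => /eqP->; apply: tau_diag.
- move: pq; rewrite leq_eqVlt ltnS leqn0 => /orP[] /eqP->.
    exact: tau_diag.
  exact: tau_sub1.
rewrite [fam _ _](_ : _ = 0) ?tau0 //; apply/ffunP => B; rewrite fam_vec /=.
by rewrite !ffunE if_same.
Qed.

Lemma tor_class_linear n a u0 u1 v0 v1 :
  tor_class n (a *: u0 + v0) (a *: u1 + v1) =
  a *: tor_class n u0 u1 + tor_class n v0 v1.
Proof.
rewrite /tor_class scalemxAl -mulmxDl -vec_linear; congr (_ *m _).
by apply: eq_vec => -[|[|p]] B _ //=; rewrite scaler0 addr0.
Qed.

Lemma tor_classB n u0 u1 v0 v1 :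
  tor_class n (u0 - v0) (u1 - v1) = tor_class n u0 u1 - tor_class n v0 v1.
Proof.
rewrite addrC -scaleN1r [u1 - _]addrC -[- v1]scaleN1r tor_class_linear.
by rewrite scaleN1r addrC.
Qed.

Lemma tor_class0 n : tor_class n 0 0 = 0.
Proof.
rewrite -(subrr (0 : ext c 'rV[k]_(b 0))) -(subrr (0 : ext c 'rV[k]_(b 1))).
by rewrite tor_classB !subrr.
Qed.

Lemma eq_tor_class n (u0 v0 : ext c 'rV[k]_(b 0)) (u1 v1 : ext c 'rV[k]_(b 1)) :
    (forall B : {set 'I_c}, #|B| = n -> u0 B = v0 B) ->
    (forall B : {set 'I_c}, #|B|.+1 = n -> u1 B = v1 B) ->
  tor_class n u0 u1 = tor_class n v0 v1.
Proof.
move=> e0 e1; rewrite /tor_class; congr (_ *m _); apply: eq_vec => -[|[|p]] B pB //=.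
  exact: e0.
exact: e1.
Qed.

Lemma tor_class_wedge l n u0 u1 :
  (tor_class n.+1 (wedge u0 (egen k l)) (wedge u1 (egen k l))
     - tor_class n u0 u1 *m gact N l n <= gbnd N n.+1)%MS.
Proof.
have := F_act l (low_family_closed n u0 u1); rewrite /tor_class.
set V := vec n.+1 _; set V' := vec n.+1 _; suff -> : V = V' by [].
apply: eq_vec => p B pB; rewrite !wedge_egen.
case: ifP => lB; last first.
  case: p pB => [|[|p]] pB /=; rewrite ?wedge_egen ?lB ?ffunE //.
have pD : (p + #|B :\ l| = n)%N.
  by move: pB; rewrite (cardsD1 l) lB addnCA add1n => -[].
rewrite fam_vec pD eqxx.
by case: p pB pD => [|[|p]] pB pD /=; rewrite ?wedge_egen ?lB // ext_0E ffunE scaler0.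
Qed.

Lemma total_boundary_bound n U : total_boundary U -> (vec n U *m F n <= gbnd N n)%MS.
Proof.
move=> [K [V [V0 UE]]].
have -> : vec n U = vec n (totau (maxn K n.+1) V).
  apply: eq_vec => p B _; rewrite UE.
  by rewrite (tot_widen tau_linear p (leq_maxl K n.+1) V0).
by rewrite -(vec_dTot tau_linear tau_degree V (leq_maxr K n.+1)) F_bound.
Qed.

Lemma tor_class_surj n (z : 'rV[k]_(gdim N n)) : (z <= gcyc N n)%MS ->
  exists u0 u1, (z - tor_class n u0 u1 <= gbnd N n)%MS.
Proof.
move=> /F_surj[v vc zv].
have [|U [Ub UE]] := @total_cycle n (fam v) _ vc.
  move=> p np; apply/ffunP => B; rewrite ext_0E; apply: fam_degree.
  by rewrite neq_ltn (leq_trans np) ?leq_addr ?orbT.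
exists (fam v 0%N - U 0%N), (fam v 1%N - U 1%N).
rewrite -[z](subrK (v *m F n)) -addrA addmx_sub // -mulmxBl.
suff -> : v - vec n (low_family (fam v 0%N - U 0%N) (fam v 1%N - U 1%N)) = vec n U.
  exact: total_boundary_bound.
apply/eqP; rewrite subr_eq -{1}[v]vec_fam -[vec n U]scale1r -vec_linear; apply/eqP.
apply: eq_vec => -[|[|p]] B _ /=; rewrite scale1r.
- by rewrite addrC subrK.
- by rewrite addrC subrK.
by rewrite UE // addr0.
Qed.

Lemma tor_class_kernel u0 u1 : (forall n, (tor_class n u0 u1 <= gbnd N n)%MS) <->
  exists w2 w3, u0 = @tau 2 0 w2 + @tau 3 0 w3 /\ u1 = @tau 3 1 w3.
Proof.
split=> [h|[w2 [w3 [-> ->]]] n].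
  apply: (@total_boundary_low (low_family u0 u1)) => [|[|[|p]]] //.
  pose G n := fam (vec n (low_family u0 u1)).
  have Gb n : total_boundary (G n).
    have [w wE] := F_inj (@low_family_closed n u0 u1) (h n).
    exists n.+1, (fam w); split=> [p np|p].
      apply/ffunP => B; rewrite ext_0E; apply: fam_degree.
      by rewrite neq_ltn (leq_trans np) ?leq_addr ?orbT.
    by rewrite /G wE (fam_dTot tau_linear tau_degree).
  (* Nonzero places are at most 1 and exterior degrees at most c, so the degrees 0 to c + 1 exhaust
     the family. *)
  apply: (eq_total_boundary _ (total_boundary_sum c.+2 Gb)) => p.
  apply/ffunP => B; rewrite sum_ffunE.
  under eq_bigr => n _ do rewrite /G fam_vec.
  have [lt|] := ltnP (p + #|B|) c.+2.
    rewrite (bigD1 (Ordinal lt)) //= eqxx big1 ?addr0 // => n /eqP ne.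
    by case: eqP => // e; case: ne; apply: val_inj.
  have Bc : (#|B| <= c)%N by rewrite -[X in (_ <= X)%N]card_ord max_card.
  case: p => [|[|p]] /=; last first.
  - by move=> _; rewrite big1 ?ffunE // => n _; rewrite if_same.
  - by rewrite add1n !ltnS leqNgt ltnS Bc.
  by rewrite add0n leqNgt ltnS (leqW Bc).
apply: total_boundary_bound.
apply: (eq_total_boundary _ (total_boundaryD (total_boundary_single w2)
  (total_boundary_single w3))) => -[|[|[|[|p]]]]; rewrite !tot_single //=.
- by rewrite tau_sub1 add0r.
- by rewrite tau_diag tau_sub1 addr0.
- by rewrite tau_diag addr0.
by rewrite addr0.
Qed.

(** * The submodule generated in degree 0 and its quotient *)

Local Notation gen := (gen_by_degree0 N).

Lemma gen_le_cycle n : (gen n <= gcyc N n)%MS.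
Proof.
have [bc cact _ _ _] := NE; elim: n => [|n IH] //=.
rewrite addsmx_sub bc; apply/sumsmx_subP => l _; rewrite genmxE.
exact: submx_trans (submxMr _ IH) (cact l n).
Qed.

Lemma bound_le_gen n : (gbnd N n <= gen n)%MS.
Proof. by have [bc _ _ _ _] := NE; case: n => [|n] //=; apply: addsmxSl. Qed.

Lemma gen_act l n : (gen n *m gact N l n <= gen n.+1)%MS.
Proof.
apply: submx_trans (addsmxSr _ _); rewrite -genmxE.
exact: (sumsmx_sup l).
Qed.

Lemma sub_degree0_Emodule : is_Emodule (sub_degree0 N).
Proof.
have [bc cact bact sq anti] := NE; split=> /= [n|l n|l n|l n|l l' n].
- exact: bound_le_gen.
- exact: gen_act.
- exact: bact.
- exact: submx_trans (submxMr _ (gen_le_cycle n)) (sq l n).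
- exact: submx_trans (submxMr _ (gen_le_cycle n)) (anti l l' n).
Qed.

Lemma quo_degree0_Emodule : is_Emodule (quo_degree0 N).
Proof.
have [bc cact bact sq anti] := NE; split=> /= [n|l n|l n|l n|l l' n].
- exact: gen_le_cycle.
- exact: cact.
- exact: gen_act.
- exact: submx_trans (sq l n) (bound_le_gen _).
- exact: submx_trans (anti l l' n) (bound_le_gen _).
Qed.

Lemma tor_class_cycle n u0 u1 : (tor_class n u0 u1 <= gcyc N n)%MS.
Proof. exact/F_cycle/low_family_closed. Qed.

Lemma tor_class_wedgel l n u0 :
  (tor_class n.+1 (wedge u0 (egen k l)) 0 - tor_class n u0 0 *m gact N l n
     <= gbnd N n.+1)%MS.
Proof. by have := tor_class_wedge l n u0 0; rewrite wedge0l. Qed.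

Lemma tor_class_sum n (I : finType) (G : I -> ext c 'rV[k]_(b 0)) :
  tor_class n (\sum_i G i) 0 = \sum_i tor_class n (G i) 0.
Proof.
apply: (big_morph (fun u => tor_class n u 0)) => [u v|]; last exact: tor_class0.
rewrite -{1}[u]scale1r -{1}[0](addr0 (0 : ext c 'rV[k]_(b 1))).
by rewrite -{1}[0](scaler0 _ (1 : k)) tor_class_linear scale1r.
Qed.

(** In degree 0 place 1 contributes nothing, so N_0 comes from place 0. In higher degree each e_B
    is, up to sign, a shorter product times some e_l, so the classes from place 0 are exactly those
    reached from N_0 by right multiplication. *)
Lemma genP n (z : 'rV[k]_(gdim N n)) : (z <= gen n)%MS <->
  exists u0, (z - tor_class n u0 0 <= gbnd N n)%MS.
Proof.
have [bc cact bact sq anti] := NE.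
suff {z} [h1 h2] : (forall z : 'rV[k]_(gdim N n), (z <= gen n)%MS ->
    exists u0, (z - tor_class n u0 0 <= gbnd N n)%MS) /\
    forall u0, (tor_class n u0 0 <= gen n)%MS.
  split=> [|[u0 zu]]; first exact: h1.
  rewrite -[z](subrK (tor_class n u0 0)) addmx_sub //.
  exact: submx_trans (bound_le_gen n).
elim: n => [|n [IH1 IH2]]; split.
- move=> z /tor_class_surj [u0 [u1]].
  rewrite (@eq_tor_class 0 u0 u0 u1 0) //.
  by exists u0.
- by move=> u0; apply: tor_class_cycle.
- move=> z /= /sub_addsmxP[[y1 y2] /= ->].
  have /sub_sumsmxP[y yE] : (y2 *m (\sum_(l < c) <<gen n *m gact N l n>>)%MS <=
      \sum_(l < c) <<gen n *m gact N l n>>)%MS by apply: submxMl.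
  have /fin_all_exists [x xE] l :
      exists x, y l *m <<gen n *m gact N l n>>%MS = x *m gen n *m gact N l n.
    have /submxP[x ->] : (y l *m <<gen n *m gact N l n>>%MS <= gen n *m gact N l n)%MS.
      by rewrite -(genmxE (gen n *m _)) submxMl.
    by exists x; rewrite mulmxA.
  have /fin_all_exists [u uE] l := IH1 (x l *m gen n) (submxMl _ _).
  exists (\sum_l wedge (u l) (egen k l)); rewrite yE tor_class_sum -addrA.
  apply: addmx_sub; first exact: submxMl.
  rewrite -sumrB; apply: summx_sub => l _; rewrite xE.
  rewrite -[_ *m gact N l n](subrK (tor_class n (u l) 0 *m gact N l n)).
  rewrite -mulmxBl -addrA; apply: addmx_sub.
    exact: submx_trans (submxMr _ (uE l)) (bact l n).
  by rewrite -opprB -scaleN1r scalemx_sub ?tor_class_wedgel.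
move=> u0; pose del B (x : 'rV[k]_(b 0)) : ext c 'rV[k]_(b 0) :=
  [ffun C : {set 'I_c} => if C == B then x else 0].
have -> : u0 = \sum_B del B (u0 B).
  apply/ffunP => C; rewrite sum_ffunE (bigD1 C) //= ffunE eqxx big1 ?addr0 // => B ne.
  by rewrite ffunE eq_sym (negbTE ne).
rewrite tor_class_sum; apply: summx_sub => B _.
have [Bn|Bn] := eqVneq #|B| n.+1; last first.
  rewrite (@eq_tor_class n.+1 _ 0 0 0) ?tor_class0 ?sub0mx // => C Cn.
  by rewrite !ffunE; case: eqP => // CB; rewrite -CB Cn eqxx in Bn.
have /set0Pn[l lB] : B != set0 by rewrite -card_gt0 Bn.
(* The exponent of the sign that [wedge_egen] produces when e_l multiplies e_(B - l); putting the
   same sign on the coefficient cancels it. *)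
pose s := #|[set x in B | (l < x)%N]|.
have -> : del B (u0 B) = wedge (del (B :\ l) ((-1) ^+ s *: u0 B)) (egen k l).
  apply/ffunP => C; rewrite wedge_egen !ffunE.
  case: ifP => [/eqP->|/eqP ne]; last first.
    case: ifP => // lC; case: eqP => [e|_]; last by rewrite scaler0.
    by case: ne; rewrite -(setD1K lC) e setD1K.
  by rewrite lB eqxx scalerA -expr2 sqrr_sign scale1r.
set u := del (B :\ l) _.
rewrite -[tor_class _ _ _](subrK (tor_class n u 0 *m gact N l n)).
apply: addmx_sub; first exact: submx_trans (tor_class_wedgel _ _ _) (bound_le_gen _).
exact: submx_trans (submxMr _ (IH2 _)) (gen_act l n).
Qed.

Definition tor_eps n (u : ext c 'rV[k]_(T_rank b 0)) : 'rV[k]_(gdim N n) :=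
  tor_class n (ext_fst u) (ext_snd u).

Lemma tor_class_degree m n u : ehomog (@T_deg b 0) m u -> m <> n -> tor_eps n u = 0.
Proof.
move=> /ehomog_T[h0 h1] mn; rewrite /tor_eps -(tor_class0 n).
apply: eq_tor_class => B Bn; rewrite ext_0E; apply/eqP; apply: contraT => /rV0Pn[j].
  by move=> /h0 e; case: mn; rewrite -e -Bn.
by move=> /h1 e; case: mn; rewrite -e -Bn.
Qed.

Lemma T_augmentation : augmentation (N := N) (@T_deg b 0) (@T_d 0) tor_eps.
Proof.
have [bc _ _ _ _] := NE.
split=> [|m n u hu mn|l n u|n z /tor_class_surj[u0 [u1 zu]]|u].
- split=> [n a u v|n u]; last exact: tor_class_cycle.
  by rewrite /tor_eps ext_fst_linear ext_snd_linear tor_class_linear.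
- by rewrite (tor_class_degree hu mn) sub0mx.
- by rewrite /tor_eps ext_fst_wedge ext_snd_wedge; apply: tor_class_wedge.
- by exists (ext_pair u0 u1); rewrite /tor_eps ext_pairK1 ext_pairK2.
rewrite tor_class_kernel; split=> [[w2 [w3 [e0 e1]]]|[w ->]].
  exists (ext_pair w2 w3); rewrite /T_d ext_pairK1 ext_pairK2.
  by rewrite -[u]ext_pair_eta e0 e1.
by exists (ext_fst w), (ext_snd w); rewrite /T_d ext_pairK1 ext_pairK2.
Qed.

Lemma up_augmentation : augmentation (N := sub_degree0 N) (@up_deg b 0)
  (@tau 2 0 : ext c 'rV[k]_(up_rank b 1) -> ext c 'rV[k]_(up_rank b 0))
  (fun n u => tor_eps n (ext_pair u 0)).
Proof.
have E n (u : ext c 'rV[k]_(b 0)) : tor_eps n (ext_pair u 0) = tor_class n u 0.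
  by rewrite /tor_eps ext_pairK1 ext_pairK2.
split=> [|m n u hu mn|l n u|n z /genP[u0 zu]|u] /=.
- split=> [n a u v|n u]; rewrite !E; last first.
    by apply/genP; exists u; rewrite subrr sub0mx.
  by rewrite -[X in tor_class n _ X](addr0 0) -{1}[0](scaler0 _ a) tor_class_linear.
- rewrite (tor_class_degree _ mn) ?sub0mx //; apply/ehomog_T.
  by rewrite ext_pairK1 ext_pairK2; split=> // B i; rewrite ffunE mxE eqxx.
- by rewrite !E tor_class_wedgel.
- by exists u0; rewrite E.
split=> [h|[w ->] n]; last first.
  rewrite E; apply: (tor_class_kernel _ _).2; exists w, 0.
  by rewrite !tau0 addr0.
have [|w2 [w3 [-> /esym/(@tau2_exact 1)[y ->]]]] := (tor_class_kernel u 0).1.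
  by move=> n; rewrite -E.
(* Here w3 = t_2 y, and t_3 t_2 y = - t_2 t_3 y. *)
exists (w2 - @tau 5 2 y); rewrite (linB (@tau_linear _ _)); congr (_ + _).
by have /eqP := tau2_tau3 y; rewrite addrC addr_eq0 => /eqP.
Qed.

Lemma low_augmentation : augmentation (N := quo_degree0 N) (@low_deg b 0)
  (@tau 3 1 : ext c 'rV[k]_(low_rank b 1) -> ext c 'rV[k]_(low_rank b 0))
  (fun n u => tor_eps n (ext_pair 0 u)).
Proof.
have E n (u : ext c 'rV[k]_(b 1)) : tor_eps n (ext_pair 0 u) = tor_class n 0 u.
  by rewrite /tor_eps ext_pairK1 ext_pairK2.
have EB n u0 u1 : tor_class n u0 u1 = tor_class n 0 u1 + tor_class n u0 0.
  by apply/eqP; rewrite -subr_eq -tor_classB subrr subr0.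
split=> [|m n u hu mn|l n u|n z /tor_class_surj[u0 [u1 zu]]|u] /=.
- split=> [n a u v|n u]; rewrite !E; last exact: tor_class_cycle.
  by rewrite -{1}[0](addr0 0) -{1}[0](scaler0 _ a) tor_class_linear.
- rewrite (tor_class_degree _ mn) ?sub0mx //; apply/ehomog_T.
  by rewrite ext_pairK1 ext_pairK2; split=> // B i; rewrite ffunE mxE eqxx.
- apply: submx_trans (bound_le_gen _); rewrite !E.
  by have := tor_class_wedge l n 0 u; rewrite wedge0l.
- exists u1; rewrite E; apply/genP; exists u0.
  by rewrite -addrA -opprD -EB.
split=> [h|[w ->] n].
  have /(_ _)/constructive_indefinite_description hn n :
      exists u0, (tor_class n 0 u - tor_class n u0 0 <= gbnd N n)%MS.
    by apply/genP; rewrite -E.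
  (* The witness is chosen for each n separately. In degree n only the coefficients with #|B| = n
     matter, so one u0 assembled by cardinality serves every n. *)
  pose u0 : ext c 'rV[k]_(b 0) := [ffun B : {set 'I_c} => sval (hn #|B|) B].
  have [|w2 [w3 [_ ->]]] := (tor_class_kernel (- u0) u).1; last by exists w3.
  move=> n; rewrite -[- u0]sub0r -[u]subr0 tor_classB.
  rewrite (@eq_tor_class n u0 (sval (hn n)) 0 0) //; first exact: (svalP (hn n)).
  by move=> B Bn; rewrite ffunE Bn.
(* t_2 w + t_3 w is the total boundary of w, so t_2 w at place 1 has the same class as - t_3 w at
   place 0. *)
rewrite E; apply/genP; exists (- @tau 3 0 w).
rewrite -tor_classB sub0r opprK subr0.
by apply: (tor_class_kernel _ _).2; exists 0, w; rewrite tau0 add0r.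
Qed.

End Augmentation.
End LinearStrands.

(** * From regularity to exactness of the strands *)

Section StrandExactness.
Variables (S : comNzRingType) (k : fieldType) (rho : {rmorphism S -> k}) (c : nat).
Hypothesis rho_surj : forall y, exists x, rho x = y.
Variables (f : 'I_c -> S) (b : nat -> nat) (dG : forall p, 'M[S]_(b p.+1, b p)).
Variable t : forall p r : nat,
  {linear ext c 'rV[S]_(b p) -> ext c 'rV[S]_(b r)}.
Hypothesis ht : higher_CI_operators f dG t.
Hypotheses (heven : has_regularity (parity_part false (Ext_R rho t)) 0)
  (hodd : has_regularity (parity_part true (Ext_R rho t)) 1).

(** Even p uses the bound 0 and odd p the bound 1; both are less than p + 2, so exactness starts at
    place 2 in one parity and at place 3 in the other. *)
Lemma tk2_exact p (u : ext c 'rV[k]_(b p.+2)) :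
  @tk S k rho c b t p.+2 p u = 0 ->
  exists w : ext c 'rV[k]_(b p.+4), u = @tk S k rho c b t p.+4 p.+2 w.
Proof.
rewrite (tk2_row_koszul rho_surj ht) => u0.
suff [w ->] : exists w, u = row_koszul (fun l => rchi (Ext_R rho t) l p.+2) w.
  by exists w; rewrite (tk2_row_koszul rho_surj ht).
case: (boolP (odd p)) => op.
  exact: (@regularity_row_exact _ _ (Ext_R rho t) true 1 p hodd op isT u u0).
exact: (@regularity_row_exact _ _ (Ext_R rho t) false 0 p heven (negbTE op) isT u u0).
Qed.

End StrandExactness.

Theorem theorem9p2
  (S : comNzRingType) (mm : S -> Prop) (hS : regular_local_ring mm)
  (k : fieldType) (rho : {rmorphism S -> k}) (hk : quotient_map rho mm)
  (c : nat) (f : 'I_c -> S) (hf : regular_sequence f)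
  (R : comNzRingType) (pi : {rmorphism S -> R})
  (hR : quotient_map pi (ideal_gen f))
  (M : lmodType R) (hM : fin_generated M)
  (* R (x) G is the minimal free resolution of M over R *)
  (b : nat -> nat) (dG : forall p, 'M[S]_(b p.+1, b p))
  (etaG : 'rV[R]_(b 0%N) -> M)
  (hG : free_resolution id (fun p => map_mx pi (dG p)) etaG)
  (hGmin : forall p i j, mm (dG p i j))
  (* CI operators and higher CI operators on G (x) K *)
  (t : forall p r : nat, {linear ext c 'rV[S]_(b p) -> ext c 'rV[S]_(b r)})
  (ht : higher_CI_operators f dG t)
  (* a free resolution F of M over S, with homotopies for the f_i *)
  (a : nat -> nat) (dF : forall n, 'M[S]_(a n.+1, a n))
  (etaF : 'rV[S]_(a 0%N) -> M) (hF : free_resolution pi dF etaF)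
  (sigma : 'I_c -> forall n, 'M[S]_(a n, a n.+1))
  (hsigma : homotopies f dF sigma)
  (heven : has_regularity (parity_part false (Ext_R rho t)) 0)
  (hodd : has_regularity (parity_part true (Ext_R rho t)) 1) :
  let T := Tor_S rho dF sigma in
  exists eps : forall n, ext c 'rV[k]_(T_rank b 0%N) -> 'rV[k]_(a n),
  [/\ minimal_free_resolution (N := T) (@T_deg b) (@T_diff S k rho c b t) eps,
      minimal_free_resolution (N := sub_degree0 T)
        (@up_deg b) (@up_diff S k rho c b t)
        (fun n u => eps n (ext_pair u 0)) &
      minimal_free_resolution (N := quo_degree0 T)
        (@low_deg b) (@low_diff S k rho c b t)
        (fun n u => eps n (ext_pair 0 u))].
Proof.
move=> T.
have [rho_surj rho_ker] := hk.
have [_ mmP] : local_ring mm by case: hS.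
have rho_f l : rho (f l) = 0.
  (* Outside the maximal ideal [f l] would be a unit, and the sequence would generate the unit
     ideal. *)
  apply/rho_ker/mmP => -[y fy]; case: hf => _; apply.
  exists (fun j => if j == l then y else 0).
  rewrite (bigD1 l) //= eqxx mulrC fy big1 ?addr0 // => j /negbTE->.
  exact: mul0r.
have rho_dG p : map_mx rho (dG p) = 0.
  by apply/matrixP => i j; rewrite !mxE; apply/rho_ker.
pose tf p r : ext c 'rV[S]_(b p) -> ext c 'rV[S]_(b r) := t p r.
pose tau := @tk S k rho c b tf.
have lin p r : linear (@tau p r) by apply: tk_linear.
have deg := tk_degree rho_surj ht.
have diag := tk_diag rho_surj ht rho_f.
have sub1 := tk_sub1 rho_surj ht rho_dG.
have wdg := tk_wedge rho_surj ht.
have sq := tk_square rho_surj ht.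
have ex := tk2_exact rho_surj ht heven hodd.
have [_ _ _ exF] := hF.
have NE : is_Emodule T := Tor_S_Emodule exF hsigma rho_f.
have [F [Fcyc Fbnd Finj Fsurj Fact]] := comparison rho
  (total_free_resolution hf hR hG ht) (total_homotopies ht) hF hsigma.
have closedP n (v : 'rV[k]_(tot_rank c b n)) :
    (v <= cycles (fun p => map_mx rho (dTot tf p)) n)%MS <-> closed tau v.
  case: n v => [|n] v.
    (* [cycles] is everything in degree 0, in accordance with t_0 = 0 modulo the maximal ideal. *)
    split=> _; last exact: submx1.
    move=> p; rewrite /tot big1 // => q; rewrite (ord1 q) leqn0 => /eqP->.
    exact: diag.
  rewrite cycles_mulmx (map_dTot rho t); split=> [/eqP v0 p|v0].
    by rewrite -(fam_dTot lin deg) v0 (lin0 (@fam_linear _ _ _ _ p)).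
  apply/eqP/fam_inj => p; rewrite (fam_dTot lin deg) v0.
  by rewrite (lin0 (@fam_linear _ _ _ _ p)).
have boundP n (w : 'rV[k]_(tot_rank c b n)) :
    (w <= bounds (fun p => map_mx rho (dTot tf p)) n)%MS <->
    exists w', w = w' *m dTot tau n.
  rewrite genmxE (map_dTot rho t); split=> [/submxP//|[w' ->]].
  exact: submxMl.
have F1 n (v : 'rV[k]_(tot_rank c b n)) : closed tau v -> (v *m F n <= gcyc T n)%MS.
  by move=> /closedP; apply: Fcyc.
have F2 n (w : 'rV[k]_(tot_rank c b n.+1)) : (w *m dTot tau n *m F n <= gbnd T n)%MS.
  by apply: Fbnd; apply/boundP; exists w.
have F3 n (v : 'rV[k]_(tot_rank c b n)) : closed tau v ->
    (v *m F n <= gbnd T n)%MS -> exists w, v = w *m dTot tau n.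
  by move=> /closedP vc vb; apply/boundP; apply: Finj.
have F4 n (z : 'rV[k]_(gdim T n)) : (z <= gcyc T n)%MS ->
    exists2 v, closed tau v & (z - v *m F n <= gbnd T n)%MS.
  by move=> /Fsurj[v /closedP vc zv]; exists v.
have F5 l n (v : 'rV[k]_(tot_rank c b n)) : closed tau v ->
    (vec n.+1 (fun p => wedge (fam v p) (egen k l)) *m F n.+1
     - v *m F n *m gact T l n <= gbnd T n.+1)%MS.
  move=> /closedP/(Fact l); rewrite map_rmul_mx mulmx_rmul => h.
  rewrite /= -scalemxAr; set V := vec _ _ in h *.
  (* The sign (-1)^n of the homotopy [rmul_mx] and the one relating left and right actions in
     [Tor_S] coincide, so wedging with e_l corresponds to the right action without sign. *)
  have -> : V *m F n.+1 - (-1) ^+ n *: (v *m F n *m map_mx rho (sigma l n)) =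
      (-1) ^+ n *: ((-1) ^+ n *: V *m F n.+1 - v *m F n *m map_mx rho (sigma l n)).
    by rewrite scalerBr -scalemxAl scalerA -expr2 sqrr_sign scale1r.
  exact: scalemx_sub.
exists (@tor_eps k c b T F); split; split.
- exact: NE.
- exact: (T_minimal_exact lin deg diag sub1 wdg sq ex).
- exact: (T_augmentation lin deg diag sub1 sq ex NE F1 F2 F3 F4 F5).
- exact: (sub_degree0_Emodule NE).
- exact: (up_minimal_exact lin deg diag sub1 wdg sq ex).
- exact: (up_augmentation lin deg diag sub1 sq ex NE F1 F2 F3 F4 F5).
- exact: (quo_degree0_Emodule NE).
- exact: (low_minimal_exact lin deg diag sub1 wdg sq ex).
exact: (low_augmentation lin deg diag sub1 sq ex NE F1 F2 F3 F4 F5).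
Qed.
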